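(* Let $\alpha$ be a complex number with $\alpha\neq 0$ and $\alpha^2\neq -1$. On a space with coordinates $(x,y,z,p,q)$ with $y\ne\alpha$, put $$\sigma_1=i(dy+y\,dz)-i(y^2-1)(dp-p\,dz),\quad \sigma_2=dy+y\,dz-(y^2+1)(dp-p\,dz),\quad \sigma_3=-2iy(dp-p\,dz)+i\,dz,$$ and $$\omega_1=\sigma_1-i e^{\alpha x}\,dq,\qquad \omega_2=\sigma_2+dx,\qquad \omega_3=\sigma_3+i\alpha e^{\alpha x}\,dq .$$ By the change of coordinates $$(\bar x,\bar y,\bar z,\bar p,\bar q)=\left(2e^{z-\alpha x},\; q-\tfrac1\alpha e^{-\alpha x}-2p\,e^{-\alpha x},\; -\tfrac{\alpha y+1}{\alpha}e^{z},\; -e^{-z}p,\; -\frac{1}{4e^{2z-\alpha x}(y-\alpha)}\right),$$ the 1-forms $\omega_1,\omega_2,\omega_3$ can be brought into the Monge normal form $$d\bar y-\bar p\,d\bar x,\qquad d\bar p-\bar q\,d\bar x,\qquad d\bar z-\left(\bar q\,\bar z^2-\frac{1}{\alpha^2+1}\Big(\sqrt{\bar q}\,\bar z-\frac{1}{2\sqrt{\bar q}\,\bar x}\Big)^2\right)d\bar x ,$$ i.e. the span of $\omega_1,\omega_2,\omega_3$ equals the span of these three 1-forms (expressed in $(x,y,z,p,q)$ by substituting $\bar x=2e^{z-\alpha x}$, $\bar y=q-\tfrac1\alpha e^{-\alpha x}-2p\,e^{-\alpha x}$, $\bar z=-\tfrac{\alpha y+1}{\alpha}e^{z}$, $\bar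 p=-e^{-z}p$, $\bar q=-\frac{1}{4e^{2z-\alpha x}(y-\alpha)}$). Moreover, the rank 2 distribution annihilated by $\omega_1,\omega_2,\omega_3$ is maximally symmetric whenever $\alpha^2=-\frac19$ or $\alpha^2=-9$.
   Context: Here $i^2=-1$. Since $\alpha$ and the forms are complex, everything is understood over $\mathbb C$: $(x,y,z,p,q)$ are treated as local (holomorphic) coordinates, 1-forms have complex-analytic coefficients, and spans are over complex-valued functions. The expression $\big(\sqrt{\bar q}\,\bar z-\frac{1}{2\sqrt{\bar q}\,\bar x}\big)^2$ means $\bar q\bar z^2-\frac{\bar z}{\bar x}+\frac{1}{4\bar q\bar x^2}$, so it does not depend on the branch of the square root. A $(2,3,5)$-distribution is a rank 2 distribution $\mathcal D$ on a 5-manifold such that $[\mathcal D,\mathcal D]$ has rank 3 and $[\mathcal D,[\mathcal D,\mathcal D]]$ is the full tangent bundle. Given such $\mathcal D$, Cartan's method of equivalence produces a coframe $(\theta_1,\dots,\theta_5)$, with $\mathcal D$ the common kernel of $\theta_1,\theta_2,\theta_3$, satisfying, for some 1-forms $\Omega_1,\dots,\Omega_7$, $$\begin{aligned} d\theta_1&=\theta_1\wedge(2\Omega_1+\Omega_4)+\theta_2\wedge\Omega_2+\theta_3\wedge\theta_4,\\ d\theta_2&=\theta_1\wedge\Omega_3+\theta_2\wedge(\Omega_1+2\Omega_4)+\theta_3\wedge\theta_5,\\ d\theta_3&=\theta_1\wedge\Omega_5+\theta_2\wedge\Omega_6+\theta_3\wedge(\Omega_1+\Omega_4)+\theta_4\wedge\theta_5,\\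 d\theta_4&=\theta_1\wedge\Omega_7+\tfrac43\theta_3\wedge\Omega_6+\theta_4\wedge\Omega_1+\theta_5\wedge\Omega_2,\\ d\theta_5&=\theta_2\wedge\Omega_7-\tfrac43\theta_3\wedge\Omega_5+\theta_4\wedge\Omega_3+\theta_5\wedge\Omega_4 . \end{aligned}$$ The metric $g=2\theta_1\theta_5-2\theta_2\theta_4+\frac43\theta_3\theta_3$ represents a conformal class canonically attached to $\mathcal D$ (Nurowski's conformal structure). The distribution is called maximally symmetric when $g$ has vanishing Weyl tensor (equivalently, its local symmetry algebra is $\mathfrak g_2$, so it is locally equivalent to the flat model). *)

(* Defs.v *)
From mathcomp Require Import all_boot all_order all_algebra.
From mathcomp Require Import complex ring.
From mathcomp Require Import boolp classical_sets functions reals.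
From mathcomp Require Import topology normedtype derive sequences exp trigo.

Set Implicit Arguments.
Unset Strict Implicit.
Unset Printing Implicit Defensive.

Import Order.TTheory GRing.Theory Num.Theory.
Import numFieldNormedType.Exports.

Local Open Scope classical_set_scope.
Local Open Scope ring_scope.

(* All indices are shifted by one: theta 0, ..., theta 4 stand for
   theta_1, ..., theta_5, and similarly for the other families. *)

(* R[i] with its type class structures packaged, which makes its topology as a
   numFieldType available. It is the base field below, so that differentiable
   and 'D_v are complex differentiability and complex derivatives. *)
Definition CC (R : realType) : numClosedFieldType := complex R.

(* Points, tangent vectors and covectors of C^5 are all row vectors; the
   coefficient of the k-th coordinate differential in the covector a is a 0 k. *)
Notation C5 R := 'rV[CC R]_5.

Section ComplexExponential.
Variable R : realType.

Definition cexp (z : CC R) : CC R :=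
  Complex (expR (complex.Re z) * cos (complex.Im z))
          (expR (complex.Re z) * sin (complex.Im z)).

End ComplexExponential.

Section HolomorphicCalculus.
Variable R : realType.
Local Notation C := (CC R).
Local Notation C5 := (C5 R).

Definition holo (V : normedModType C) (U : set C5) (f : C5 -> V) : Prop :=
  forall u, U u -> differentiable f u.

Definition ebasis (k : 'I_5) : C5 := delta_mx 0 k.

Definition pd (k : 'I_5) (f : C5 -> C) (u : C5) : C := 'D_(ebasis k) f u.

Definition fdiff (f : C5 -> C) (u : C5) : C5 := \row_k pd k f u.

Definition pairing (a v : C5) : C := \sum_k a 0 k * v 0 k.

(* A 2-form is given by the skew-symmetric matrix of its values on pairs of
   coordinate vector fields, with the convention
   (a /\ b)(v, w) = a(v) b(w) - a(w) b(v). *)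
Definition wedge (a b : C5) : 'M[C]_5 := a^T *m b - b^T *m a.

Definition extd (w : C5 -> C5) (u : C5) : 'M[C]_5 :=
  \matrix_(j, k) (pd j (fun v => w v 0 k) u - pd k (fun v => w v 0 j) u).

Definition pullback (Phi : C5 -> C5) (eta : C5 -> C5) (u : C5) : C5 :=
  \sum_k eta (Phi u) 0 k *: fdiff (fun v => Phi v 0 k) u.

Definition lie_bracket (V W : C5 -> C5) (u : C5) : C5 :=
  'D_(V u) W u - 'D_(W u) V u.

Definition form_span n (U : set C5) (w : 'I_n -> C5 -> C5) : set (C5 -> C5) :=
  [set eta | exists f : 'I_n -> C5 -> C,
     forall u, U u -> eta u = \sum_k f k u *: w k u].

(* Local biholomorphism at every point of U. *)
Definition local_coordinates (U : set C5) (Phi : C5 -> C5) : Prop :=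
  holo U Phi /\
  forall u, U u -> exists (W W' : set C5) (Psi : C5 -> C5),
    [/\ [/\ open W, W u & W `<=` U], open W' /\ holo W' Psi,
        forall v, W v -> W' (Phi v) /\ Psi (Phi v) = v &
        forall v, W' v -> W (Psi v) /\ Phi (Psi v) = v].

End HolomorphicCalculus.

Section Distributions.
Variable R : realType.
Local Notation C := (CC R).
Local Notation C5 := (C5 R).

Definition annihilator n (w : 'I_n -> C5 -> C5) (u : C5) : set C5 :=
  [set v | forall k, pairing (w k u) v = 0].

Definition is_distribution (U : set C5) (r : nat) (D : C5 -> set C5) : Prop :=
  forall u, U u -> exists (W : set C5) (B : 'I_r -> C5 -> C5),
    [/\ [/\ open W, W u & W `<=` U],
        forall k, holo W (B k) &
        forall v, W v ->
          row_free (\matrix_(k < r) B k v) /\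
          D v = [set X | (X <= \matrix_(k < r) B k v)%MS]].

Definition vspan (S : set C5) : set C5 :=
  [set X | exists n (B : 'I_n -> C5),
     (forall k, S (B k)) /\ (X <= \matrix_(k < n) B k)%MS].

Definition local_section (D : C5 -> set C5) (u : C5) (V : C5 -> C5) : Prop :=
  \forall v \near u, differentiable V v /\ D v (V v).

(* [D, E], spanned by E and the brackets of local sections of D and E. *)
Definition dist_bracket (D E : C5 -> set C5) (u : C5) : set C5 :=
  vspan (E u `|` [set X | exists V W : C5 -> C5,
    [/\ local_section D u V, local_section E u W & X = lie_bracket V W u]]).

Definition is_235_distribution (U : set C5) (D : C5 -> set C5) : Prop :=
  [/\ is_distribution U 2 D,
      is_distribution U 3 (dist_bracket D D) &
      forall u, U u -> dist_bracket D (dist_bracket D D) u = setT].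

Definition cartan_coframe (W : set C5) (D : C5 -> set C5)
    (th : 'I_5 -> C5 -> C5) (Om : 'I_7 -> C5 -> C5) : Prop :=
  [/\ (forall k, holo W (th k)) /\ (forall k, holo W (Om k)),
      forall u, W u -> row_free (\matrix_(k < 5) th k u),
      forall u, W u ->
        D u = annihilator (tnth [tuple th 0; th 1; th 2]) u &
      forall u, W u ->
      let t k := th k u in let O k := Om k u in
      [/\ extd (th 0) u = wedge (t 0) (2 *: O 0 + O 3) + wedge (t 1) (O 1)
                          + wedge (t 2) (t 3),
          extd (th 1) u = wedge (t 0) (O 2) + wedge (t 1) (O 0 + 2 *: O 3)
                          + wedge (t 2) (t 4),
          extd (th 2) u = wedge (t 0) (O 4) + wedge (t 1) (O 5)
                          + wedge (t 2) (O 0 + O 3) + wedge (t 3) (t 4),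
          extd (th 3) u = wedge (t 0) (O 6) + (4 / 3) *: wedge (t 2) (O 5)
                          + wedge (t 3) (O 0) + wedge (t 4) (O 1) &
          extd (th 4) u = wedge (t 1) (O 6) - (4 / 3) *: wedge (t 2) (O 4)
                          + wedge (t 3) (O 2) + wedge (t 4) (O 3)]].

End Distributions.

Section Weyl.
Variable R : realType.
Local Notation C := (CC R).
Local Notation C5 := (C5 R).
Variable g : C5 -> 'M[C]_5.

(* christoffel u i j k is Gamma^i_(j k). *)
Definition christoffel (u : C5) (i j k : 'I_5) : C :=
  2^-1 * \sum_m invmx (g u) i m *
    (pd j (fun v => g v m k) u + pd k (fun v => g v m j) u
     - pd m (fun v => g v j k) u).

(* riemann u i j k l is R^i_(j k l), the i-th component of R(d_k, d_l) d_j. *)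
Definition riemann (u : C5) (i j k l : 'I_5) : C :=
  pd k (fun v => christoffel v i l j) u - pd l (fun v => christoffel v i k j) u
  + \sum_m (christoffel u i k m * christoffel u m l j
            - christoffel u i l m * christoffel u m k j).

Definition riemann_low (u : C5) (i j k l : 'I_5) : C :=
  \sum_m g u i m * riemann u m j k l.

Definition ricci (u : C5) (j l : 'I_5) : C := \sum_i riemann u i j i l.

Definition scalar_curvature (u : C5) : C :=
  \sum_j \sum_l invmx (g u) j l * ricci u j l.

(* The constants are 1/(n-2) and 1/((n-1)(n-2)) with n = 5. *)
Definition weyl (u : C5) (i j k l : 'I_5) : C :=
  riemann_low u i j k l
  - 3^-1 * (ricci u i k * g u j l - ricci u i l * g u j k
            + ricci u j l * g u i k - ricci u j k * g u i l)
  + 12^-1 * scalar_curvature u * (g u i k * g u j l - g u i l * g u j k).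

End Weyl.

Section MaximalSymmetry.
Variable R : realType.
Local Notation C := (CC R).
Local Notation C5 := (C5 R).

(* In 2 a b the product of 1-forms is the symmetric product
   (a (x) b + b (x) a) / 2. *)
Definition nurowski_metric (th : 'I_5 -> C5 -> C5) (u : C5) : 'M[C]_5 :=
  let t k := th k u in
  ((t 0)^T *m t 4 + (t 4)^T *m t 0) - ((t 1)^T *m t 3 + (t 3)^T *m t 1)
  + (4 / 3) *: ((t 2)^T *m t 2).

Definition maximally_symmetric (U : set C5) (D : C5 -> set C5) : Prop :=
  is_235_distribution U D /\
  forall u, U u -> exists (W : set C5) (th : 'I_5 -> C5 -> C5)
                          (Om : 'I_7 -> C5 -> C5),
    [/\ [/\ open W, W u & W `<=` U], cartan_coframe W D th Om &
        forall v, W v ->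
          forall i j k l, weyl (nurowski_metric th) v i j k l = 0].

End MaximalSymmetry.

Section RollingForms.
Variables (R : realType) (alpha : CC R).
Local Notation C := (CC R).
Local Notation C5 := (C5 R).

Definition xc (u : C5) : C := u 0 0.
Definition yc (u : C5) : C := u 0 1.
Definition zc (u : C5) : C := u 0 2.
Definition pc (u : C5) : C := u 0 3.
Definition qc (u : C5) : C := u 0 4.

Local Notation dx := (@ebasis R 0).
Local Notation dy := (@ebasis R 1).
Local Notation dz := (@ebasis R 2).
Local Notation dp := (@ebasis R 3).
Local Notation dq := (@ebasis R 4).

Definition sigma1 (u : C5) : C5 :=
  'i *: (dy + yc u *: dz) - ('i * (yc u ^+ 2 - 1)) *: (dp - pc u *: dz).
Definition sigma2 (u : C5) : C5 :=
  dy + yc u *: dz - (yc u ^+ 2 + 1) *: (dp - pc u *: dz).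
Definition sigma3 (u : C5) : C5 :=
  - (2 * 'i * yc u) *: (dp - pc u *: dz) + 'i *: dz.

Definition omega1 (u : C5) : C5 :=
  sigma1 u - ('i * cexp (alpha * xc u)) *: dq.
Definition omega2 (u : C5) : C5 := sigma2 u + dx.
Definition omega3 (u : C5) : C5 :=
  sigma3 u + ('i * alpha * cexp (alpha * xc u)) *: dq.

Definition omega : 'I_3 -> C5 -> C5 := tnth [tuple omega1; omega2; omega3].

Definition bar_coordinates (u : C5) : C5 :=
  let x := xc u in let y := yc u in let z := zc u in
  let p := pc u in let q := qc u in
  \row_k [tuple 2 * cexp (z - alpha * x);
                q - alpha^-1 * cexp (- (alpha * x))
                  - 2 * p * cexp (- (alpha * x));
                - ((alpha * y + 1) / alpha) * cexp z;
                - cexp (- z) * p;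
                - (4 * cexp (2 * z - alpha * x) * (y - alpha))^-1]`_k.

(* (sqrt q * z - 1 / (2 * sqrt q * x)) ^ 2, expanded; see monge_squareE. *)
Definition monge_square (x z q : C) : C :=
  q * z ^+ 2 - z / x + (4 * q * x ^+ 2)^-1.

(* Here the coordinates (x, y, z, p, q) are the barred ones. *)
Definition monge1 (u : C5) : C5 := dy - pc u *: dx.
Definition monge2 (u : C5) : C5 := dp - qc u *: dx.
Definition monge3 (u : C5) : C5 :=
  dz - (qc u * zc u ^+ 2
        - (alpha ^+ 2 + 1)^-1 * monge_square (xc u) (zc u) (qc u)) *: dx.

Definition monge : 'I_3 -> C5 -> C5 := tnth [tuple monge1; monge2; monge3].

End RollingForms.

Lemma monge_squareE (R : realType) (x z s : CC R) : x != 0 -> s != 0 ->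
  (s * z - (2 * s * x)^-1) ^+ 2 = monge_square x z (s ^+ 2).
Proof. by move=> x0 s0; rewrite /monge_square; field; rewrite s0 x0. Qed.

(* Main.v *)
From HB Require Import structures.
Require Import Defs.
From mathcomp Require Import all_boot all_order all_algebra.
From mathcomp Require Import complex ring lra.
From mathcomp Require Import boolp classical_sets functions reals.
From mathcomp Require Import topology normedtype derive sequences exp trigo.

Set Implicit Arguments.
Unset Strict Implicit.
Unset Printing Implicit Defensive.

Import Order.TTheory GRing.Theory Num.Theory.
Import numFieldNormedType.Exports.
Local Open Scope classical_set_scope.
Local Open Scope ring_scope.

(** In the coframe
      e1 = alpha (dy + y dz - y^2 P),  e2 = alpha P,  e3 = dz - 2 y P,
      e4 = alpha/2 (dx - A dq),  e5 = alpha/2 (dx + A dq),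
    where P = dp - p dz and A = exp (alpha x), the omega_k and the exterior
    derivatives of the coframe have constant coefficients.  The structure
    equations are
      de1 = e1 /\ e3,  de2 = - e2 /\ e3,  de3 = - (2 / alpha^2) e1 /\ e2,
      de4 = - e4 /\ e5,  de5 = e4 /\ e5,
    those of the left-invariant forms on the product of SL(2) and the affine
    group of the line ([coframe_structure]), and omega1, omega2, omega3 span
    the same forms as
      theta_0 = e1 + e4,  theta_1 = e2 - e5,  theta_2 = e3 - e4 + e5
    ([span_omega], [annihilator_omega]).  Each assertion becomes a question
    about these three forms.

    Coordinates.  Put Z = exp z.  The barred coordinates are rational in
    y, p, q, A, Z; the functions Z, A and y are recovered from bar x, bar z,
    bar q by formulas that need alpha^2 + 1 <> 0, after which p and q come out
    linearly.  Taking branches of the logarithm of A and Z near a base point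
    gives a holomorphic local inverse ([bar_local_coordinates]).

    Monge form.  The pulled back Monge forms are combinations of the theta_k,
    and the transition matrix is triangular with nonvanishing diagonal once
    the forms are taken in the order theta_1, theta_2, theta_0
    ([monge_rows], [contact_rows_monge], [span_monge]).

    Growth vector.  Brackets of the fields dual to the coframe are constant
    combinations of these fields ([lie_bracket_invariant]).  Cartan's formula
    ([extd_lie_bracket]) shows that the brackets of arbitrary sections of the
    distribution are annihilated by theta_0 and theta_1, so the rank grows to
    at most 3.  The bracket of the two generators has the coefficient
    - 2 (alpha^2 + 1) / alpha^2 along the third direction, which is where
    alpha^2 <> -1 makes the growth vector equal to (2,3,5)
    ([contact_is_235]).

    Flatness.  For alpha^2 = -9 and alpha^2 = -1/9 Cartan's structure
    equations have a solution with constant coefficients in the coframe e, so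
    Nurowski's metric g has constant coefficients as well.  The connection
    matrices of g are then constant, and so is its curvature tensor, which
    turns out to be the Kulkarni-Nomizu product of g with a symmetric tensor.
    A curvature tensor of this shape has zero Weyl part
    ([weyl_kulkarni_nomizu], [frame_weyl]).  What remains is a finite set of
    identities between rational numbers, which are cleared of denominators and
    decided by computation with integers ([check1], [check2],
    [cartan_check1], [cartan_check2]). *)

(** * Metric connections in a moving frame *)

Lemma commutator_entry (F : pzRingType) n (A B : 'M[F]_n) i j :
  (A *m B - B *m A) i j = \sum_m (A i m * B m j - B i m * A m j).
Proof. by rewrite !mxE -sumrB. Qed.

Section FrameAlgebra.
Variables (F : numFieldType) (n : nat).
Local Notation M := 'M[F]_n.

(** Uniqueness of the Levi-Civita connection: the Christoffel symbols are the
    only torsion-free solution of the equation of metricity.  [dg k] stands for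
    the k-th partial derivative of the metric. *)
Lemma christoffel_unique (g gi : M) (dg T : 'I_n -> M) :
  gi *m g = 1%:M -> g^T = g ->
  (forall k, dg k = (T k)^T *m g + g *m T k) ->
  (forall i j k, T k i j = T j i k) ->
  forall i j k,
    2^-1 * \sum_m gi i m * (dg j m k + dg k m j - dg m j k) = T k i j.
Proof.
move=> gig gs dgE Ts i j k.
pose L k := g *m T k.
have Ls m a b : L a m b = L b m a.
  by rewrite !mxE; apply: eq_bigr => l _; rewrite Ts.
have dgL a m b : dg a m b = L a b m + L a m b.
  rewrite dgE mxE; congr (_ + _).
  by rewrite -[g in X in X = _]gs -trmx_mul mxE.
have E m : dg j m k + dg k m j - dg m j k = 2 * L k m j.
  by rewrite !dgL (Ls m j k) (Ls k j m) (Ls j k m); ring.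
under eq_bigr do rewrite E mulrCA.
rewrite -mulr_sumr mulKf ?pnatr_eq0 //.
have -> : T k = gi *m L k by rewrite mulmxA gig mul1mx.
by rewrite mxE.
Qed.

(** The matrix [E] is the coframe, [N] its inverse, [dE k] the k-th partial
    derivative of [E], [G] the constant matrix of the metric in the coframe.
    The matrices [w c] are the connection coefficients and [S a] the structure
    constants, d(e_a) being the 2-form with matrix [S a] in the coframe. *)
Variables (E N G : M) (w S : 'I_n -> M) (dE : 'I_n -> M).
Hypothesis NE : N *m E = 1%:M.
Hypothesis metric : forall c, G *m w c + (w c)^T *m G = 0.
Hypothesis torsion : forall a c d, S a c d = w d a c - w c a d.
Hypothesis structure : forall a k j,
  dE k a j - dE j a k = \sum_c \sum_d E c k * S a c d * E d j.

Definition frame_connection k : M := \sum_c E c k *: w c.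
Local Notation W := frame_connection.
(** The gauge transformation from the frame [E] to the coordinate frame. *)
Definition coord_connection k : M := N *m (dE k + W k *m E).
Local Notation T := coord_connection.

Lemma mulE_connection k : E *m T k = dE k + W k *m E.
Proof. by rewrite mulmxA (mulmx1C NE) mul1mx. Qed.

Lemma coord_connection_metric k :
  (dE k)^T *m G *m E + E^T *m G *m dE k =
  (T k)^T *m (E^T *m G *m E) + (E^T *m G *m E) *m T k.
Proof.
have GW : G *m W k + (W k)^T *m G = 0.
  rewrite /W [X in X *m G]linear_sum mulmx_sumr mulmx_suml -big_split big1 // => c _ /=.
  by rewrite -scalemxAr [X in _ + X *m _]linearZ /= -scalemxAl -scalerDr metric scaler0.
have -> : E^T *m G *m E *m T k = E^T *m G *m (dE k + W k *m E).
  by rewrite -[LHS]mulmxA mulE_connection.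
have -> : (T k)^T *m (E^T *m G *m E) = (dE k + W k *m E)^T *m G *m E.
  by rewrite -mulE_connection; move: (T k) => t; rewrite trmx_mul !mulmxA.
rewrite linearD /= trmx_mul !mulmxDl mulmxDr.
rewrite addrACA -[LHS]addr0; congr (_ + _); apply/esym.
have -> : E^T *m (W k)^T *m G *m E + E^T *m G *m (W k *m E) =
    E^T *m (G *m W k + (W k)^T *m G) *m E.
  by rewrite mulmxDr mulmxDl addrC !mulmxA.
by rewrite GW mulmx0 mul0mx.
Qed.

Lemma coord_connection_sym i j k : T k i j = T j i k.
Proof.
rewrite !mxE; apply: eq_bigr => a _; congr (_ * _).
apply/eqP; rewrite -subr_eq0; apply/eqP.
have WE l m : (W l *m E) a m = \sum_c \sum_d E c l * w c a d * E d m.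
  rewrite exchange_big mxE; apply: eq_bigr => d _.
  rewrite /W summxE mulr_suml; apply: eq_bigr => c _.
  by rewrite mxE.
rewrite [(dE k + _) a j]mxE [(dE j + _) a k]mxE !WE.
rewrite [X in _ - (_ + X)]exchange_big opprD addrACA structure.
rewrite -sumrB -big_split big1 //= => c _.
rewrite -sumrB -big_split big1 //= => d _.
by rewrite torsion; ring.
Qed.

(** The matrix of R(X_c, X_d) on the dual frame X: the [w c] are constant,
    so the derivatives of the connection contribute only - w([X_c, X_d]). *)
Definition frame_curvature c d : M :=
  w c *m w d - w d *m w c + \sum_e S e c d *: w e.

(** The curvature 2-form dW + W /\ W, where W is the sum of the e_c w_c; the
    structure equations replace the derivatives of the coframe. *)
Lemma frame_curvatureE k l :
  \sum_e dE k e l *: w e - \sum_e dE l e k *: w e + W k *m W l - W l *m W k =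
  \sum_c \sum_d (E c k * E d l) *: frame_curvature c d.
Proof.
have WW a b : W a *m W b = \sum_c \sum_d (E c a * E d b) *: (w c *m w d).
  rewrite mulmx_suml; apply: eq_bigr => c _; rewrite mulmx_sumr.
  by apply: eq_bigr => d _; rewrite -scalemxAl -scalemxAr scalerA.
have -> : \sum_e dE k e l *: w e - \sum_e dE l e k *: w e =
    \sum_c \sum_d (E c k * E d l) *: \sum_e S e c d *: w e.
  rewrite -sumrB; under eq_bigr => e _ do rewrite -scalerBl structure scaler_suml.
  rewrite exchange_big; apply: eq_bigr => c _ /=.
  under eq_bigr => e _ do rewrite scaler_suml.
  rewrite exchange_big; apply: eq_bigr => d _ /=.
  rewrite scaler_sumr; apply: eq_bigr => e _; rewrite scalerA; congr (_ *: _); ring.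
rewrite !WW [X in _ - X]exchange_big -addrA -sumrB -big_split; apply: eq_bigr => c _ /=.
rewrite -sumrB -big_split; apply: eq_bigr => d _ /=.
rewrite [E d l * E c k]mulrC -scalerBr -scalerDr; congr (_ *: _).
by rewrite /frame_curvature addrC.
Qed.

(** Curvature transforms by conjugation under the gauge transformation.  The
    matrices [dTkl], [ddEkl] stand for the derivatives of [T l] and [dE l] in
    the direction k; the first two hypotheses are the derivatives of
    [mulE_connection], and the last one is the symmetry of second derivatives,
    which is the only analytic input. *)
Lemma coord_curvatureE k l (dTkl dTlk ddEkl ddElk : M) :
  dE k *m T l + E *m dTkl =
    ddEkl + ((\sum_e dE k e l *: w e) *m E + W l *m dE k) ->
  dE l *m T k + E *m dTlk =
    ddElk + ((\sum_e dE l e k *: w e) *m E + W k *m dE l) ->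
  ddEkl = ddElk ->
  E *m (dTkl - dTlk + (T k *m T l - T l *m T k)) =
  (\sum_c \sum_d (E c k * E d l) *: frame_curvature c d) *m E.
Proof.
move=> /(canRL (addKr _)) Hkl /(canRL (addKr _)) Hlk ddE.
rewrite mulmxDr !mulmxBr Hkl Hlk -frame_curvatureE.
have ETT a b : E *m (T a *m T b) = dE a *m T b + (W a *m dE b + W a *m W b *m E).
  by rewrite mulmxA mulE_connection mulmxDl -!mulmxA mulE_connection mulmxDr !mulmxA.
rewrite !ETT ddE !mulmxDl !mulNmx.
move: (dE k *m T l) (dE l *m T k) (W k *m dE l) (W l *m dE k) => a b c d.
move: (_ *m E) (_ *m E) (_ *m E) (_ *m E) => x y z t.
apply/matrixP => i j; rewrite !mxE; ring.
Qed.

End FrameAlgebra.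

Section KulkarniNomizu.
Variables (F : numFieldType).

Definition kulkarni_nomizu n (p g : 'M[F]_n) i j k l :=
  p i k * g j l - p i l * g j k + g i k * p j l - g i l * p j k.

(** The Kulkarni-Nomizu product is natural: curvature of this form in one
    coframe has this form in all of them. *)
Lemma kulkarni_nomizu_pullback n (E P G : 'M[F]_n) (Q : 'I_n -> 'I_n -> 'M[F]_n) :
  (forall a b c d, Q c d a b = kulkarni_nomizu P G a b c d) ->
  forall i j k l,
  (E^T *m (\sum_c \sum_d (E c k * E d l) *: Q c d) *m E) i j =
  kulkarni_nomizu (E^T *m P *m E) (E^T *m G *m E) i j k l.
Proof.
move=> QE i j k l.
(* Each of the four terms of the product factors into two bilinear forms. *)
have quad (X Y : 'M[F]_n) i' j' :
  \sum_c \sum_d \sum_a \sum_b E a i * E b j * (E c i' * E d j') * (X a c * Y b d) =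
  (E^T *m X *m E) i i' * (E^T *m Y *m E) j j'.
  rewrite !mxE mulr_suml; apply: eq_bigr => c _.
  rewrite mulr_sumr; apply: eq_bigr => d _.
  rewrite !mxE !mulr_suml; apply: eq_bigr => a _.
  rewrite !mulr_sumr; apply: eq_bigr => b _.
  by rewrite !mxE; ring.
rewrite /kulkarni_nomizu -!quad.
rewrite [X in _ - X + _ - _]exchange_big [X in _ - X]exchange_big.
rewrite mulmx_sumr mulmx_suml summxE -!sumrB -!big_split -!sumrB; apply: eq_bigr => c _ /=.
rewrite mulmx_sumr mulmx_suml summxE -!sumrB -!big_split -!sumrB; apply: eq_bigr => d _ /=.
rewrite -scalemxAr -scalemxAl [LHS]mxE mxE mulr_sumr.
under [LHS]eq_bigr => b _ do rewrite [X in _ * (X * _)]mxE mulr_suml mulr_sumr.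
rewrite [LHS]exchange_big -!sumrB -!big_split -!sumrB; apply: eq_bigr => a _ /=.
rewrite -!sumrB -!big_split -!sumrB; apply: eq_bigr => b _ /=.
by rewrite mxE QE /kulkarni_nomizu; ring.
Qed.

(** If Riem is the Kulkarni-Nomizu product of p with g, then in dimension 5
    Ric = 3 p + t g and the scalar curvature is 8 t, where t is the trace of p
    with respect to g.  So p is the Schouten tensor, and the Weyl tensor, which
    is what remains of Riem after subtracting its product with g, is zero. *)
Lemma weyl_kulkarni_nomizu (p g gi : 'M[F]_5) (Rm : 'I_5 -> 'I_5 -> 'M[F]_5) :
  gi *m g = 1%:M -> g^T = g -> p^T = p ->
  (forall i j k l, (g *m Rm k l) i j = kulkarni_nomizu p g i j k l) ->
  let ric j l := \sum_i Rm i l i j in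
  let s := \sum_j \sum_l gi j l * ric j l in
  forall i j k l,
    (g *m Rm k l) i j
    - 3^-1 * (ric i k * g j l - ric i l * g j k + ric j l * g i k - ric j k * g i l)
    + 12^-1 * s * (g i k * g j l - g i l * g j k) = 0.
Proof.
move=> gig gs ps RmE ric s i j k l.
have ggi := mulmx1C gig.
have gsE a b : g a b = g b a by rewrite -[in LHS]gs mxE.
have psE a b : p a b = p b a by rewrite -[in LHS]ps mxE.
pose t := \tr (gi *m p).
have ricE a b : ric a b = 3 * p a b + t * g a b.
  have E c : Rm c b c a = (gi *m p) c c * g a b - (gi *m p) c b * g c a
      + (gi *m g) c c * p a b - (gi *m g) c b * p c a.
    rewrite -[Rm c b]mul1mx -gig -mulmxA mxE !mxE !mulr_suml -sumrB -big_split -sumrB.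
    by apply: eq_bigr => m _ /=; rewrite RmE /kulkarni_nomizu (gsE a c) (psE a c); ring.
  rewrite /ric; under eq_bigr do rewrite E gig.
  rewrite sumrB big_split sumrB /= -!mulr_suml.
  have -> : \sum_c (gi *m p) c b * g c a = p a b.
    under eq_bigr do rewrite mulrC gsE.
    transitivity ((g *m (gi *m p)) a b); first by rewrite [RHS]mxE.
    by rewrite mulmxA ggi mul1mx.
  have -> : \sum_c (1%:M : 'M[F]_5) c b * p c a = p a b.
    under eq_bigr do rewrite mulrC psE.
    transitivity ((p *m 1%:M) a b); first by rewrite [RHS]mxE.
    by rewrite mulmx1.
  have -> : \sum_c (1%:M : 'M[F]_5) c c = 5 by rewrite -[LHS]/(\tr 1%:M) mxtrace1.
  by rewrite -/(\tr _) -/t; ring.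
have sE : s = 8 * t.
  have E a b : gi a b * ric a b = 3 * (gi a b * p b a) + t * (gi a b * g b a).
    by rewrite ricE (psE a b) (gsE a b); ring.
  rewrite /s; under eq_bigr => a _ do under eq_bigr => b _ do rewrite E.
  under eq_bigr do rewrite big_split /= -!mulr_sumr.
  rewrite big_split /= -!mulr_sumr.
  have tr (X Y : 'M[F]_5) : \sum_a \sum_b X a b * Y b a = \tr (X *m Y).
    by apply: eq_bigr => a _; rewrite mxE.
  by rewrite !tr gig mxtrace1 -/t; ring.
rewrite RmE /kulkarni_nomizu !ricE sE.
by field; rewrite ?pnatr_eq0.
Qed.

End KulkarniNomizu.

(** * The complex exponential and a branch of the logarithm *)

Section FirstOrder.
Variable K : numFieldType.

(** Differentiability without quotients: this form transfers estimates between
    the real and the complex variable. *)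
Lemma is_derive_remainder (f : K -> K) (x d : K) :
  is_derive x 1 f d <->
  forall e, 0 < e -> \forall h \near (0 : K),
    `|f (h + x) - f x - d * h| <= e * `|h|.
Proof.
set q := fun h : K => h^-1 *: (f (h *: (1:K) + x) - f x).
have qE (h e : K) : h != 0 ->
    (`|d - q h| <= e) = (`|f (h + x) - f x - d * h| <= e * `|h|).
  move=> h0; rewrite /q /GRing.scale /= mulr1.
  have -> : d - h^-1 * (f (h + x) - f x) = - (h^-1 * (f (h + x) - f x - d * h)).
    by field.
  rewrite normrN normrM normfV ler_pdivrMl ?normr_gt0 //. rewrite [e * _]mulrC. by [].
split=> [[df dE] e e0|H].
  have cv : q @ 0^' --> d by rewrite -dE; exact: df.
  move/cvgrPdist_le: cv => /(_ _ e0).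
  rewrite near_withinE; apply: filterS => h.
  have [->|h0 /(_ isT)] := eqVneq h 0.
    by rewrite add0r mulr0 subr0 subrr normr0 mulr0.
  by rewrite qE.
have cv : q @ 0^' --> d.
  apply/cvgrPdist_le => e e0.
  have := H _ e0; rewrite near_withinE.
  by apply: filterS => h he h0; rewrite qE.
split; first by apply/cvg_ex; exists d.
exact: cvg_lim cv.
Qed.
End FirstOrder.

Section ComplexExp.
Variable R : realType.
Local Notation C := (CC R).
Implicit Types (z w h : C) (a b e : R).
Local Notation toC := (fun a : R => Complex a 0 : C).

Lemma cexpD z w : cexp (z + w) = cexp z * cexp w.
Proof.
case: z => a b; case: w => c d; rewrite /cexp /= expRD cosD sinD.
by apply/eqP; rewrite eq_complex /=; apply/andP; split; apply/eqP; ring.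
Qed.

Lemma cexp0 : cexp (0 : C) = 1.
Proof. by rewrite /cexp /= expR0 cos0 sin0 mulr0 mulr1. Qed.

Lemma cexpNK z : cexp (- z) * cexp z = 1.
Proof. by rewrite -cexpD addNr cexp0. Qed.

Lemma cexp_neq0 z : cexp z != 0.
Proof. by apply/eqP => z0; have /eqP := cexpNK z; rewrite z0 mulr0 eq_sym oner_eq0. Qed.

Lemma cexpN z : cexp (- z) = (cexp z)^-1.
Proof. by apply: (mulIf (cexp_neq0 z)); rewrite cexpNK mulVf // cexp_neq0. Qed.

Lemma norm_Re_le z : (`|complex.Re z|%:C)%C <= `|z| :> C.
Proof. exact: normc_ge_Re. Qed.

Lemma norm_Im_le z : (`|complex.Im z|%:C)%C <= `|z| :> C.
Proof.
have := norm_Re_le (z * Complex 0 1).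
have n1 : `|Complex 0 1 : C| = 1.
  by rewrite normc_def /= expr0n /= expr1n add0r sqrtr1.
rewrite normrM n1 mulr1.
by case: z => a b; rewrite /= mulr0 mulr1 add0r normrN.
Qed.

Lemma norm_le_ReIm z : `|z| <= ((`|complex.Re z| + `|complex.Im z|)%:C)%C :> C.
Proof.
rewrite normc_def lecR -[leRHS]ger0_norm ?addr_ge0 // -[leRHS]sqrtr_sqr.
rewrite ler_wsqrtr // sqrrD !real_normK ?num_real //.
by rewrite -addrA lerD2l lerDr mulrn_wge0 ?mulr_ge0.
Qed.

Lemma continuous_Re : continuous (fun z : C => complex.Re z : R).
Proof.
move=> z; apply/(@cvgrPdist_lt _ R _ (nbhs z) (nbhs_filter z)) => e e0; apply/nbhs_ballP.
exists (e%:C)%C; first by rewrite /= ltcR.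
move=> w; rewrite -ball_normE /= => h.
by rewrite -ltcR; apply: le_lt_trans h; rewrite -raddfB; exact: norm_Re_le.
Qed.

Lemma continuous_Im : continuous (fun z : C => complex.Im z : R).
Proof.
move=> z; apply/(@cvgrPdist_lt _ R _ (nbhs z) (nbhs_filter z)) => e e0; apply/nbhs_ballP.
exists (e%:C)%C; first by rewrite /= ltcR.
move=> w; rewrite -ball_normE /= => h.
by rewrite -ltcR; apply: le_lt_trans h; rewrite -raddfB; exact: norm_Im_le.
Qed.

Lemma cvg_Complex (T : Type) (F : set_system T) {FF : Filter F} (f g : T -> R) a b :
  f @ F --> a -> g @ F --> b -> (fun t => Complex (f t) (g t) : C) @ F --> (Complex a b : C).
Proof.
move=> /cvgrPdist_lt fa /cvgrPdist_lt gb; apply/cvgrPdist_lt => e.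
case: e => [e e']; rewrite ltcE /= => /andP[/eqP -> e0].
have e2 : 0 < e / 2 by rewrite divr_gt0.
near=> t.
apply: le_lt_trans (norm_le_ReIm _) _; rewrite ltcR /= (splitr e).
by apply: ltrD; near: t; [exact: fa|exact: gb].
Unshelve. all: by end_near. Qed.

End ComplexExp.

Section ComplexExpDerive.
Variable R : realType.
Local Notation C := (CC R).
Implicit Types (z w h : C) (a b e : R).

Lemma near_ReIm (P Q : R -> Prop) :
  (\forall a \near (0 : R), P a) -> (\forall b \near (0 : R), Q b) ->
  \forall h \near (0 : C), P (complex.Re h) /\ Q (complex.Im h).
Proof.
move=> HP HQ; near=> h; split; near: h.
  exact: (@continuous_Re R (0 : C) P HP).
exact: (@continuous_Im R (0 : C) Q HQ).
Unshelve. all: by end_near. Qed.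

(** The first-order estimate for exp (a + i b) from those for the real
    functions exp, cos, sin at 0. *)
Lemma cexp_remainder_bound a b e : 0 < e -> e <= 1 ->
  `|expR a - 1 - a| <= e * `|a| -> `|cos b - 1| <= e * `|b| ->
  `|sin b - b| <= e * `|b| -> `|expR a - 1| <= e ->
  `|expR a * cos b - 1 - a| + `|expR a * sin b - b| <= 6 * e * (`|a| + `|b|).
Proof.
move=> e0 e1 ha hc hs he.
have ea : 0 <= expR a <= 2.
  by rewrite expR_ge0 /=; have := le_trans (ler_norm _) he; lra.
have -> : expR a * cos b - 1 - a = (expR a - 1 - a) + expR a * (cos b - 1) by ring.
have -> : expR a * sin b - b = expR a * (sin b - b) + (expR a - 1) * b by ring.
have h1 := ler_normD (expR a - 1 - a) (expR a * (cos b - 1)).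
have h2 := ler_normD (expR a * (sin b - b)) ((expR a - 1) * b).
have h3 : `|expR a * (cos b - 1)| <= 2 * (e * `|b|).
  by rewrite normrM; apply: ler_pM => //; rewrite ger0_norm; case/andP: ea.
have h4 : `|expR a * (sin b - b)| <= 2 * (e * `|b|).
  by rewrite normrM; apply: ler_pM => //; rewrite ger0_norm; case/andP: ea.
have h5 : `|(expR a - 1) * b| <= e * `|b| by rewrite normrM ler_wpM2r.
have na := normr_ge0 a; have nb := normr_ge0 b.
have ma := mulr_ge0 (ltW e0) na; have mb := mulr_ge0 (ltW e0) nb.
lra.
Qed.

Lemma cexp_remainder e : 0 < e ->
  \forall h \near (0 : C), `|cexp h - 1 - h| <= (e%:C)%C * `|h|.
Proof.
move=> e0; pose d := Num.min (e / 12) 1.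
have d0 : 0 < d by rewrite lt_min ltr01 divr_gt0.
have [de d1] : 12 * d <= e /\ d <= 1.
  split; last by rewrite ge_min lexx orbT.
  by rewrite mulrC -ler_pdivlMr // ge_min lexx.
have de0 : is_derive (0 : R) 1 expR 1 by apply: (is_derive_eq (is_derive_expR 0)); rewrite expR0.
have dc0 : is_derive (0 : R) 1 (@cos R) 0.
  by apply: (is_derive_eq (is_derive_cos 0)); rewrite sin0 oppr0.
have ds0 : is_derive (0 : R) 1 (@sin R) 1 by apply: (is_derive_eq (is_derive_sin 0)); rewrite cos0.
move/is_derive_remainder: de0 => /(_ _ d0) He.
move/is_derive_remainder: dc0 => /(_ _ d0) Hc.
move/is_derive_remainder: ds0 => /(_ _ d0) Hs.
have Hn : \forall a \near (0 : R), `|expR a - 1| <= d.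
  have /(@cvgrPdist_le _ R _ _ (nbhs_filter _)) /(_ _ d0) := @continuous_expR R (0 : R).
  by apply: filterS => a; rewrite expR0 distrC.
have Hea := @filterI _ _ (nbhs_filter (0 : R)) _ _ He Hn.
have Hcs := @filterI _ _ (nbhs_filter (0 : R)) _ _ Hc Hs.
have := near_ReIm Hea Hcs.
apply: filterS => -[a b] /= [[H1 H2] [H3 H4]].
move: H1 H3 H4; rewrite !addr0 expR0 cos0 sin0 mul1r mul0r mul1r !subr0 => H1 H3 H4.
apply: le_trans (norm_le_ReIm _) _ => /=; rewrite oppr0 addr0.
have B := cexp_remainder_bound d0 d1 H1 H3 H4 H2.
have ra := norm_Re_le (Complex a b); have rb := norm_Im_le (Complex a b).
move: ra rb; rewrite normc_def /= -rmorphM !lecR; set r := Num.sqrt _ => ra rb.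
apply: le_trans B _.
have s0 : 0 <= `|a| + `|b| by rewrite addr_ge0.
have r0 : 0 <= r by rewrite sqrtr_ge0.
have := ler_wpM2r r0 de; have := ler_wpM2l (ltW d0) ra; have := ler_wpM2l (ltW d0) rb; lra.
Qed.

(** By the addition formula only the derivative at 0 matters. *)
Lemma is_derive_cexp z : is_derive z 1 (@cexp R) (cexp z).
Proof.
apply/is_derive_remainder => e0 e0_gt0.
have n0 : 0 < `|cexp z| by rewrite normr_gt0 cexp_neq0.
(* A positive element of C is a positive real number. *)
have : 0 < e0 / `|cexp z| by rewrite divr_gt0.
case dE: (e0 / `|cexp z|) => [d d']; rewrite ltcE /= => /andP[/eqP d'0 d0].
have := cexp_remainder d0; apply: filterS => h hh.
have -> : cexp (h + z) - cexp z - cexp z * h = cexp z * (cexp h - 1 - h).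
  by rewrite cexpD; ring.
rewrite normrM mulrC -ler_pdivlMr // mulrAC dE.
by rewrite d'0.
Qed.

End ComplexExpDerive.

Section ComplexLog.
Variable R : realType.
Local Notation C := (CC R).
Implicit Types (z w h : C) (a b : R).

Lemma cexp_remainderC (e : C) : 0 < e ->
  \forall h \near (0 : C), `|cexp h - 1 - h| <= e * `|h|.
Proof.
case: e => e e'; rewrite ltcE /= => /andP[/eqP -> e0].
exact: cexp_remainder.
Qed.

(** The principal branch on the right half-plane, where arctangent is a
    continuous choice of the argument: for w = r exp (i t) with |t| < pi/2,
    Re w = r cos t, so ln r = ln (Re w) - ln (cos t). *)
Definition clog w : C :=
  let t := atan (complex.Im w / complex.Re w) in
  Complex (ln (complex.Re w) - ln (cos t)) t.

Lemma Im_clog_bound w : - (pi / 2) < complex.Im (clog w) < pi / 2.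
Proof. by rewrite /= atan_gtNpi2 atan_ltpi2. Qed.

Lemma cos_atan_gt0 (x : R) : 0 < cos (atan x).
Proof. by apply: cos_gt0_pihalf; rewrite atan_gtNpi2 atan_ltpi2. Qed.

Lemma clogK w : 0 < complex.Re w -> cexp (clog w) = w.
Proof.
case: w => a b /= a0; rewrite /cexp /clog /=; set t := atan _.
have c0 : 0 < cos t := cos_atan_gt0 _.
rewrite expRB !lnK ?posrE //.
have tb : sin t = cos t * (b / a).
  by rewrite -(atanK (b / a)) -/t /tan mulrCA divff ?mulr1 // gt_eqF.
have n0 : cos t != 0 by rewrite gt_eqF.
have na : a != 0 by rewrite gt_eqF.
by apply/eqP; rewrite eq_complex /= tb; apply/andP; split; apply/eqP; field; rewrite ?n0 ?na.
Qed.

Lemma cexpK h : - (pi / 2) < complex.Im h < pi / 2 -> clog (cexp h) = h.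
Proof.
case: h => a b /= hb; rewrite /cexp /clog /=.
have c0 : 0 < cos b by apply: cos_gt0_pihalf.
have e0 := expR_gt0 a.
have -> : expR a * sin b / (expR a * cos b) = tan b.
  by rewrite /tan; field; rewrite !gt_eqF.
rewrite tanK ?in_itv //= lnM ?posrE // expRK.
by apply/eqP; rewrite eq_complex /= addrK !eqxx.
Qed.

Lemma cvg_clog (T : Type) (F : set_system T) {FF : ProperFilter F} (f : T -> C) w :
  0 < complex.Re w -> f @ F --> w -> (fun t => clog (f t)) @ F --> clog w.
Proof.
move=> w0 fw; have w0n : complex.Re w != 0 by rewrite gt_eqF.
have cr : (fun t => complex.Re (f t) : R) @ F --> complex.Re w.
  exact: (cvg_comp _ _ fw (@continuous_Re R w)).
have ci : (fun t => complex.Im (f t) : R) @ F --> complex.Im w.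
  exact: (cvg_comp _ _ fw (@continuous_Im R w)).
have ct : (fun t => atan (complex.Im (f t) / complex.Re (f t))) @ F
    --> atan (complex.Im w / complex.Re w).
  have cq : (fun t => complex.Im (f t) / complex.Re (f t)) @ F
      --> complex.Im w / complex.Re w.
    by apply: cvgM => //; exact: cvgV.
  have ca := @continuous_atan R (complex.Im w / complex.Re w).
  exact: (cvg_comp _ _ cq ca).
have cc : (fun t => cos (atan (complex.Im (f t) / complex.Re (f t)))) @ F
    --> cos (atan (complex.Im w / complex.Re w)).
  have ccos := @continuous_cos R (atan (complex.Im w / complex.Re w)).
  exact: (cvg_comp _ _ ct ccos).
have cl := continuous_ln w0.
have cl' := continuous_ln (cos_atan_gt0 (complex.Im w / complex.Re w)).
apply: cvg_Complex => //; apply: cvgB.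
  exact: (cvg_comp _ _ cr cl).
exact: (cvg_comp _ _ cc cl').
Qed.

(** The inverse function rule by hand.  With k = log (w + h) - log w one has
    exp k = 1 + h / w, and the remainder of exp at 0 bounds both k by a multiple
    of h / w and the error k - h / w by a small multiple of k. *)
Lemma is_derive_clog w : 0 < complex.Re w -> is_derive w 1 clog w^-1.
Proof.
move=> w0; apply/is_derive_remainder => e e0.
have wn : w != 0 by apply/eqP => E; move: w0; rewrite E ltxx.
have nw : 0 < `|w| by rewrite normr_gt0.
have d0 : 0 < e * `|w| / 2 by rewrite divr_gt0 // mulr_gt0.
have h0 : 0 < 2^-1 :> C by rewrite invr_gt0.
have NF := nbhs_filter (0 : C).
have cw : (fun h : C => h + w) @ (0 : C) --> w.
  rewrite -[X in _ --> X]add0r; apply: (@cvgD _ _ _ _ NF); first exact: cvg_id.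
  exact: cvg_cst.
have cl : (fun h : C => clog (h + w) - clog w) @ (0 : C) --> (0 : C).
  rewrite -[X in _ --> X](subrr (clog w)).
  have c1 : (fun h : C => clog (h + w)) @ (0 : C) --> clog w.
    exact: (@cvg_clog _ _ (nbhs_pfilter (0 : C))).
  have c2 : (fun h : C => clog w) @ (0 : C) --> clog w by exact: cvg_cst.
  exact: (cvgB c1 c2).
pose k0 h := clog (h + w) - clog w.
have P1 : \forall h \near (0 : C),
  `|cexp (k0 h) - 1 - k0 h| <= e * `|w| / 2 * `|k0 h| := cl _ (cexp_remainderC d0).
have P2 : \forall h \near (0 : C),
  `|cexp (k0 h) - 1 - k0 h| <= 2^-1 * `|k0 h| := cl _ (cexp_remainderC h0).
have P3 : \forall h \near (0 : C), 0 < complex.Re (h + w).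
  have c3 : (fun h : C => complex.Re (h + w) : R) @ (0 : C) --> complex.Re w.
    exact: (cvg_comp _ _ cw (@continuous_Re R w)).
  exact: (c3 _ (lt_nbhsr w0)).
near=> h.
have hw : 0 < complex.Re (h + w) by near: h; exact: P3.
have k1 : `|cexp (k0 h) - 1 - k0 h| <= e * `|w| / 2 * `|k0 h| by near: h; exact: P1.
have k2 : `|cexp (k0 h) - 1 - k0 h| <= 2^-1 * `|k0 h| by near: h; exact: P2.
move: k1 k2; rewrite /k0; set k := clog (h + w) - clog w => k1 k2.
have kE : cexp k = 1 + h / w.
  by rewrite /k cexpD cexpN !clogK // mulrDl divff // addrC.
have hE : cexp k - 1 = h / w by rewrite kE addrC addKr.
rewrite hE in k1 k2.
have kh : 2^-1 * `|k| <= `|h / w|.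
  have := ler_normB (h / w) (h / w - k); rewrite opprB addrCA subrr addr0 => H.
  have := le_trans H (lerD (lexx _) k2); rewrite -lerBlDr; apply: le_trans.
  by rewrite le_eqVlt; apply/orP; left; apply/eqP; field.
have -> : clog (h + w) - clog w - w^-1 * h = - (h / w - k).
  by rewrite -/k opprB [w^-1 * h]mulrC.
rewrite normrN; apply: (le_trans k1); rewrite -!mulrA; apply: ler_wpM2l; first exact: ltW.
by rewrite mulrC -ler_pdivlMr // -normfV -normrM.
Unshelve. all: by end_near. Qed.
Lemma open_right_half_plane : open [set w : C | 0 < complex.Re w].
Proof.
apply: (@open_comp _ _ (fun w : C => complex.Re w : R) [set x | 0 < x]); last exact: open_gt.
by move=> w _; exact: continuous_Re.
Qed.

Lemma open_strip : open [set w : C | - (pi / 2) < complex.Im w < pi / 2].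
Proof.
rewrite (_ : [set w : C | _] = [set w : C | - (pi / 2) < complex.Im w] `&`
  [set w | complex.Im w < pi / 2]); last first.
  by apply/seteqP; split => w /= => [/andP[]|[-> ->]].
apply: openI.
  apply: (@open_comp _ _ (fun w : C => complex.Im w : R) [set x | - (pi / 2) < x]).
    by move=> w _; exact: continuous_Im.
  exact: open_gt.
apply: (@open_comp _ _ (fun w : C => complex.Im w : R) [set x | x < pi / 2]).
  by move=> w _; exact: continuous_Im.
exact: open_lt.
Qed.

Lemma Re_cexp_gt0 (w : C) : - (pi / 2) < complex.Im w < pi / 2 -> 0 < complex.Re (cexp w).
Proof. by move=> h; rewrite mulr_gt0 ?expR_gt0 // cos_gt0_pihalf. Qed.

End ComplexLog.

(** * Differentials as covectors *)

Section Differentials.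
Variable R : realType.
Local Notation C := (CC R).
Local Notation C5 := (C5 R).
Implicit Types (f g : C5 -> C) (u a b v : C5).

Lemma pairingDl a b v : pairing (a + b) v = pairing a v + pairing b v.
Proof. by rewrite /pairing -big_split; apply: eq_bigr => k _; rewrite mxE mulrDl. Qed.

Lemma pairingZl (c : C) a v : pairing (c *: a) v = c * pairing a v.
Proof. by rewrite /pairing mulr_sumr; apply: eq_bigr => k _; rewrite mxE mulrA. Qed.

Lemma pairingDr a v w : pairing a (v + w) = pairing a v + pairing a w.
Proof. by rewrite /pairing -big_split; apply: eq_bigr => k _; rewrite mxE mulrDr. Qed.

Lemma pairingZr (c : C) a v : pairing a (c *: v) = c * pairing a v.
Proof. by rewrite /pairing mulr_sumr; apply: eq_bigr => k _; rewrite mxE mulrCA. Qed.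

Lemma pairing_ebasisr a k : pairing a (ebasis R k) = a 0 k.
Proof.
rewrite /pairing (bigD1 k) //= big1 ?addr0; last first.
  by move=> j /negbTE jk; rewrite mxE jk andbF mulr0.
by rewrite mxE !eqxx mulr1.
Qed.

Lemma pairing_ebasisl v k : pairing (ebasis R k) v = v 0 k.
Proof.
rewrite /pairing (bigD1 k) //= big1 ?addr0; last first.
  by move=> j /negbTE jk; rewrite mxE jk andbF mul0r.
by rewrite mxE !eqxx mul1r.
Qed.

(** The differential as a row of coefficients, so that the differential of a
    concrete function can be computed by rules and read off as a matrix. *)
Definition has_diff f u a : Prop := is_diff u f (pairing a).

Lemma has_diff_differentiable f u a : has_diff f u a -> differentiable f u.
Proof. by case. Qed.

Lemma has_diff_derive f u a v : has_diff f u a -> 'D_v f u = pairing a v.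
Proof. by move=> [df dfE]; rewrite deriveE // dfE. Qed.

Lemma has_diff_pd f u a k : has_diff f u a -> pd k f u = a 0 k.
Proof. by move=> fa; rewrite /pd (has_diff_derive _ fa) pairing_ebasisr. Qed.

Lemma has_diff_fdiff f u a : has_diff f u a -> fdiff f u = a.
Proof. by move=> fa; apply/rowP => k; rewrite mxE (has_diff_pd _ fa). Qed.

Lemma has_diff_eq f u a b : has_diff f u a -> a = b -> has_diff f u b.
Proof. by move=> fa <-. Qed.

Lemma differentiable_has_diff f u : differentiable f u -> has_diff f u (fdiff f u).
Proof.
move=> df; split=> //; apply: funext => v.
rewrite {1}(row_sum_delta v) linear_sum; apply: eq_bigr => k _.
by rewrite linearZ /= mxE /pd deriveE // mulrC.
Qed.

Lemma has_diff_cst (c : C) u : has_diff (fun=> c) u 0.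
Proof.
apply: (is_diff_eq (is_diff_cst c u)); apply: funext => v.
by rewrite /pairing big1 // => k _; rewrite mxE mul0r.
Qed.

Lemma has_diff_coord k u : has_diff (fun v => v 0 k) u (ebasis R k).
Proof.
have lin : linear (fun v : C5 => v 0 k : C) by move=> c v w; rewrite !mxE.
pose coordM := GRing.isLinear.Build _ _ _ _ _ lin.
pose coordL : {linear C5 -> C} := HB.pack (fun v : C5 => v 0 k : C) coordM.
have cont : continuous coordL by exact: coord_continuous.
split; first exact: (linear_differentiable u cont).
rewrite -[X in 'd X _]/(coordL : C5 -> C) (diff_lin u cont).
by apply: funext => v; rewrite pairing_ebasisl.
Qed.

Lemma has_diffD f g u a b : has_diff f u a -> has_diff g u b ->
  has_diff (fun v => f v + g v) u (a + b).
Proof.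
move=> fa gb; apply: (is_diff_eq (is_diffD fa gb)).
by apply: funext => v; rewrite pairingDl.
Qed.

Lemma has_diffM f g u a b : has_diff f u a -> has_diff g u b ->
  has_diff (fun v => f v * g v) u (f u *: b + g u *: a).
Proof.
move=> fa gb; apply: (is_diff_eq (is_diffM fa gb)).
by apply: funext => v; rewrite pairingDl !pairingZl.
Qed.

Lemma has_diff_comp (h : C -> C) f u a (d : C) :
  has_diff f u a -> is_derive (f u) 1 h d -> has_diff (fun v => h (f v)) u (d *: a).
Proof.
move=> fa [/derivable1_diffP dh dhE]; have [df dfE] := fa.
split; first exact: differentiable_comp.
rewrite -[X in 'd X _]/(h \o f) diff_comp //; apply: funext => v /=.
by rewrite diff1E // dfE pairingZl derive1E dhE mulrC.
Qed.

Lemma has_diffN f u a : has_diff f u a -> has_diff (fun v => - f v) u (- a).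
Proof.
move=> fa; apply: (is_diff_eq (is_diffN fa)); apply: funext => v.
by rewrite -[- a]scaleN1r pairingZl mulN1r.
Qed.

Lemma has_diff_exp f u a : has_diff f u a ->
  has_diff (fun v => cexp (f v)) u (cexp (f u) *: a).
Proof. by move=> fa; apply: has_diff_comp fa (is_derive_cexp _). Qed.

Lemma has_diff_log f u a : has_diff f u a -> 0 < complex.Re (f u) ->
  has_diff (fun v => clog (f v)) u ((f u)^-1 *: a).
Proof. by move=> fa f0; apply: has_diff_comp fa (is_derive_clog f0). Qed.

Lemma differentiable_add f g u : differentiable f u -> differentiable g u ->
  differentiable (fun v => f v + g v) u.
Proof.
move=> /differentiable_has_diff df /differentiable_has_diff dg.
exact: has_diff_differentiable (has_diffD df dg).
Qed.

Lemma differentiable_mul f g u : differentiable f u -> differentiable g u ->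
  differentiable (fun v => f v * g v) u.
Proof.
move=> /differentiable_has_diff df /differentiable_has_diff dg.
exact: has_diff_differentiable (has_diffM df dg).
Qed.

Lemma differentiable_opp f u : differentiable f u -> differentiable (fun v => - f v) u.
Proof.
by move=> /differentiable_has_diff df; exact: has_diff_differentiable (has_diffN df).
Qed.

Lemma differentiable_log f u : differentiable f u -> 0 < complex.Re (f u) ->
  differentiable (fun v => clog (f v)) u.
Proof.
by move=> /differentiable_has_diff df f0; exact: has_diff_differentiable (has_diff_log df f0).
Qed.

Lemma differentiable_const (c : C) u : differentiable (fun _ : C5 => c) u.
Proof. exact: has_diff_differentiable (has_diff_cst c u). Qed.

Lemma differentiable_coordinate k u : differentiable (fun v : C5 => v 0 k : C) u.
Proof. exact: has_diff_differentiable (has_diff_coord k u). Qed.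

Lemma near_open f u (O : set C) : differentiable f u -> open O -> O (f u) ->
  \forall v \near u, O (f v).
Proof.
move=> df oO Of; exact: (differentiable_continuous df (open_nbhs_nbhs (conj oO Of))).
Qed.

Lemma open_neqC (a : C) : open [set w | w != a].
Proof.
rewrite (_ : [set x | _] = ~` [set a]); last first.
  by apply/seteqP; split => x /= /eqP.
by apply: closed_openC; exact/accessible_closed_set1/hausdorff_accessible/norm_hausdorff.
Qed.

End Differentials.

(** * Elementary functions *)

Section Elementary.
Variable R : realType.
Local Notation C := (CC R).
Local Notation C5 := (C5 R).
Implicit Types (f g : C5 -> C) (u : C5).

(** A class of everywhere holomorphic functions closed under partial
    derivatives.  It contains the coefficients of the coframe, of its inverse
    and of all tensors formed from them, and it makes the symmetry of second
    derivatives an induction on expressions. *)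
Inductive elementary : (C5 -> C) -> Prop :=
| elementary_cst c : elementary (fun=> c)
| elementary_coord k : elementary (fun u => u 0 k)
| elementaryD f g : elementary f -> elementary g -> elementary (fun u => f u + g u)
| elementaryM f g : elementary f -> elementary g -> elementary (fun u => f u * g u)
| elementary_exp f : elementary f -> elementary (fun u => cexp (f u)).

Lemma elementary_differentiable f u : elementary f -> differentiable f u.
Proof.
elim=> {f} [c|k|f g _ df _ dg|f g _ df _ dg|f _ df].
- exact: differentiable_const.
- exact: differentiable_coordinate.
- exact: differentiable_add.
- exact: differentiable_mul.
- exact: has_diff_differentiable (has_diff_exp (differentiable_has_diff df)).
Qed.

Lemma elementary_has_diff f u : elementary f -> has_diff f u (fdiff f u).
Proof. by move=> ef; exact/differentiable_has_diff/elementary_differentiable. Qed.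

Let addE (a b : C5) k : (a + b) 0 k = a 0 k + b 0 k.
Proof. exact: mxE. Qed.

Let scaleE (c : C) (a : C5) k : (c *: a) 0 k = c * a 0 k.
Proof. exact: mxE. Qed.

Let fdiffE f u k : fdiff f u 0 k = pd k f u.
Proof. exact: mxE. Qed.

Lemma pd_cst k (c : C) u : pd k (fun=> c) u = 0.
Proof. by rewrite (has_diff_pd k (has_diff_cst c u)) mxE. Qed.

Lemma pd_coord k j u : pd k (fun v => v 0 j) u = (k == j)%:R.
Proof. by rewrite (has_diff_pd k (has_diff_coord j u)) mxE eqxx. Qed.

Lemma pdD k f g u : elementary f -> elementary g ->
  pd k (fun v => f v + g v) u = pd k f u + pd k g u.
Proof.
move=> /(elementary_has_diff u) df /(elementary_has_diff u) dg.
rewrite (has_diff_pd k (has_diffD df dg)) addE.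
by congr (_ + _); exact: fdiffE.
Qed.

Lemma pdM k f g u : elementary f -> elementary g ->
  pd k (fun v => f v * g v) u = f u * pd k g u + g u * pd k f u.
Proof.
move=> /(elementary_has_diff u) df /(elementary_has_diff u) dg.
rewrite (has_diff_pd k (has_diffM df dg)) addE.
by congr (_ + _); rewrite scaleE; congr (_ * _); exact: fdiffE.
Qed.

Lemma pd_exp k f u : elementary f ->
  pd k (fun v => cexp (f v)) u = cexp (f u) * pd k f u.
Proof.
move=> /(elementary_has_diff u) df.
by rewrite (has_diff_pd k (has_diff_exp df)) scaleE; congr (_ * _); exact: fdiffE.
Qed.

Lemma elementary_pd k f : elementary f -> elementary (pd k f).
Proof.
elim=> {f} [c|j|f g ef df eg dg|f g ef df eg dg|f ef df].
- rewrite (_ : pd k _ = fun=> 0); first exact: elementary_cst.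
  by apply: funext => u; rewrite pd_cst.
- rewrite (_ : pd k _ = fun=> (k == j)%:R); first exact: elementary_cst.
  by apply: funext => u; rewrite pd_coord.
- rewrite (_ : pd k _ = fun u => pd k f u + pd k g u); first exact: elementaryD.
  by apply: funext => u; rewrite pdD.
- rewrite (_ : pd k _ = fun u => f u * pd k g u + g u * pd k f u).
    by apply: elementaryD; exact: elementaryM.
  by apply: funext => u; rewrite pdM.
- rewrite (_ : pd k _ = fun u => cexp (f u) * pd k f u).
    by apply: elementaryM => //; exact: elementary_exp.
  by apply: funext => u; rewrite pd_exp.
Qed.

Let pd_eq l f g u : f = g -> pd l f u = pd l g u.
Proof. by move=> ->. Qed.

(* In the two auxiliary identities, c and d are values of functions, cj the
   derivative of the first one in the direction j, and c2, c2' its two mixed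
   second derivatives. *)
Let mixed_product (c d cj ck dj dk c2 c2' d2 d2' X Y : C) :
  X = c * d2 + dk * cj + (d * c2 + ck * dj) ->
  Y = c * d2' + dj * ck + (d * c2' + cj * dk) -> c2 = c2' -> d2 = d2' -> X = Y.
Proof. by move=> -> -> -> ->; ring. Qed.

Let mixed_exp (c cj ck c2 c2' X Y : C) :
  X = c * c2 + ck * (c * cj) -> Y = c * c2' + cj * (c * ck) -> c2 = c2' -> X = Y.
Proof. by move=> -> -> ->; ring. Qed.

Lemma pdC j k f u : elementary f -> pd j (pd k f) u = pd k (pd j f) u.
Proof.
move=> ef; elim: ef j k u => {f} [c|i|f g ef df eg dg|f g ef df eg dg|f ef df] j k u.
- have E l : pd l (fun=> c) = fun=> 0 by apply: funext => v; exact: pd_cst.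
  rewrite (pd_eq j u (E k)) (pd_eq k u (E j)).
  by rewrite (pd_cst j) (pd_cst k).
- have E l : pd l (fun v : C5 => v 0 i) = fun=> ((l == i)%:R : C).
    by apply: funext => v; exact: pd_coord.
  rewrite (pd_eq j u (E k)) (pd_eq k u (E j)).
  by rewrite (pd_cst j) (pd_cst k).
- have pf l := elementary_pd l ef; have pg l := elementary_pd l eg.
  have E l : pd l (fun v => f v + g v) = fun v => pd l f v + pd l g v.
    by apply: funext => v; exact: pdD.
  have E2 l m : pd l (pd m (fun v => f v + g v)) u = pd l (pd m f) u + pd l (pd m g) u.
    exact (etrans (pd_eq l u (E m)) (pdD l u (pf m) (pg m))).
  exact (etrans (E2 j k) (etrans (congr2 +%R (df j k u) (dg j k u)) (esym (E2 k j)))).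
- have pf l := elementary_pd l ef; have pg l := elementary_pd l eg.
  have E l : pd l (fun v => f v * g v) = fun v => f v * pd l g v + g v * pd l f v.
    by apply: funext => v; exact: pdM.
  have E2 l m : pd l (pd m (fun v => f v * g v)) u =
      f u * pd l (pd m g) u + pd m g u * pd l f u +
      (g u * pd l (pd m f) u + pd m f u * pd l g u).
    refine (etrans (pd_eq l u (E m)) _).
    refine (etrans (pdD l u (elementaryM ef (pg m)) (elementaryM eg (pf m))) _).
    exact (congr2 +%R (pdM l u ef (pg m)) (pdM l u eg (pf m))).
  exact (mixed_product (E2 j k) (E2 k j) (df j k u) (dg j k u)).
- have pf l := elementary_pd l ef; have exf := elementary_exp ef.
  have E l : pd l (fun v => cexp (f v)) = fun v => cexp (f v) * pd l f v.
    by apply: funext => v; exact: pd_exp.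
  have E2 l m : pd l (pd m (fun v => cexp (f v))) u =
      cexp (f u) * pd l (pd m f) u + pd m f u * (cexp (f u) * pd l f u).
    refine (etrans (pd_eq l u (E m)) _).
    refine (etrans (pdM l u exf (pf m)) _).
    exact (congr1 (fun c => cexp (f u) * pd l (pd m f) u + pd m f u * c) (pd_exp l u ef)).
  exact (mixed_exp (E2 j k) (E2 k j) (df j k u)).
Qed.

Lemma elementary_sum n (F : 'I_n -> C5 -> C) :
  (forall i, elementary (F i)) -> elementary (fun u => \sum_i F i u).
Proof.
move=> eF; elim: n F eF => [|n IH] F eF.
  rewrite (_ : (fun u => _) = fun=> 0); first exact: elementary_cst.
  by apply: funext => u; rewrite big_ord0.
rewrite (_ : (fun u => _) = fun u => F ord0 u + \sum_i F (lift ord0 i) u).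
  by apply: elementaryD => //; exact: IH.
by apply: funext => u; rewrite big_ord_recl.
Qed.

Lemma pd_sum k n (F : 'I_n -> C5 -> C) u : (forall i, elementary (F i)) ->
  pd k (fun v => \sum_i F i v) u = \sum_i pd k (F i) u.
Proof.
move=> eF; elim: n F eF => [|n IH] F eF.
  rewrite big_ord0 (_ : (fun v => _) = fun=> 0) ?pd_cst //.
  by apply: funext => v; rewrite big_ord0.
rewrite (_ : (fun v => _) = fun v => F ord0 v + \sum_i F (lift ord0 i) v); last first.
  by apply: funext => v; rewrite big_ord_recl.
by rewrite pdD ?IH ?big_ord_recl //; exact: elementary_sum.
Qed.

Definition elementary_mx m n (M : C5 -> 'M[C]_(m, n)) :=
  forall i j, elementary (fun u => M u i j).

Definition mpd m n k (M : C5 -> 'M[C]_(m, n)) u : 'M[C]_(m, n) :=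
  \matrix_(i, j) pd k (fun v => M v i j) u.

Lemma elementary_mxM m n p (M : C5 -> 'M[C]_(m, n)) (N : C5 -> 'M[C]_(n, p)) :
  elementary_mx M -> elementary_mx N -> elementary_mx (fun u => M u *m N u).
Proof.
move=> eM eN i j; rewrite (_ : (fun u => _) = fun u => \sum_k M u i k * N u k j).
  by apply: elementary_sum => k; exact: elementaryM.
by apply: funext => u; rewrite mxE.
Qed.

Lemma elementary_mxD m n (M N : C5 -> 'M[C]_(m, n)) :
  elementary_mx M -> elementary_mx N -> elementary_mx (fun u => M u + N u).
Proof.
move=> eM eN i j; rewrite (_ : (fun u => _) = fun u => M u i j + N u i j).
  exact: elementaryD.
by apply: funext => u; rewrite mxE.
Qed.

Lemma elementary_mx_cst m n (M : 'M[C]_(m, n)) : elementary_mx (fun=> M).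
Proof. by move=> i j; exact: elementary_cst. Qed.

Lemma elementary_mx_tr m n (M : C5 -> 'M[C]_(m, n)) :
  elementary_mx M -> elementary_mx (fun u => (M u)^T).
Proof.
move=> eM i j; rewrite (_ : (fun u => _) = fun u => M u j i) //.
by apply: funext => u; rewrite mxE.
Qed.

Lemma elementary_mx_mpd m n k (M : C5 -> 'M[C]_(m, n)) :
  elementary_mx M -> elementary_mx (mpd k M).
Proof.
move=> eM i j; rewrite (_ : (fun u => _) = pd k (fun u => M u i j)).
  exact: elementary_pd.
by apply: funext => u; rewrite mxE.
Qed.

Lemma mpdE m n k (M : C5 -> 'M[C]_(m, n)) u i j :
  mpd k M u i j = pd k (fun v => M v i j) u.
Proof. exact: mxE. Qed.

Lemma mpdM m n p k (M : C5 -> 'M[C]_(m, n)) (N : C5 -> 'M[C]_(n, p)) u :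
  elementary_mx M -> elementary_mx N ->
  mpd k (fun v => M v *m N v) u = mpd k M u *m N u + M u *m mpd k N u.
Proof.
move=> eM eN; apply/matrixP => i j.
have E : (fun v => (M v *m N v) i j) = fun v => \sum_l M v i l * N v l j.
  by apply: funext => v; exact: mxE.
have eMN l : elementary (fun v => M v i l * N v l j) by exact: elementaryM.
refine (etrans (mpdE _ _ _ _ _) (etrans (pd_eq k u E) (etrans (pd_sum k u eMN) _))).
rewrite [RHS]mxE [X in _ = X + _]mxE [X in _ = _ + X]mxE -big_split.
apply: eq_bigr => l _.
refine (etrans (pdM k u (eM i l) (eN l j)) (etrans (addrC _ _) _)).
refine (congr2 (fun a b => a + M u i l * b) (etrans (mulrC _ _) _) _).
  exact (congr1 (fun a => a * N u l j) (esym (mpdE _ _ _ _ _))).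
exact (esym (mpdE _ _ _ _ _)).
Qed.

Lemma mpdD m n k (M N : C5 -> 'M[C]_(m, n)) u :
  elementary_mx M -> elementary_mx N ->
  mpd k (fun v => M v + N v) u = mpd k M u + mpd k N u.
Proof.
move=> eM eN; apply/matrixP => i j.
have E : (fun v => (M v + N v) i j) = fun v => M v i j + N v i j.
  by apply: funext => v; exact: mxE.
refine (etrans (mpdE _ _ _ _ _) (etrans (pd_eq k u E) _)).
refine (etrans (pdD k u (eM i j) (eN i j)) _).
rewrite [RHS]mxE.
exact (congr2 +%R (esym (mpdE _ _ _ _ _)) (esym (mpdE _ _ _ _ _))).
Qed.

Lemma mpd_cst m n k (M : 'M[C]_(m, n)) u : mpd k (fun=> M) u = 0.
Proof.
apply/matrixP => i j; rewrite [RHS]mxE.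
exact (etrans (mpdE _ _ _ _ _) (pd_cst k (M i j) u)).
Qed.

Lemma mpd_tr m n k (M : C5 -> 'M[C]_(m, n)) u : mpd k (fun v => (M v)^T) u = (mpd k M u)^T.
Proof.
apply/matrixP => i j; rewrite [RHS]mxE.
have E : (fun v => (M v)^T i j) = fun v => M v j i by apply: funext => v; exact: mxE.
exact (etrans (mpdE _ _ _ _ _) (etrans (pd_eq k u E) (esym (mpdE _ _ _ _ _)))).
Qed.

Lemma mpdC m n j k (M : C5 -> 'M[C]_(m, n)) u : elementary_mx M ->
  mpd j (mpd k M) u = mpd k (mpd j M) u.
Proof.
move=> eM; apply/matrixP => a b.
have E l : (fun v => mpd l M v a b) = pd l (fun v => M v a b).
  by apply: funext => v; exact: mpdE.
refine (etrans (mpdE _ _ _ _ _) (etrans (pd_eq j u (E k)) _)).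
refine (etrans (pdC j k u (eM a b)) (esym _)).
exact (etrans (mpdE _ _ _ _ _) (pd_eq k u (E j))).
Qed.

End Elementary.

(** * Conformal flatness of metrics with constant coefficients in a frame *)

Section FrameCurvature.
Variable R : realType.
Local Notation C := (CC R).
Local Notation C5 := (C5 R).

Variables (E N : C5 -> 'M[C]_5) (G Gi P : 'M[C]_5) (w S : 'I_5 -> 'M[C]_5).
Hypothesis eE : elementary_mx E.
Hypothesis eN : elementary_mx N.
Hypothesis NE : forall u, N u *m E u = 1%:M.
Hypothesis structure : forall a u,
  extd (fun v => row a (E v)) u = (E u)^T *m S a *m E u.
Hypothesis GiG : Gi *m G = 1%:M.
Hypothesis Gs : G^T = G.
Hypothesis Ps : P^T = P.
Hypothesis metric : forall c, G *m w c + (w c)^T *m G = 0.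
Hypothesis torsion : forall a c d, S a c d = w d a c - w c a d.
Hypothesis curvature : forall a b c d,
  (G *m frame_curvature w S c d) a b = kulkarni_nomizu P G a b c d.

Definition frame_metric u : 'M[C]_5 := (E u)^T *m G *m E u.
Local Notation g := frame_metric.

Lemma frame_metric_sym u : (g u)^T = g u.
Proof. by rewrite /g !trmx_mul Gs trmxK mulmxA. Qed.

Lemma frame_metric_inv u : invmx (g u) *m g u = 1%:M.
Proof.
have : (N u *m Gi *m (N u)^T) *m g u = 1%:M.
  rewrite /g !mulmxA -[X in X *m G]mulmxA -trmx_mul (mulmx1C (NE u)) trmx1 mulmx1.
  by rewrite -[X in X *m E u]mulmxA GiG mulmx1 NE.
by move=> /mulmx1_unit [_ gu]; exact: mulVmx.
Qed.

Lemma structure_entry u a k j : mpd k E u a j - mpd j E u a k =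
  \sum_c \sum_d E u c k * S a c d * E u d j.
Proof.
have rE l : (fun v => row a (E v) 0 l) = fun v => E v a l.
  by apply: funext => v; exact: mxE.
have pE l m : pd l (fun v => row a (E v) 0 m) u = mpd l E u a m.
  exact (etrans (congr1 (fun f => pd l f u) (rE m)) (esym (mpdE _ _ _ _ _))).
refine (etrans (congr2 (fun x y => x - y) (esym (pE k j)) (esym (pE j k))) _).
transitivity (extd (fun v => row a (E v)) u k j); first by rewrite [RHS]mxE.
rewrite structure mxE exchange_big; apply: eq_bigr => d _.
by rewrite mxE mulr_suml; apply: eq_bigr => c _; rewrite mxE.
Qed.

Definition levi_civita k u : 'M[C]_5 :=
  coord_connection (E u) (N u) w (fun l => mpd l E u) k.
Local Notation T := levi_civita.

Lemma mpd_frame_metric k u :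
  mpd k g u = (mpd k E u)^T *m G *m E u + (E u)^T *m G *m mpd k E u.
Proof.
have eEt := elementary_mx_tr eE; have eG := @elementary_mx_cst R _ _ G.
refine (etrans (mpdM k u (elementary_mxM eEt eG) eE) _).
refine (congr1 (fun X => X *m E u + _) (etrans (mpdM k u eEt eG) _)).
refine (etrans (congr2 (fun X Y => X *m G + (E u)^T *m Y) (mpd_tr k E u) (mpd_cst k G u)) _).
by rewrite mulmx0 addr0.
Qed.

Lemma levi_civita_sym u i j k : T k u i j = T j u i k.
Proof.
exact: (@coord_connection_sym C 5 (E u) (N u) w S (fun l => mpd l E u) torsion
  (structure_entry u) i j k).
Qed.

(** The connection obtained from the frame is metric and torsion-free, hence is
    the Levi-Civita connection of the coordinate definition. *)
Lemma christoffel_frame u i j k : christoffel g u i j k = T j u i k.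
Proof.
rewrite -levi_civita_sym.
rewrite -(@christoffel_unique C 5 (g u) (invmx (g u)) (fun l => mpd l g u) (T^~ u)).
- rewrite /christoffel; congr (_ * _); apply: eq_bigr => m _; congr (_ * _).
  exact (congr2 (fun x y => x - y)
    (congr2 +%R (esym (mpdE _ _ _ _ _)) (esym (mpdE _ _ _ _ _)))
    (esym (mpdE _ _ _ _ _))).
- exact: frame_metric_inv.
- exact: frame_metric_sym.
- move=> l; rewrite mpd_frame_metric.
  exact: (@coord_connection_metric C 5 (E u) (N u) G w (fun l => mpd l E u) (NE u) metric l).
- by move=> a b c; exact: levi_civita_sym.
Qed.

Definition connection_form k u : 'M[C]_5 := frame_connection (E u) w k.
Local Notation W := connection_form.

Lemma elementary_connection k : elementary_mx (W k).
Proof.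
move=> i j; rewrite (_ : (fun u => _) = fun u => \sum_c E u c k * w c i j).
  by apply: elementary_sum => c; apply: elementaryM => //; exact: elementary_cst.
apply: funext => u; rewrite /W /frame_connection summxE.
by apply: eq_bigr => c _; rewrite mxE.
Qed.

Lemma mpd_connection l k u : mpd k (W l) u = \sum_e mpd k E u e l *: w e.
Proof.
apply/matrixP => i j.
have F : (fun v => W l v i j) = fun v => \sum_c E v c l * w c i j.
  apply: funext => v; rewrite /W /frame_connection summxE.
  by apply: eq_bigr => c _; rewrite mxE.
have eW c : elementary (fun v => E v c l * w c i j).
  by apply: elementaryM => //; exact: elementary_cst.
refine (etrans (mpdE _ _ _ _ _) (etrans (congr1 (fun f => pd k f u) F) _)).
refine (etrans (pd_sum k u eW) _); rewrite summxE; apply: eq_bigr => c _.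
refine (etrans (pdM k u (eE c l) (elementary_cst (w c i j))) _).
refine (etrans (congr2 (fun x y => E u c l * x + w c i j * y)
  (pd_cst k (w c i j) u) (esym (mpdE k E u c l))) _).
by rewrite mulr0 add0r mulrC [RHS]mxE.
Qed.

Lemma elementary_levi_civita k : elementary_mx (T k).
Proof.
apply: elementary_mxM => //; apply: elementary_mxD.
  exact: elementary_mx_mpd.
by apply: elementary_mxM => //; exact: elementary_connection.
Qed.

(** The derivative of the gauge equation E T = dE + W E, in the form that
    [coord_curvatureE] takes. *)
Lemma mpd_levi_civita k l u :
  mpd k E u *m T l u + E u *m mpd k (T l) u =
  mpd k (mpd l E) u + ((\sum_e mpd k E u e l *: w e) *m E u + W l u *m mpd k E u).
Proof.
have ET : (fun v => E v *m T l v) = fun v => mpd l E v + W l v *m E v.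
  by apply: funext => v; exact: (mulE_connection w (fun m => mpd m E v) (NE v) l).
rewrite -mpd_connection.
refine (etrans (esym (mpdM k u eE (elementary_levi_civita l))) _).
refine (etrans (congr1 (fun X => mpd k X u) ET) _).
have eW := elementary_connection l.
refine (etrans (mpdD k u (elementary_mx_mpd l eE) (elementary_mxM eW eE)) _).
exact (congr1 (fun X => _ + X) (mpdM k u eW eE)).
Qed.

Definition riemann_mx k l u : 'M[C]_5 :=
  mpd k (T l) u - mpd l (T k) u + (T k u *m T l u - T l u *m T k u).

Lemma riemann_frame u i j k l : riemann g u i j k l = riemann_mx k l u i j.
Proof.
have chE a b : (fun v => christoffel g v i a b) = fun v => T a v i b.
  by apply: funext => v; exact: christoffel_frame.
rewrite /riemann /riemann_mx.
have p a b c : pd a (fun v => christoffel g v i b c) u = mpd a (T b) u i c.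
  exact (etrans (congr1 (fun f => pd a f u) (chE b c)) (esym (mpdE _ _ _ _ _))).
have ch a b c := christoffel_frame u a b c.
have q : \sum_m (christoffel g u i k m * christoffel g u m l j
  - christoffel g u i l m * christoffel g u m k j) =
  (T k u *m T l u - T l u *m T k u) i j.
  refine (etrans _ (esym (commutator_entry _ _ _ _))); apply: eq_bigr => m _.
  exact (congr2 (fun x y => x - y) (congr2 *%R (ch i k m) (ch m l j))
    (congr2 *%R (ch i l m) (ch m k j))).
refine (etrans (congr2 +%R (congr2 (fun x y => x - y) (p k l j) (p l k j)) q) _).
move: (mpd k _ u) (mpd l _ u) (T k u *m _ - _) => X Y Z.
by rewrite [RHS]mxE [X in _ = X + _]mxE [X in _ = _ + X + _]mxE; congr (_ + _).
Qed.

Lemma frame_riemann u k l :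
  E u *m riemann_mx k l u =
  (\sum_c \sum_d (E u c k * E u d l) *: frame_curvature w S c d) *m E u.
Proof.
exact: (coord_curvatureE (NE u) (structure_entry u) (mpd_levi_civita k l u)
  (mpd_levi_civita l k u) (mpdC k l u eE)).
Qed.

(** The coordinate Riemann tensor is the pull-back by [E] of the constant
    curvature of the frame, so [weyl_kulkarni_nomizu] applies pointwise. *)
Lemma frame_weyl u i j k l : weyl g u i j k l = 0.
Proof.
pose p := (E u)^T *m P *m E u.
have ps : p^T = p by rewrite /p !trmx_mul Ps trmxK mulmxA.
have RmE a b c d : (g u *m riemann_mx c d u) a b = kulkarni_nomizu p (g u) a b c d.
  rewrite -[g u]/((E u)^T *m G *m E u) -[_ *m E u *m _]mulmxA frame_riemann.
  rewrite mulmxA -[(E u)^T *m G *m _]mulmxA mulmx_sumr.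
  rewrite (eq_bigr (fun c' => \sum_d' (E u c' c * E u d' d) *: (G *m frame_curvature w S c' d'))).
    by rewrite (kulkarni_nomizu_pullback _ curvature).
  move=> c' _; rewrite mulmx_sumr; apply: eq_bigr => d' _; by rewrite -scalemxAr.
have rl a b c d : riemann_low g u a b c d = (g u *m riemann_mx c d u) a b.
  by rewrite mxE; apply: eq_bigr => m _; rewrite riemann_frame.
have rc a b : ricci g u a b = \sum_m riemann_mx m b u m a.
  by apply: eq_bigr => m _; rewrite riemann_frame.
have sc : scalar_curvature g u = \sum_a \sum_b invmx (g u) a b * \sum_m riemann_mx m b u m a.
  by apply: eq_bigr => a _; apply: eq_bigr => b _; rewrite rc.
rewrite /weyl rl !rc sc.
exact: (weyl_kulkarni_nomizu (frame_metric_inv u) (frame_metric_sym u) ps RmE).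
Qed.

End FrameCurvature.

(** * Integer tables for the two flat parameters *)

Definition table := seq (seq int).
Definition entry (s : table) (i j : nat) : int := nth 0 (nth [::] s i) j.

Definition sum5 (f : nat -> int) : int := f 0%N + f 1%N + f 2%N + f 3%N + f 4%N.
Definition all5 (p : nat -> bool) : bool := all p (iota 0 5).

Lemma all5P p : all5 p -> forall i : 'I_5, p i.
Proof. by move=> /allP H i; apply: H; rewrite mem_iota ltn_ord. Qed.

(** With the indices of the coframe starting from 0, the exterior derivative of
    the a-th form is a multiple of the wedge product of the forms in the a-th
    pair. *)
Definition lie_pairs : seq (nat * nat) := [:: (0, 2); (1, 2); (0, 1); (3, 4); (3, 4)]%N.

Definition lie_table (s : seq int) (a c d : nat) : int :=
  let ij := nth (0, 0)%N lie_pairs a in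
  nth 0 s a * (((c == ij.1) && (d == ij.2))%:Z - ((c == ij.2) && (d == ij.1))%:Z).

(** The hypotheses of [frame_weyl] with denominators cleared: the connection
    and the structure constants are the entries of [w] and [s] divided by a
    common denominator d, so the curvature and [P] carry d^2; the inverse of
    [G] is [Gi] divided by [k]. *)
Definition frame_data_check (G Gi P : table) (w : seq table) (k : int) (s : seq int) : bool :=
  let g := entry G in let p := entry P in
  let w c := entry (nth [::] w c) in
  let S e c d := w d e c - w c e d in
  [&& all5 (fun a => all5 (fun b =>
        [&& g a b == g b a, p a b == p b a &
            sum5 (fun m => entry Gi a m * g m b) == if a == b then k else 0])),
      all5 (fun c => all5 (fun a => all5 (fun b =>
        sum5 (fun m => g a m * w c m b) + sum5 (fun m => w c m a * g m b) == 0))),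
      all5 (fun a => all5 (fun c => all5 (fun d =>
        lie_table s a c d == S a c d))) &
      all5 (fun a => all5 (fun b => all5 (fun c => all5 (fun d =>
        sum5 (fun m => g a m *
          (sum5 (fun l => w c m l * w d l b) - sum5 (fun l => w d m l * w c l b)
           + sum5 (fun e => S e c d * w e m b)))
        == p a c * g b d - p a d * g b c + g a c * p b d - g a d * p b c))))].

(* The case alpha^2 = -9.  The metric is Nurowski's metric up to a constant
   factor; the connection and the structure constants are multiplied by 36, so
   the Schouten tensor is multiplied by 36^2.  The third structure constant is
   36 * (- 2 / -9) = 8. *)
Definition metric1 : table :=
  [:: [:: 0; 2; 0; 0; 2]; [:: 2; 0; 0; -2; 0]; [:: 0; 0; 3; -3; 3];
      [:: 0; -2; -3; 3; 3]; [:: 2; 0; 3; 3; 3]].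
Definition cometric1 : table :=
  [:: [:: 0; 9; -3; 0; 3]; [:: 9; 0; -3; -3; 0]; [:: -3; -3; 2; -3; 3];
      [:: 0; -3; -3; 0; 3]; [:: 3; 0; 3; 3; 0]].
Definition schouten1 : table :=
  [:: [:: 0; 180; 0; 0; -108]; [:: 180; 0; 0; 108; 0];
      [:: 0; 0; -162; 162; -162]; [:: 0; 108; 162; -162; -162];
      [:: -108; 0; -162; -162; -162]].
Definition connection1 : seq table :=
  [:: [:: [:: 0; 0; 0; 0; 0]; [:: 0; 0; 0; 0; 0]; [:: 0; -4; -6; 6; 6];
          [:: 0; 0; -6; 6; -6]; [:: 0; 0; 0; 0; 0]];
      [:: [:: 0; 0; 0; 0; 0]; [:: 0; 0; 0; 0; 0]; [:: 4; 0; 6; 6; 6];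
          [:: 0; 0; 0; 0; 0]; [:: 0; 0; -6; 6; -6]];
      [:: [:: 36; 0; 0; 0; 0]; [:: 0; -36; 0; 0; 0]; [:: -6; 6; 0; 18; 18];
          [:: -6; 0; 0; 18; 0]; [:: 0; -6; 0; 0; -18]];
      [:: [:: 0; 0; 0; 0; 0]; [:: 0; 0; 0; 0; 0]; [:: 6; 6; 18; 0; 0];
          [:: 6; 0; 18; 0; 18]; [:: 0; 6; 0; 0; -18]];
      [:: [:: 0; 0; 0; 0; 0]; [:: 0; 0; 0; 0; 0]; [:: 6; 6; 18; 0; 0];
          [:: -6; 0; 0; -18; 0]; [:: 0; -6; -18; 18; 0]]].

Lemma check1 : frame_data_check metric1 cometric1 schouten1 connection1 24
  [:: 36; -36; 8; -36; 36].
Proof. by vm_compute. Qed.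

(* The case alpha^2 = -1/9, with 12 in place of 36; here the third structure
   constant is 12 * 18 = 216. *)
Definition metric2 : table :=
  [:: [:: 0; -18; 0; 0; 6]; [:: -18; 0; 0; -6; 0]; [:: 0; 0; 1; -1; 1];
      [:: 0; -6; -1; 1; -7]; [:: 6; 0; 1; -7; 1]].
Definition cometric2 : table :=
  [:: [:: 0; -1; -1; 0; 1]; [:: -1; 0; -1; -1; 0]; [:: -1; -1; 30; 3; -3];
      [:: 0; -1; 3; 0; -3]; [:: 1; 0; -3; -3; 0]].
Definition schouten2 : table :=
  [:: [:: 0; 324; 0; 0; -108]; [:: 324; 0; 0; 108; 0]; [:: 0; 0; -18; 18; -18];
      [:: 0; 108; 18; -18; -162]; [:: -108; 0; -18; -162; -18]].
Definition connection2 : seq table :=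
  [:: [:: [:: 0; 0; -6; 6; -6]; [:: 0; 0; 0; 0; 0]; [:: 0; -108; 0; 0; 36];
          [:: 0; 0; 0; 0; 0]; [:: 0; 0; 0; 0; 0]];
      [:: [:: 0; 0; 0; 0; 0]; [:: 0; 0; 6; -6; 6]; [:: 108; 0; 0; 36; 0];
          [:: 0; 0; 0; 0; 0]; [:: 0; 0; 0; 0; 0]];
      [:: [:: 6; 0; 0; 2; 0]; [:: 0; -6; 0; 0; 2]; [:: 0; 0; 0; 0; 0];
          [:: 0; 0; 0; 0; 0]; [:: 0; 0; 0; 0; 0]];
      [:: [:: 6; 0; 2; -4; 2]; [:: 0; -6; 0; 0; -2]; [:: 0; 36; 0; 12; 0];
          [:: 0; 0; 0; 12; 0]; [:: 0; 0; 0; 0; -12]];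
      [:: [:: -6; 0; 0; 2; 0]; [:: 0; 6; 2; -2; 4]; [:: 36; 0; 0; 0; -12];
          [:: 0; 0; 0; -12; 0]; [:: 0; 0; 0; 0; 12]]].

Lemma check2 : frame_data_check metric2 cometric2 schouten2 connection2 24
  [:: 12; -12; 216; -12; 12].
Proof. by vm_compute. Qed.

Section Transport.
Variable K : numFieldType.

Lemma sum5E f : (sum5 f)%:~R = \sum_(i < 5) (f i)%:~R :> K.
Proof. by rewrite !big_ord_recl big_ord0 /= addr0 /sum5 !rmorphD /= !addrA. Qed.

Definition table_mx (s : table) : 'M[K]_5 := \matrix_(i, j) (entry s i j)%:~R.

Definition lie_index1 (a : 'I_5) : 'I_5 := inord (nth (0, 0) lie_pairs a).1%N.
Definition lie_index2 (a : 'I_5) : 'I_5 := inord (nth (0, 0) lie_pairs a).2%N.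

Lemma lie_index1E a : lie_index1 a = (nth (0, 0) lie_pairs a).1%N :> nat.
Proof. by rewrite /lie_index1 inordK; case: a => [[|[|[|[|[|]]]]]]. Qed.

Lemma lie_index2E a : lie_index2 a = (nth (0, 0) lie_pairs a).2%N :> nat.
Proof. by rewrite /lie_index2 inordK; case: a => [[|[|[|[|[|]]]]]]. Qed.

Definition lie_structure (c : 'I_5 -> K) (a : 'I_5) : 'M[K]_5 :=
  c a *: (delta_mx (lie_index1 a) (lie_index2 a)
          - delta_mx (lie_index2 a) (lie_index1 a)).

Lemma lie_structure_table (d : int) (s : seq int) a e f :
  lie_structure (fun b => (d%:~R)^-1 * (nth 0 s b)%:~R) a e f =
  (d%:~R)^-1 * (lie_table s a e f)%:~R.
Proof.
rewrite mxE /lie_table rmorphM /= mulrA; congr (_ * _).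
by rewrite !mxE rmorphB /= -!pmulrn -lie_index1E -lie_index2E -!val_eqE.
Qed.

Variables (G Gi P : table) (w : seq table) (k d : int) (s : seq int).
Hypothesis data : frame_data_check G Gi P w k s.
Hypothesis k0 : k != 0.
Hypothesis d0 : d != 0.

Let D : K := d%:~R.
Let D0 : D != 0. Proof. by rewrite intr_eq0. Qed.
Let wm (c : 'I_5) : 'M[K]_5 := D^-1 *: table_mx (nth [::] w c).
Let c (a : 'I_5) : K := D^-1 * (nth 0 s a)%:~R.

Lemma table_metric_inv : ((k%:~R)^-1 *: table_mx Gi) *m table_mx G = 1%:M.
Proof.
case/and4P: data => H _ _ _.
apply/matrixP => a b; move/all5P/(_ a)/all5P/(_ b)/and3P: H => [_ _ /eqP H].
rewrite -scalemxAl !mxE.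
transitivity ((k%:~R)^-1 * (sum5 (fun m => entry Gi a m * entry G m b))%:~R : K).
  by rewrite sum5E; congr (_ * _); apply: eq_bigr => m _; rewrite !mxE -intrM.
rewrite H -(inj_eq val_inj) /=; case: (_ == _); last by rewrite mulr0.
by rewrite mulVf // intr_eq0.
Qed.

Lemma table_metric_sym : (table_mx G)^T = table_mx G.
Proof.
case/and4P: data => H _ _ _.
apply/matrixP => a b; move/all5P/(_ b)/all5P/(_ a)/and3P: H => [/eqP H _ _].
by rewrite !mxE H.
Qed.

Lemma table_schouten_sym : (table_mx P)^T = table_mx P.
Proof.
case/and4P: data => H _ _ _.
apply/matrixP => a b; move/all5P/(_ b)/all5P/(_ a)/and3P: H => [_ /eqP H _].
by rewrite !mxE H.
Qed.

Lemma table_connection_metric e : table_mx G *m wm e + (wm e)^T *m table_mx G = 0.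
Proof.
case/and4P: data => _ H _ _.
apply/matrixP => a b; move/all5P/(_ e)/all5P/(_ a)/all5P/(_ b)/eqP: H => H.
rewrite /wm -scalemxAr [(_ *: _)^T]linearZ /= -scalemxAl -scalerDr !mxE.
transitivity (D^-1 * (sum5 (fun m => entry G a m * entry (nth [::] w e) m b)
   + sum5 (fun m => entry (nth [::] w e) m a * entry G m b))%:~R).
  rewrite rmorphD /= !sum5E; congr (_ * (_ + _)); apply: eq_bigr => m _.
    by rewrite !mxE -intrM.
  by rewrite !mxE -intrM.
by rewrite H mulr0.
Qed.

Lemma lie_structureE a e f : lie_structure c a e f = wm f a e - wm e a f.
Proof.
case/and4P: data => _ _ H _.
move/all5P/(_ a)/all5P/(_ e)/all5P/(_ f)/eqP: H => H.
rewrite lie_structure_table H rmorphB mulrBr /=.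
by congr (_ - _); rewrite !mxE.
Qed.

Lemma table_curvature a b e f :
  (table_mx G *m frame_curvature wm (lie_structure c) e f) a b =
  kulkarni_nomizu ((D ^+ 2)^-1 *: table_mx P) (table_mx G) a b e f.
Proof.
case/and4P: data => _ _ _ H.
move/all5P/(_ a)/all5P/(_ b)/all5P/(_ e)/all5P/(_ f)/eqP: H => H.
pose W (c : 'I_5) := entry (nth [::] w c).
have E m : frame_curvature wm (lie_structure c) e f m b = (D ^+ 2)^-1 *
  (sum5 (fun l => W e m l * W f l b) - sum5 (fun l => W f m l * W e l b)
     + sum5 (fun g => (W f g e - W e g f) * entry (nth [::] w g) m b))%:~R.
  rewrite /frame_curvature [LHS]mxE summxE commutator_entry rmorphD rmorphB /= !sum5E.
  rewrite -sumrB !mulrDr !mulr_sumr; congr (_ + _); apply: eq_bigr => l _.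
    by rewrite /wm /W !mxE !rmorphM /=; field.
  rewrite mxE lie_structureE /wm /W !mxE !(rmorphB, rmorphM) /=.
  by field.
transitivity ((D ^+ 2)^-1 * (sum5 (fun m => entry G a m *
  (sum5 (fun l => W e m l * W f l b) - sum5 (fun l => W f m l * W e l b)
     + sum5 (fun g => (W f g e - W e g f) * entry (nth [::] w g) m b))))%:~R).
  rewrite mxE [X in _ * X]sum5E mulr_sumr; apply: eq_bigr => m _.
  by rewrite E mxE intrM mulrCA.
rewrite /W H /kulkarni_nomizu !mxE !(rmorphB, rmorphD, rmorphM) /=; ring.
Qed.

End Transport.

(** * Constant solutions of the structure equations of Cartan *)

Definition wedge_entry (x y : nat -> int) e f : int := x e * y f - y e * x f.

(** The structure equations for the coframe with rows [T] and the forms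
    Omega_1, ..., Omega_7 with rows [O] divided by [D], multiplied by [d] [D]
    (and by 3 where the coefficient 4/3 occurs); then the formula for the
    metric, and the invertibility of [T]. *)
Definition cartan_check (T O G Ti : table) (m n d D : int) (s : seq int) : bool :=
  let t := entry T in let o := entry O in
  let w := wedge_entry in
  let dt k e f := sum5 (fun a => t k a * lie_table s a e f) in
  all5 (fun e => all5 (fun f => [&&
    D * dt 0%N e f == d * (w (t 0%N) (fun e => 2 * o 0%N e + o 3%N e) e f + w (t 1%N) (o 1%N) e f
                         + D * w (t 2%N) (t 3%N) e f),
    D * dt 1%N e f == d * (w (t 0%N) (o 2%N) e f + w (t 1%N) (fun e => o 0%N e + 2 * o 3%N e) e f
                         + D * w (t 2%N) (t 4%N) e f),
    D * dt 2%N e f == d * (w (t 0%N) (o 4%N) e f + w (t 1%N) (o 5%N) e f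
                         + w (t 2%N) (fun e => o 0%N e + o 3%N e) e f + D * w (t 3%N) (t 4%N) e f),
    3 * D * dt 3%N e f == d * (3 * w (t 0%N) (o 6%N) e f + 4 * w (t 2%N) (o 5%N) e f
                         + 3 * w (t 3%N) (o 0%N) e f + 3 * w (t 4%N) (o 1%N) e f),
    3 * D * dt 4%N e f == d * (3 * w (t 1%N) (o 6%N) e f - 4 * w (t 2%N) (o 4%N) e f
                         + 3 * w (t 3%N) (o 2%N) e f + 3 * w (t 4%N) (o 3%N) e f),
    3 * (t 0%N e * t 4%N f + t 4%N e * t 0%N f - (t 1%N e * t 3%N f + t 3%N e * t 1%N f))
      + 4 * (t 2%N e * t 2%N f) == m * entry G e f &
    sum5 (fun a => t e a * entry Ti a f) == if e == f then n else 0])).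

(* With c = 2 (1 + alpha^2) and r = alpha^2 / c, a solution is
     r theta_0, r theta_1, r theta_2, e4 + k theta_0, e5 - k theta_1
   where k = -1/4 for alpha^2 = -9 and k = -3/4 for alpha^2 = -1/9.  The
   structure equations are homogeneous for the weights 3, 3, 2, 1, 1, and
   rescaling by 4 makes all the coefficients integers. *)
Definition coframe1 : table :=
  [:: [:: 36; 0; 0; 36; 0]; [:: 0; 36; 0; 0; -36]; [:: 0; 0; 9; -9; 9];
      [:: -1; 0; 0; 3; 0]; [:: 0; 1; 0; 0; 3]].
Definition forms1 : table :=
  [:: [:: 0; 0; 36; 12; -12]; [:: 0; 0; 0; 0; 0]; [:: 0; 0; 0; 0; 0];
      [:: 0; 0; -36; -12; 12]; [:: 0; 2; 0; 0; 6]; [:: -2; 0; 0; 6; 0];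
      [:: 0; 0; -1; 1; -1]].
Definition coframe1_inv : table :=
  [:: [:: 3; 0; 0; -36; 0]; [:: 0; 3; 0; 0; 36]; [:: 1; 1; 16; 36; -36];
      [:: 1; 0; 0; 36; 0]; [:: 0; -1; 0; 0; 36]].
Definition coframe2 : table :=
  [:: [:: -4; 0; 0; -4; 0]; [:: 0; -4; 0; 0; 4]; [:: 0; 0; -1; 1; -1];
      [:: -3; 0; 0; 1; 0]; [:: 0; 3; 0; 0; 1]].
Definition forms2 : table :=
  [:: [:: 0; 0; 4; 12; -12]; [:: 0; 0; 0; 0; 0]; [:: 0; 0; 0; 0; 0];
      [:: 0; 0; -4; -12; 12]; [:: 0; 18; 0; 0; 6]; [:: -18; 0; 0; 6; 0];
      [:: 0; 0; 3; -3; 3]].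
Definition coframe2_inv : table :=
  [:: [:: -1; 0; 0; -4; 0]; [:: 0; -1; 0; 0; 4]; [:: -3; -3; -16; 4; -4];
      [:: -3; 0; 0; 4; 0]; [:: 0; 3; 0; 0; 4]].

Lemma cartan_check1 : cartan_check coframe1 forms1 metric1 coframe1_inv 108 144 36 48
  [:: 36; -36; 8; -36; 36].
Proof. by vm_compute. Qed.

Lemma cartan_check2 : cartan_check coframe2 forms2 metric2 coframe2_inv 4 16 12 16
  [:: 12; -12; 216; -12; 12].
Proof. by vm_compute. Qed.

Section CartanTransport.
Variable K : numFieldType.

Definition table_row (s : table) (k : nat) : 'rV[K]_5 := \row_a (entry s k a)%:~R.

Definition const_wedge (a b : 'rV[K]_5) : 'M[K]_5 := a^T *m b - b^T *m a.

Lemma const_wedgeE a b e f : const_wedge a b e f = a 0 e * b 0 f - b 0 e * a 0 f.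
Proof. by rewrite !mxE !big_ord1 !mxE. Qed.

Variables (T O G Ti : table) (m n d D : int) (s : seq int).
Hypothesis data : cartan_check T O G Ti m n d D s.
Hypothesis d0 : d != 0.
Hypothesis D0 : D != 0.
Hypothesis n0 : n != 0.

Let dK : d%:~R != 0 :> K. Proof. by rewrite intr_eq0. Qed.
Let DK : D%:~R != 0 :> K. Proof. by rewrite intr_eq0. Qed.
Let c (a : 'I_5) : K := (d%:~R)^-1 * (nth 0 s a)%:~R.
Let S := lie_structure c.
Let t k := table_row T k.
Let o k := (D%:~R)^-1 *: table_row O k.
Let w := const_wedge.
Let dt k := \sum_a t k 0 a *: S a.

Let dtE k e f : dt k e f = (d%:~R)^-1 * (sum5 (fun a =>
  entry T k a * lie_table s a e f))%:~R.
Proof.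
rewrite /dt summxE sum5E mulr_sumr; apply: eq_bigr => a _.
by rewrite mxE lie_structure_table mxE [in RHS]intrM mulrCA.
Qed.

Let scaled (v z x : int) : v != 0 -> v * D * z = d * x ->
  (d%:~R)^-1 * z%:~R = (v%:~R * D%:~R)^-1 * x%:~R :> K.
Proof.
move=> v0 H; have vK : v%:~R != 0 :> K by rewrite intr_eq0.
apply: (mulfI (mulf_neq0 dK (mulf_neq0 vK DK))).
rewrite [RHS]mulrA mulfK ?mulf_neq0 // -[in RHS]intrM -H !rmorphM /=.
by field.
Qed.

Lemma table_cartan :
  [/\ dt 0%N = w (t 0%N) (2 *: o 0%N + o 3%N) + w (t 1%N) (o 1%N) + w (t 2%N) (t 3%N),
      dt 1%N = w (t 0%N) (o 2%N) + w (t 1%N) (o 0%N + 2 *: o 3%N) + w (t 2%N) (t 4%N),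
      dt 2%N = w (t 0%N) (o 4%N) + w (t 1%N) (o 5%N) + w (t 2%N) (o 0%N + o 3%N)
               + w (t 3%N) (t 4%N),
      dt 3%N = w (t 0%N) (o 6%N) + (4 / 3) *: w (t 2%N) (o 5%N) + w (t 3%N) (o 0%N)
               + w (t 4%N) (o 1%N) &
      dt 4%N = w (t 1%N) (o 6%N) - (4 / 3) *: w (t 2%N) (o 4%N) + w (t 3%N) (o 2%N)
               + w (t 4%N) (o 3%N)].
Proof.
have wE := const_wedgeE.
split; apply/matrixP => e f; move: data => /all5P/(_ e)/all5P/(_ f) /andP [/eqP E0]
  /and5P [/eqP E1 /eqP E2 /eqP E3 /eqP E4 _]; rewrite dtE.
- have := @scaled 1 _ _ isT; rewrite mul1r => /(_ _ _ E0) ->.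
  by rewrite !(mxE, big_ord1) /wedge_entry !(rmorphD, rmorphB, rmorphM) /=; field; rewrite DK.
- have := @scaled 1 _ _ isT; rewrite mul1r => /(_ _ _ E1) ->.
  by rewrite !(mxE, big_ord1) /wedge_entry !(rmorphD, rmorphB, rmorphM) /=; field; rewrite DK.
- have := @scaled 1 _ _ isT; rewrite mul1r => /(_ _ _ E2) ->.
  by rewrite !(mxE, big_ord1) /wedge_entry !(rmorphD, rmorphB, rmorphM) /=; field; rewrite DK.
- rewrite (@scaled 3 _ _ isT E3).
  by rewrite !(mxE, big_ord1) /wedge_entry !(rmorphD, rmorphB, rmorphM) /=; field; rewrite DK.
- rewrite (@scaled 3 _ _ isT E4).
  by rewrite !(mxE, big_ord1) /wedge_entry !(rmorphD, rmorphB, rmorphM) /=; field; rewrite DK.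
Qed.

Lemma table_cartan_metric :
  ((t 0%N)^T *m t 4%N + (t 4%N)^T *m t 0%N) - ((t 1%N)^T *m t 3%N + (t 3%N)^T *m t 1%N)
  + (4 / 3) *: ((t 2%N)^T *m t 2%N) = (m%:~R / 3) *: table_mx K G.
Proof.
apply/matrixP => e f; move: data => /all5P/(_ e)/all5P/(_ f) /andP [_]
  /and5P [_ _ _ _ /andP [/eqP E _]].
have {}E := congr1 (fun x : int => x%:~R : K) E.
rewrite !(mxE, big_ord1).
have -> : m%:~R / 3 * (entry G e f)%:~R = (m * entry G e f)%:~R / 3 :> K.
  by rewrite intrM mulrAC.
by rewrite -E !(rmorphD, rmorphB, rmorphM) /=; field.
Qed.

Lemma table_cartan_free : (\matrix_(k < 5) t k) *m ((n%:~R)^-1 *: table_mx K Ti) = 1%:M.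
Proof.
apply/matrixP => e f; move: data => /all5P/(_ e)/all5P/(_ f) /andP [_]
  /and5P [_ _ _ _ /andP [_ /eqP E]].
rewrite -scalemxAr !mxE.
transitivity ((n%:~R)^-1 * (sum5 (fun a => entry T e a * entry Ti a f))%:~R : K).
  by rewrite sum5E; congr (_ * _); apply: eq_bigr => a _; rewrite !mxE -intrM.
rewrite E -(inj_eq val_inj) /=; case: (_ == _); last by rewrite mulr0.
by rewrite mulVf // intr_eq0.
Qed.

End CartanTransport.

(** * The invariant coframe *)

Section LieStructure.
Variable F : fieldType.
Implicit Types (al y p A : F).

(** Row [a], column [k]: the coefficient of the k-th coordinate differential in
    e_(a+1).  The variables are al = alpha and A = exp (alpha x). *)
Definition coframe_entry al y p A (a k : nat) : F :=
  match a, k with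
  | 0%N, 1%N => al | 0%N, 2%N => al * (y + y * y * p) | 0%N, 3%N => - al * (y * y)
  | 1%N, 2%N => - al * p | 1%N, 3%N => al
  | 2%N, 2%N => 1 + 2 * (y * p) | 2%N, 3%N => - 2 * y
  | 3%N, 0%N => al / 2 | 3%N, 4%N => - (al / 2) * A
  | 4%N, 0%N => al / 2 | 4%N, 4%N => al / 2 * A
  | _, _ => 0
  end.

(** The derivative of the previous entries in the direction [j], where A
    depends on x with derivative al A. *)
Definition coframe_entry_pd al y p A (a k j : nat) : F :=
  match a, k, j with
  | 0%N, 2%N, 1%N => al * (1 + 2 * (y * p)) | 0%N, 2%N, 3%N => al * (y * y)
  | 0%N, 3%N, 1%N => - al * (2 * y)
  | 1%N, 2%N, 3%N => - al
  | 2%N, 2%N, 1%N => 2 * p | 2%N, 2%N, 3%N => 2 * y | 2%N, 3%N, 1%N => - 2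
  | 3%N, 4%N, 0%N => - (al / 2) * (al * A)
  | 4%N, 4%N, 0%N => al / 2 * (al * A)
  | _, _, _ => 0
  end.

(** The inverse matrix.  B stands for exp (- alpha x): written in this way,
    and not as 1/A, the entries are elementary functions in the sense above. *)
Definition frame_entry al y p B (k b : nat) : F :=
  match k, b with
  | 0%N, 3%N | 0%N, 4%N => al^-1
  | 1%N, 0%N => al^-1 | 1%N, 1%N => - al^-1 * (y * y) | 1%N, 2%N => - 1 * y
  | 2%N, 1%N => 2 / al * y | 2%N, 2%N => 1
  | 3%N, 1%N => al^-1 * (1 + 2 * (y * p)) | 3%N, 2%N => p
  | 4%N, 3%N => - al^-1 * B | 4%N, 4%N => al^-1 * B
  | _, _ => 0
  end.

Definition lie_coef (s : F) (a : 'I_5) : F := nth 0 [:: 1; -1; s; -1; 1] a.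

End LieStructure.

Lemma mul_delta_mx_entry (K : pzRingType) m n p q (A : 'M[K]_(m, n)) (B : 'M[K]_(p, q))
    i l j k : (A *m delta_mx i l *m B) j k = A j i * B l k.
Proof. by rewrite -(mul_delta_mx (0 : 'I_1)) !mulmxA -colE -mulmxA -rowE mxE big_ord1 !mxE. Qed.

Lemma ord5P (P : 'I_5 -> Prop) : P 0 -> P 1 -> P 2 -> P 3 -> P 4 -> forall i, P i.
Proof.
move=> P0 P1 P2 P3 P4 [[|[|[|[|[|//]]]]] i].
- by rewrite (_ : Ordinal i = 0) //; apply: val_inj.
- by rewrite (_ : Ordinal i = 1) //; apply: val_inj.
- by rewrite (_ : Ordinal i = 2) //; apply: val_inj.
- by rewrite (_ : Ordinal i = 3) //; apply: val_inj.
- by rewrite (_ : Ordinal i = 4) //; apply: val_inj.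
Qed.

(** The structure equations as identities between rational functions of the
    variables al, y, p, A. *)
Lemma coframe_structure_entry (K : numFieldType) (al y p A : K) (al0 : al != 0) (a j k : 'I_5) :
  let E : 'M[K]_5 := \matrix_(a, k) coframe_entry al y p A a k in
  coframe_entry_pd al y p A a k j - coframe_entry_pd al y p A a j k =
  (E^T *m lie_structure (lie_coef (- 2 / al ^+ 2)) a *m E) j k.
Proof.
move=> E; rewrite -scalemxAr -scalemxAl mulmxBr mulmxBl.
rewrite [RHS]mxE [X in _ = _ * X]mxE [X in _ = _ * (_ + X)]mxE !mul_delta_mx_entry !mxE.
rewrite lie_index1E lie_index2E /lie_coef; clear E.
move: a => [[|[|[|[|[|//]]]]] ia]; move: j => [[|[|[|[|[|//]]]]] ij];
  move: k => [[|[|[|[|[|//]]]]] ik] /=; by field.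
Qed.
Lemma frame_coframe_entry (F : fieldType) (al y p A B : F) : al != 0 -> (2 : F) != 0 -> B * A = 1 ->
  (\matrix_(k < 5, b < 5) frame_entry al y p B k b) *m
  (\matrix_(a < 5, k < 5) coframe_entry al y p A a k) = 1%:M.
Proof.
move=> al0 two0 BA.
have A0 : A != 0 by apply/eqP => A0; move/eqP: BA; rewrite A0 mulr0 eq_sym oner_eq0.
have -> : B = A^-1 by rewrite -[LHS]mulr1 -(divff A0) mulrA BA mul1r.
apply/matrixP => i j; rewrite !mxE !big_ord_recl big_ord0 !mxE /=.
move: i j; case=> [[|[|[|[|[|//]]]]] ii]; case=> [[|[|[|[|[|//]]]]] jj] /=; field;
  rewrite ?al0 ?A0 ?two0 //.
Qed.

Section ContactForms.
Variable K : fieldType.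

Definition row5 (s : seq K) : 'rV[K]_5 := \row_a s`_a.

Lemma row5_0 s : row5 s 0 0 = s`_0. Proof. by rewrite mxE. Qed.
Lemma row5_1 s : row5 s 0 1 = s`_1. Proof. by rewrite mxE. Qed.
Lemma row5_2 s : row5 s 0 2 = s`_2. Proof. by rewrite mxE. Qed.
Lemma row5_3 s : row5 s 0 3 = s`_3. Proof. by rewrite mxE. Qed.
Lemma row5_4 s : row5 s 0 4 = s`_4. Proof. by rewrite mxE. Qed.
Definition row5E := (row5_0, row5_1, row5_2, row5_3, row5_4).

(** The coefficients of theta_0, theta_1, theta_2 in the coframe. *)
Definition contact_form (k : 'I_3) : 'rV[K]_5 :=
  row5 (nth [::] [:: [:: 1; 0; 0; 1]; [:: 0; 1; 0; 0; -1]; [:: 0; 0; 1; -1; 1]] k).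

Variables (al y p A : K).

Definition coframe_mx : 'M[K]_5 := \matrix_(a, k) coframe_entry al y p A a k.

Lemma contact_coframe : al != 0 -> (2 : K) != 0 -> forall k : 'I_3,
  contact_form k *m coframe_mx = nth 0
    [:: row5 [:: al / 2; al; al * (y + y * y * p); - al * (y * y); - (al / 2) * A];
        row5 [:: - (al / 2); 0; - al * p; al; - (al / 2 * A)];
        row5 [:: 0; 0; 1 + 2 * (y * p); - 2 * y; al * A]] k.
Proof.
move=> al0 two0 k; apply/rowP => j; rewrite mxE !big_ord_recl big_ord0 !mxE.
by case: k j => [[|[|[|//]]]] ik [[|[|[|[|[|//]]]]] ij] /=;
  rewrite ?mxE /=; field; rewrite ?al0 ?two0.
Qed.

Local Notation dx := (delta_mx 0 0 : 'rV[K]_5).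
Local Notation dy := (delta_mx 0 1 : 'rV[K]_5).
Local Notation dz := (delta_mx 0 2 : 'rV[K]_5).
Local Notation dp := (delta_mx 0 3 : 'rV[K]_5).
Local Notation dq := (delta_mx 0 4 : 'rV[K]_5).

(** The left-hand sides are omega1, omega2, omega3 written out, with the
    exponential replaced by the variable A and the imaginary unit by i. *)
Lemma rolling_rows (i : K) : al != 0 -> (2 : K) != 0 ->
  [/\ i *: (dy + y *: dz) - (i * (y ^+ 2 - 1)) *: (dp - p *: dz) - (i * A) *: dq =
       (i / al) *: (contact_form 0 *m coframe_mx + contact_form 1 *m coframe_mx),
      dy + y *: dz - (y ^+ 2 + 1) *: (dp - p *: dz) + dx =
       al^-1 *: (contact_form 0 *m coframe_mx - contact_form 1 *m coframe_mx) &
      - (2 * i * y) *: (dp - p *: dz) + i *: dz + (i * al * A) *: dq =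
       i *: (contact_form 2 *m coframe_mx)].
Proof.
move=> al0 two0; rewrite !contact_coframe //=.
split; apply/rowP => -[[|[|[|[|[|//]]]]] ij]; rewrite !mxE /=; field; rewrite ?al0 ?two0 //.
Qed.

End ContactForms.

(* The covector in a goal for the second tactic may be left undetermined: the
   rules for sums, products and exponentials compute it. *)
Ltac elementary_tac :=
  lazymatch goal with
  | |- elementary (fun u => @?f u + @?g u) =>
      refine (@elementaryD _ f g _ _); elementary_tac
  | |- elementary (fun u => @?f u * @?g u) =>
      refine (@elementaryM _ f g _ _); elementary_tac
  | |- elementary (fun u => cexp (@?f u)) =>
      refine (@elementary_exp _ f _); elementary_tac
  | |- elementary (fun u => fun_of_matrix u _ ?k) => exact (@elementary_coord _ k)
  | |- elementary (fun u => ?c) => exact (@elementary_cst _ c)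
  end.

Ltac has_diff_tac :=
  lazymatch goal with
  | |- has_diff (fun u => @?f u + @?g u) _ _ =>
      eapply (@has_diffD _ f g); has_diff_tac
  | |- has_diff (fun u => @?f u * @?g u) _ _ =>
      eapply (@has_diffM _ f g); has_diff_tac
  | |- has_diff (fun u => cexp (@?f u)) _ _ =>
      eapply (@has_diff_exp _ f); has_diff_tac
  | |- has_diff (fun u => fun_of_matrix u _ ?k) ?u _ => exact (@has_diff_coord _ k u)
  | |- has_diff (fun u => ?c) ?u _ => exact (@has_diff_cst _ c u)
  end.

Section Coframe.
Variables (R : realType) (alpha : CC R).
Hypothesis alpha_neq0 : alpha != 0.
Local Notation C := (CC R).
Local Notation C5 := (C5 R).

Definition coframe (u : C5) : 'M[C]_5 :=
  coframe_mx alpha (yc u) (pc u) (cexp (alpha * xc u)).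

Definition frame (u : C5) : 'M[C]_5 :=
  \matrix_(k, b) frame_entry alpha (yc u) (pc u) (cexp (- alpha * xc u)) k b.

Lemma frame_coframe u : frame u *m coframe u = 1%:M.
Proof.
apply: frame_coframe_entry => //; first by rewrite pnatr_eq0.
by rewrite mulNr cexpNK.
Qed.

Lemma elementary_coframe : elementary_mx coframe.
Proof.
move=> a k; rewrite (_ : (fun u => _) = fun u : C5 =>
  coframe_entry alpha (yc u) (pc u) (cexp (alpha * xc u)) a k); last first.
  by apply: funext => u; exact: mxE.
move: a k => [[|[|[|[|[|//]]]]] ia] [[|[|[|[|[|//]]]]] ik] /=;
  rewrite /yc /pc /xc; elementary_tac.
Qed.

Lemma elementary_frame : elementary_mx frame.
Proof.
move=> a k; rewrite (_ : (fun u => _) = fun u : C5 =>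
  frame_entry alpha (yc u) (pc u) (cexp (- alpha * xc u)) a k); last first.
  by apply: funext => u; exact: mxE.
move: a k => [[|[|[|[|[|//]]]]] ia] [[|[|[|[|[|//]]]]] ik] /=;
  rewrite /yc /pc /xc; elementary_tac.
Qed.

Lemma has_diff_coframe a k u : has_diff (fun v => coframe v a k) u
  (\row_j coframe_entry_pd alpha (yc u) (pc u) (cexp (alpha * xc u)) a k j).
Proof.
rewrite (_ : (fun v => _) = fun v : C5 =>
  coframe_entry alpha (yc v) (pc v) (cexp (alpha * xc v)) a k); last first.
  by apply: funext => v; exact: mxE.
move: a k => [[|[|[|[|[|//]]]]] ia] [[|[|[|[|[|//]]]]] ik] /=;
  rewrite /yc /pc /xc; (eapply has_diff_eq; [has_diff_tac|]);
  apply/rowP => -[[|[|[|[|[|//]]]]] ij]; rewrite !mxE /=; ring.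
Qed.

Definition invariant_structure := lie_structure (lie_coef (- 2 / alpha ^+ 2)).

Lemma coframe_structure a u :
  extd (fun v => row a (coframe v)) u =
  (coframe u)^T *m invariant_structure a *m coframe u.
Proof.
apply/matrixP => j k; rewrite -coframe_structure_entry //.
have E i l : pd i (fun v => row a (coframe v) 0 l) u =
    coframe_entry_pd alpha (yc u) (pc u) (cexp (alpha * xc u)) a l i.
  rewrite (_ : (fun v => _) = fun v => coframe v a l); last first.
    by apply: funext => v; exact: mxE.
  exact (etrans (has_diff_pd i (has_diff_coframe a l u)) (mxE _ _ _ _)).
refine (etrans (mxE _ _ _ _) _).
exact (congr2 (fun x y => x - y) (E j k) (E k j)).
Qed.

End Coframe.

(** * Linear algebra of the distribution in the frame *)

Lemma sum_I5 (V : nmodType) (f : 'I_5 -> V) : \sum_i f i = f 0 + f 1 + f 2 + f 3 + f 4.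
Proof.
rewrite !big_ord_recl big_ord0 addr0 !addrA.
by congr (_ + _ + _ + _ + _); congr f; apply: val_inj.
Qed.

Lemma sum_I3 (V : nmodType) (f : 'I_3 -> V) : \sum_i f i = f 0 + f 1 + f 2.
Proof.
rewrite !big_ord_recl big_ord0 addr0 !addrA.
by congr (_ + _ + _); congr f; apply: val_inj.
Qed.

Section ContactAlgebra.
Variable K : fieldType.
Implicit Types (Y Z : 'rV[K]_5) (s : K).

Lemma rowP5 Y Z : Y 0 0 = Z 0 0 -> Y 0 1 = Z 0 1 -> Y 0 2 = Z 0 2 ->
  Y 0 3 = Z 0 3 -> Y 0 4 = Z 0 4 -> Y = Z.
Proof. by move=> *; apply/rowP; apply: ord5P. Qed.

Lemma contact_sum (k : 'I_3) Y : \sum_j contact_form K k 0 j * Y 0 j =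
  nth 0 [:: Y 0 0 + Y 0 3; Y 0 1 - Y 0 4; Y 0 2 - Y 0 3 + Y 0 4] k.
Proof.
by rewrite sum_I5; case: k => [[|[|[|//]]]] i; rewrite /contact_form /= !row5E /=; ring.
Qed.

(** The coordinates in the dual frame of the vectors annihilated by theta_0,
    theta_1, theta_2. *)
Definition rank2_coords Y := [/\ Y 0 0 = - Y 0 3, Y 0 1 = Y 0 4 & Y 0 2 = Y 0 3 - Y 0 4].

(** Those of the vectors annihilated by theta_0 and theta_1. *)
Definition rank3_coords Y := Y 0 0 = - Y 0 3 /\ Y 0 1 = Y 0 4.

(** theta_0 and theta_1, the forms that vanish on the brackets of sections of
    the distribution. *)
Definition derived_form (k : 'I_2) : 'rV[K]_5 := contact_form K (widen_ord (leqnSn 2) k).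

Lemma rank2_coordsP Y :
  (forall k, \sum_j contact_form K k 0 j * Y 0 j = 0) <-> rank2_coords Y.
Proof.
split=> [H|[H0 H1 H2] k]; last first.
  by rewrite contact_sum H0 H1 H2; case: k => [[|[|[|//]]]] i /=; ring.
move: (H 0) (H 1) (H 2); rewrite !contact_sum /rank2_coords /=.
move: (Y 0 0) (Y 0 1) (Y 0 2) (Y 0 3) (Y 0 4) => y0 y1 y2 y3 y4 h0 h1 h2; split.
- by rewrite -[LHS]subr0 -[X in _ - X]h0; ring.
- by rewrite -[LHS]subr0 -[X in _ - X]h1; ring.
- by rewrite -[LHS]subr0 -[X in _ - X]h2; ring.
Qed.

Lemma rank3_coordsP Y :
  (forall k, \sum_j derived_form k 0 j * Y 0 j = 0) <-> rank3_coords Y.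
Proof.
split=> [H|[H0 H1] k]; last first.
  by rewrite contact_sum H0 H1; case: k => [[|[|//]]] i /=; ring.
move: (H 0) (H 1); rewrite !contact_sum /rank3_coords /=.
move: (Y 0 0) (Y 0 1) (Y 0 2) (Y 0 3) (Y 0 4) => y0 y1 y2 y3 y4 h0 h1; split.
- by rewrite -[LHS]subr0 -[X in _ - X]h0; ring.
- by rewrite -[LHS]subr0 -[X in _ - X]h1; ring.
Qed.

(** Rows 1 and 2 are a basis of the rank 2 space, and row 3 completes them to
    a basis of the rank 3 space. *)
Definition section1 : 'rV[K]_5 := row5 [:: -1; 0; 1; 1; 0].
Definition section2 : 'rV[K]_5 := row5 [:: 0; 1; -1; 0; 1].
Definition section3 : 'rV[K]_5 := row5 [:: 0; 0; 1; 0; 0].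
Definition sections r (k : 'I_r) := nth 0 [:: section1; section2; section3] k.

Lemma sections_rank2 (k : 'I_2) : rank2_coords (sections k).
Proof.
by case: k => [[|[|//]]] i; rewrite /rank2_coords /sections /= !row5E /=; split; ring.
Qed.

Lemma sections_rank3 (k : 'I_3) : rank3_coords (sections k).
Proof.
by case: k => [[|[|[|//]]]] i; rewrite /rank3_coords /sections /= !row5E /=; split; ring.
Qed.

(** The k-th column reads off the coefficient along the k-th of the rows
    above, for vectors in their span. *)
Definition coord_selector r : 'M[K]_(5, r) :=
  \matrix_(a, k) (nth [::] [:: [:: 0; 0; 0; 1; 0]; [:: 0; 0; 0; 0; 1]; [:: 0; 0; 1; -1; 1]] k)`_a.

Lemma selectorE r Y (k : 'I_r) : (Y *m coord_selector r) 0 k =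
  nth 0 [:: Y 0 3; Y 0 4; Y 0 2 - Y 0 3 + Y 0 4] k.
Proof.
rewrite mxE sum_I5 !mxE /=.
move: (Y 0 0) (Y 0 1) (Y 0 2) (Y 0 3) (Y 0 4) => y0 y1 y2 y3 y4.
by case: k => [[|[|[|k]]]] i /=; rewrite ?nth_nil; ring.
Qed.

Lemma sections_selector r : (r <= 3)%N -> (\matrix_k @sections r k) *m coord_selector r = 1%:M.
Proof.
move=> r3; apply/row_matrixP => i; rewrite row_mul rowK; apply/rowP => j.
rewrite selectorE [RHS]mxE mxE.
have := leq_trans (ltn_ord i) r3; have := leq_trans (ltn_ord j) r3.
rewrite -(inj_eq val_inj) /= /sections.
by case: (val i) => [|[|[|//]]]; case: (val j) => [|[|[|//]]] _ _ /=; rewrite !row5E /=; ring.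
Qed.

Lemma row_addE Y Z k : (Y + Z) 0 k = Y 0 k + Z 0 k.
Proof. exact: mxE. Qed.

Lemma row_scaleE s Y k : (s *: Y) 0 k = s * Y 0 k.
Proof. exact: mxE. Qed.

Lemma rank2_spanP Y :
  rank2_coords Y <-> Y = \sum_k (Y *m coord_selector 2) 0 k *: sections k.
Proof.
rewrite !big_ord_recl big_ord0 !selectorE /sections /= addr0; split.
  by move=> [H0 H1 H2]; apply: rowP5; rewrite row_addE !row_scaleE !row5E /= ?H0 ?H1 ?H2; ring.
by move=> YE; split; rewrite {1}YE row_addE !row_scaleE !row5E /=; ring.
Qed.

Lemma rank3_spanP Y :
  rank3_coords Y <-> Y = \sum_k (Y *m coord_selector 3) 0 k *: sections k.
Proof.
rewrite !big_ord_recl big_ord0 !selectorE /sections /= addr0; split.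
  by move=> [H0 H1]; apply: rowP5; rewrite !row_addE !row_scaleE !row5E /= ?H0 ?H1; ring.
by move=> YE; split; rewrite {1}YE !row_addE !row_scaleE !row5E /=; ring.
Qed.

(** The bracket of the Lie algebra of the frame, with d(e_3) = s e_1 /\ e_2. *)
Definition lie_bracket_row s Y Z : 'rV[K]_5 := row5
  [:: - (Y 0 0 * Z 0 2 - Y 0 2 * Z 0 0); Y 0 1 * Z 0 2 - Y 0 2 * Z 0 1;
      - s * (Y 0 0 * Z 0 1 - Y 0 1 * Z 0 0);
      Y 0 3 * Z 0 4 - Y 0 4 * Z 0 3; - (Y 0 3 * Z 0 4 - Y 0 4 * Z 0 3)].

Lemma lie_bracket_rank3 s Y Z :
  rank2_coords Y -> rank2_coords Z -> rank3_coords (lie_bracket_row s Y Z).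
Proof.
move=> [y0 y1 y2] [z0 z1 z2]; rewrite /rank3_coords /lie_bracket_row !row5E /=.
by rewrite y0 y1 y2 z0 z1 z2; split; ring.
Qed.

(** Modulo the first two sections, their bracket is (s - 2) times the third
    one; with s = - 2 / alpha^2 this vanishes exactly for alpha^2 = -1. *)
Lemma rank3_bracket_span s Y : s - 2 != 0 -> rank3_coords Y ->
  exists c : 'I_3 -> K, Y = \sum_k c k *:
    nth 0 [:: section1; section2; lie_bracket_row s section1 section2] k.
Proof.
move=> s2 [H0 H1]; pose e := (Y 0 2 - Y 0 3 + Y 0 4) / (s - 2).
have Y2 : Y 0 2 = e * (s - 2) + Y 0 3 - Y 0 4 by rewrite /e divfK //; ring.
exists (fun k => nth 0 [:: Y 0 3 - e; Y 0 4 + e; e] k).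
rewrite !big_ord_recl big_ord0 addr0 /=.
by apply: rowP5; rewrite !row_addE !row_scaleE !row5E /= ?row5E /= ?H0 ?H1 ?Y2; ring.
Qed.

(** The brackets of the first two sections with the third one supply the two
    missing directions, for every s. *)
Lemma bracket_span s Y : exists c : 'I_5 -> K, Y = \sum_k c k *:
  nth 0 [:: section1; section2; section3; lie_bracket_row s section1 section3;
            lie_bracket_row s section2 section3] k.
Proof.
exists (fun k => nth 0
  [:: Y 0 3; Y 0 4; Y 0 2 - Y 0 3 + Y 0 4; Y 0 0 + Y 0 3; Y 0 1 - Y 0 4] k).
rewrite sum_I5 /=.
by apply: rowP5; rewrite !row_addE !row_scaleE !row5E /= ?row5E /=; ring.
Qed.

End ContactAlgebra.

Section BracketRow.
Variable K : numFieldType.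

Lemma lie_structure_bracket s (Y Z : 'rV[K]_5) :
  \row_a (- (Y *m lie_structure (lie_coef s) a *m Z^T) 0 0) = lie_bracket_row s Y Z.
Proof.
have E a : (Y *m lie_structure (lie_coef s) a *m Z^T) 0 0 = lie_coef s a *
    (Y 0 (lie_index1 a) * Z 0 (lie_index2 a) - Y 0 (lie_index2 a) * Z 0 (lie_index1 a)).
  rewrite /lie_structure -scalemxAr -scalemxAl mulmxBr mulmxBl mxE; congr (_ * _).
  by rewrite mxE [X in _ + X]mxE !mul_delta_mx_entry [Z^T _ _]mxE [Z^T (lie_index1 _) _]mxE.
have i1 a : lie_index1 a = nth 0 [:: 0; 1; 0; 3; 3] a.
  by apply: val_inj; rewrite /= lie_index1E; move: a; apply: ord5P.
have i2 a : lie_index2 a = nth 0 [:: 2; 2; 1; 4; 4] a.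
  by apply: val_inj; rewrite /= lie_index2E; move: a; apply: ord5P.
apply: rowP5; rewrite mxE E i1 i2 /lie_coef row5E /=; ring.
Qed.

End BracketRow.

(** * Exterior derivative and Lie brackets *)

Section Brackets.
Variable R : realType.
Local Notation C := (CC R).
Local Notation C5 := (C5 R).
Implicit Types (f V W eta : C5 -> C5) (u v X : C5).

Lemma differentiable_row f u :
  (forall k, differentiable (fun v => f v 0 k) u) -> differentiable f u.
Proof.
move=> df.
rewrite (_ : f = \sum_(k < 5) (fun v => f v 0 k *: ebasis R k)); last first.
  by apply: funext => v; rewrite fct_sumE [LHS]row_sum_delta.
by apply: differentiable_sum => k; exact: differentiableZl.
Qed.

Lemma differentiable_entry f u k :
  differentiable f u -> differentiable (fun v => f v 0 k) u.
Proof.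
move=> df; have dc := has_diff_differentiable (has_diff_coord k (f u)).
exact: (differentiable_comp df dc).
Qed.

Lemma derive_entry f u X k :
  differentiable f u -> ('D_X f u) 0 k = 'D_X (fun v => f v 0 k) u.
Proof.
move=> df; have dcc := has_diff_coord k (f u).
have dc := has_diff_differentiable dcc.
rewrite (deriveE _ df) (deriveE _ (differentiable_entry k df)).
rewrite -[RHS]/('d ((fun w : C5 => w 0 k) \o f) u X) (diff_comp df dc) /=.
by case: dcc => _ ->; rewrite pairing_ebasisl.
Qed.

Lemma has_diff_sum n (F : 'I_n -> C5 -> C) (a : 'I_n -> C5) u :
  (forall k, has_diff (F k) u (a k)) ->
  has_diff (fun v => \sum_k F k v) u (\sum_k a k).
Proof.
elim: n F a => [|n IH] F a Fa.
  rewrite big_ord0 (_ : (fun v => _) = fun=> 0); first exact: has_diff_cst.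
  by apply: funext => v; rewrite big_ord0.
rewrite big_ord_recl (_ : (fun v => _) = fun v => F ord0 v + \sum_k F (lift ord0 k) v).
  by apply: has_diffD => //; exact: IH.
by apply: funext => v; rewrite big_ord_recl.
Qed.

Lemma pairing_suml n (a : 'I_n -> C5) v : pairing (\sum_k a k) v = \sum_k pairing (a k) v.
Proof.
rewrite exchange_big; apply: eq_bigr => k _.
by rewrite summxE mulr_suml.
Qed.

Lemma derive_pairing eta W u X : differentiable eta u -> differentiable W u ->
  'D_X (fun v => pairing (eta v) (W v)) u =
  pairing ('D_X eta u) (W u) + pairing (eta u) ('D_X W u).
Proof.
move=> de dW.
have dek k := differentiable_has_diff (differentiable_entry k de).
have dWk k := differentiable_has_diff (differentiable_entry k dW).
have e k : ('D_X eta u) 0 k = pairing (fdiff (fun v => eta v 0 k) u) X.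
  exact (etrans (derive_entry X k de) (has_diff_derive X (dek k))).
have w k : ('D_X W u) 0 k = pairing (fdiff (fun v => W v 0 k) u) X.
  exact (etrans (derive_entry X k dW) (has_diff_derive X (dWk k))).
refine (etrans (has_diff_derive X (has_diff_sum (fun k => has_diffM (dek k) (dWk k)))) _).
rewrite pairing_suml [RHS]addrC -big_split; apply: eq_bigr => k _ /=.
refine (etrans (pairingDl _ _ _) (etrans (congr2 +%R (pairingZl _ _ _) (pairingZl _ _ _)) _)).
refine (congr2 +%R (congr1 _ (esym (w k))) (etrans (congr1 _ (esym (e k))) (mulrC _ _))).
Qed.

Lemma derive_pd f u X k : differentiable f u ->
  ('D_X f u) 0 k = \sum_j X 0 j * pd j (fun v => f v 0 k) u.
Proof.
move=> df; refine (etrans (derive_entry X k df) _).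
refine (etrans (has_diff_derive X (differentiable_has_diff (differentiable_entry k df))) _).
apply: eq_bigr => j _; rewrite mulrC.
exact (congr1 (fun x => X 0 j * x) (mxE _ _ _ _)).
Qed.

Let cartan_algebra (a b c d : C) : a + b - (c + d) - (b - d) = a - c.
Proof. by ring. Qed.

Let cartan_term (x y a b : C) : x * (a - b) * y = x * a * y - y * b * x.
Proof. by ring. Qed.

(** Cartan's formula d eta (V, W) = V (eta W) - W (eta V) - eta [V, W] for
    vector fields that are differentiable at the point. *)
Lemma extd_lie_bracket eta V W u :
  differentiable eta u -> differentiable V u -> differentiable W u ->
  (V u *m extd eta u *m (W u)^T) 0 0 =
  'D_(V u) (fun v => pairing (eta v) (W v)) u
  - 'D_(W u) (fun v => pairing (eta v) (V v)) u
  - pairing (eta u) (lie_bracket V W u).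
Proof.
move=> de dV dW; rewrite !derive_pairing //.
have E X Y : pairing ('D_X eta u) Y =
    \sum_j \sum_k X 0 j * pd j (fun v => eta v 0 k) u * Y 0 k.
  rewrite exchange_big; apply: eq_bigr => k _.
  refine (etrans (congr1 (fun x => x * Y 0 k) (derive_pd X k de)) _).
  exact: mulr_suml.
have L : pairing (eta u) (lie_bracket V W u) =
    pairing (eta u) ('D_(V u) W u) - pairing (eta u) ('D_(W u) V u).
  refine (etrans (pairingDr _ _ _) (congr1 (fun x => _ + x) _)).
  refine (etrans (congr1 _ (esym (scaleN1r _))) (etrans (pairingZr _ _ _) (mulN1r _))).
refine (etrans _ (congr1 (fun x => _ - x) (esym L))).
refine (etrans _ (esym (cartan_algebra _ _ _ _))).
refine (etrans _ (congr2 (fun x y => x - y) (esym (E _ _)) (esym (E _ _)))).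
rewrite [X in _ = _ - X]exchange_big -sumrB mxE.
under [LHS]eq_bigr => k _ do rewrite mxE mulr_suml.
rewrite exchange_big; apply: eq_bigr => j _; rewrite -sumrB; apply: eq_bigr => k _.
rewrite [X in _ * X]mxE.
refine (etrans (congr1 (fun x => V u 0 j * x * W u 0 k) (mxE _ _ _ _)) _).
exact: cartan_term.
Qed.

End Brackets.

(** * Invariant forms and vector fields *)

Lemma sum_delta_scale (K : pzRingType) n (V : lmodType K) (A : 'I_n -> V) a :
  \sum_b (delta_mx 0 a : 'rV_n) 0 b *: A b = A a.
Proof.
rewrite (bigD1 a) //= big1 ?addr0 => [|b /negbTE ba]; first by rewrite mxE !eqxx scale1r.
by rewrite mxE ba andbF scale0r.
Qed.

(** A form with matrix S in the coframe, evaluated on the vectors that have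
    coordinates xi and zeta in the dual frame. *)
Lemma change_frame (K : comPzRingType) n (E N S : 'M[K]_n) (xi zeta : 'rV[K]_n) :
  E *m N = 1%:M ->
  xi *m N^T *m (E^T *m S *m E) *m (N *m zeta^T) = xi *m S *m zeta^T.
Proof.
move=> EN; rewrite !mulmxA -[xi *m N^T *m _]mulmxA -trmx_mul EN trmx1 mulmx1.
by rewrite -[_ *m E *m N]mulmxA EN mulmx1.
Qed.

Section Invariant.
Variables (R : realType) (alpha : CC R).
Hypothesis alpha_neq0 : alpha != 0.
Local Notation C := (CC R).
Local Notation C5 := (C5 R).
Implicit Types (u v X Y : C5) (kappa xi zeta : 'rV[C]_5).
Local Notation E := (coframe alpha).
Local Notation N := (frame alpha).
Local Notation S := (invariant_structure alpha).

Lemma coframe_frame u : E u *m N u = 1%:M.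
Proof. exact: mulmx1C (frame_coframe alpha_neq0 u). Qed.

(** The left-invariant forms and vector fields for the local group structure
    that has the coframe as its Maurer-Cartan form. *)
Definition invariant_form kappa u : C5 := kappa *m E u.
Definition invariant_field xi u : C5 := xi *m (N u)^T.

Lemma elementary_row_differentiable (f : C5 -> C5) u :
  elementary_mx f -> differentiable f u.
Proof.
by move=> ef; apply: differentiable_row => k; exact: elementary_differentiable.
Qed.

Lemma elementary_invariant_form kappa : elementary_mx (invariant_form kappa).
Proof.
apply: elementary_mxM; first exact: elementary_mx_cst.
exact: elementary_coframe.
Qed.

Lemma elementary_invariant_field xi : elementary_mx (invariant_field xi).
Proof.
apply: elementary_mxM; first exact: elementary_mx_cst.
exact/elementary_mx_tr/elementary_frame.
Qed.

Lemma pairingE (a v : C5) : pairing a v = (a *m v^T) 0 0.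
Proof. by rewrite mxE; apply: eq_bigr => k _; rewrite mxE. Qed.

Lemma extd_invariant_form kappa u :
  extd (invariant_form kappa) u = (E u)^T *m (\sum_a kappa 0 a *: S a) *m E u.
Proof.
have pE j k : pd j (fun v => invariant_form kappa v 0 k) u =
    \sum_a kappa 0 a * pd j (fun v => E v a k) u.
  have -> : (fun v => invariant_form kappa v 0 k) = fun v => \sum_a kappa 0 a * E v a k.
    by apply: funext => v; rewrite mxE.
  have el a : elementary (fun v => kappa 0 a * E v a k).
    by apply: elementaryM; [exact: elementary_cst|exact: elementary_coframe].
  refine (etrans (pd_sum j u el) _); apply: eq_bigr => a _.
  refine (etrans (pdM j u (elementary_cst _) (elementary_coframe _ _ _)) _).
  refine (etrans (congr1 (fun x => _ + _ * x) (pd_cst j (kappa 0 a) u)) _).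
  by rewrite mulr0 addr0.
have rE a l : (fun v => row a (E v) 0 l) = fun v => E v a l.
  by apply: funext => v; exact: mxE.
have sE a j k : pd j (fun v => E v a k) u - pd k (fun v => E v a j) u =
    ((E u)^T *m S a *m E u) j k.
  rewrite -coframe_structure //; refine (esym (etrans (mxE _ _ _ _) _)).
  exact (congr2 (fun f g => pd j f u - pd k g u) (rE a k) (rE a j)).
apply/matrixP => j k; refine (etrans (mxE _ _ _ _) _).
refine (etrans (congr2 (fun x y => x - y) (pE j k) (pE k j)) _).
rewrite -sumrB mulmx_sumr mulmx_suml summxE; apply: eq_bigr => a _.
rewrite -scalemxAr -scalemxAl [RHS]mxE -sE.
exact: esym (mulrBr _ _ _).
Qed.

Definition bracket xi zeta : 'rV[C]_5 := \row_a (- (xi *m S a *m zeta^T) 0 0).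

Lemma pairing_invariant kappa xi u :
  pairing (invariant_form kappa u) (invariant_field xi u) = pairing kappa xi.
Proof.
rewrite !pairingE /invariant_form /invariant_field trmx_mul trmxK.
by rewrite !mulmxA -[kappa *m _ *m _]mulmxA coframe_frame mulmx1.
Qed.

Lemma coframe_coordinates u X : X *m (E u)^T *m (N u)^T = X.
Proof. by rewrite -mulmxA -trmx_mul frame_coframe // trmx1 mulmx1. Qed.

Lemma coordinateE u X a : (X *m (E u)^T) 0 a = pairing (row a (E u)) X.
Proof. by rewrite pairingE mxE [RHS]mxE; apply: eq_bigr => k _; rewrite !mxE mulrC. Qed.

(** Pairings of invariant forms with invariant fields are constant, so in
    Cartan's formula only the exterior derivative of the form survives, and it
    is given by the structure constants. *)
Lemma lie_bracket_invariant xi zeta u :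
  lie_bracket (invariant_field xi) (invariant_field zeta) u =
  invariant_field (bracket xi zeta) u.
Proof.
set X := lie_bracket _ _ _; rewrite -[LHS](coframe_coordinates u); congr (_ *m _).
apply/rowP => a; rewrite coordinateE mxE.
have rE v : row a (E v) = invariant_form (delta_mx 0 a) v by rewrite rowE.
have d1 k := elementary_row_differentiable u (elementary_invariant_form k).
have d2 k := elementary_row_differentiable u (elementary_invariant_field k).
have := extd_lie_bracket (d1 (delta_mx 0 a)) (d2 xi) (d2 zeta).
have cst0 z : (fun v => pairing (invariant_form (delta_mx 0 a) v) (invariant_field z v))
    = fun=> pairing (delta_mx 0 a) z.
  by apply: funext => v; exact: pairing_invariant.
have D0 z Z : 'D_Z (fun v => pairing (invariant_form (delta_mx 0 a) v) (invariant_field z v)) u = 0.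
  refine (etrans (congr1 (fun f => 'D_Z f u) (cst0 z)) _).
  by rewrite (has_diff_derive Z (has_diff_cst _ u)) /pairing big1 // => k _; rewrite mxE mul0r.
move=> H; move: (etrans H (congr1 (fun x => x - _) (congr2 (fun x y => x - y) (D0 _ _) (D0 _ _)))).
rewrite subrr add0r -rE -/X => /eqP; rewrite eq_sym eqr_oppLR => /eqP ->; congr (- _).
rewrite extd_invariant_form sum_delta_scale /invariant_field trmx_mul trmxK.
by rewrite change_frame // coframe_frame.
Qed.

Lemma bracketE xi zeta : bracket xi zeta = lie_bracket_row (- 2 / alpha ^+ 2) xi zeta.
Proof. exact: lie_structure_bracket. Qed.

End Invariant.

(** * The growth vector *)

Section SpanOfSections.
Variable R : realType.
Local Notation C := (CC R).
Local Notation C5 := (C5 R).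

Lemma combination_submx n (B : 'I_n -> C5) (X : C5) (c : 'I_n -> C) :
  X = \sum_k c k *: B k -> (X <= \matrix_(k < n) B k)%MS.
Proof.
move=> ->; apply: summx_sub => k _; apply: scalemx_sub.
by rewrite -[B k](rowK B) row_sub.
Qed.

Lemma vspan_combination (S : set C5) n (B : 'I_n -> C5) (X : C5) (c : 'I_n -> C) :
  (forall k, S (B k)) -> X = \sum_k c k *: B k -> vspan S X.
Proof. by move=> SB XE; exists n, B; split => //; exact: combination_submx XE. Qed.

Lemma vspan_sub (S T : set C5) : S `<=` T ->
  (forall n (B : 'I_n -> C5) (c : 'I_n -> C),
    (forall k, T (B k)) -> T (\sum_k c k *: B k)) ->
  vspan S `<=` T.
Proof.
move=> ST Tlin X [n [B [SB /submxP [d ->]]]].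
have -> : d *m (\matrix_k B k) = \sum_k d 0 k *: B k.
  by rewrite mulmx_sum_row; apply: eq_bigr => k _; rewrite rowK.
by apply: Tlin => k; exact: ST.
Qed.

End SpanOfSections.

Section GrowthVector.
Variables (R : realType) (alpha : CC R).
Hypothesis alpha_neq0 : alpha != 0.
Local Notation C := (CC R).
Local Notation C5 := (C5 R).
Implicit Types (u v X Y : C5) (xi zeta : 'rV[C]_5).
Local Notation E := (coframe alpha).
Local Notation N := (frame alpha).

Definition contact_distribution n (w : 'I_n -> 'rV[C]_5) u : set C5 :=
  [set X | forall k, pairing (invariant_form alpha (w k) u) X = 0].

Definition coords X u : 'rV[C]_5 := X *m (E u)^T.

Lemma pairing_form xi X u : pairing (invariant_form alpha xi u) X = pairing xi (coords X u).
Proof. by rewrite !pairingE /coords /invariant_form trmx_mul trmxK mulmxA. Qed.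

Lemma contact_distributionE n (w : 'I_n -> 'rV[C]_5) u X :
  contact_distribution w u X <-> forall k, pairing (w k) (coords X u) = 0.
Proof. by split=> H k; have := H k; rewrite /= pairing_form. Qed.

Lemma contact_rank2P u X :
  contact_distribution (@contact_form C) u X <-> rank2_coords (coords X u).
Proof. by apply: iff_trans (contact_distributionE _ _ _) (rank2_coordsP _). Qed.

Lemma contact_rank3P u X :
  contact_distribution (@derived_form C) u X <-> rank3_coords (coords X u).
Proof. by apply: iff_trans (contact_distributionE _ _ _) (rank3_coordsP _). Qed.

Lemma coords_field xi u : coords (invariant_field alpha xi u) u = xi.
Proof.
by rewrite /coords /invariant_field -mulmxA -trmx_mul coframe_frame // trmx1 mulmx1.
Qed.

Lemma field_coords X u : invariant_field alpha (coords X u) u = X.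
Proof. exact: coframe_coordinates. Qed.

Lemma invariant_field_sum n (c : 'I_n -> C) (xi : 'I_n -> 'rV[C]_5) u :
  invariant_field alpha (\sum_k c k *: xi k) u = \sum_k c k *: invariant_field alpha (xi k) u.
Proof.
rewrite /invariant_field mulmx_suml; apply: eq_bigr => k _.
by rewrite scalemxAl.
Qed.

(** Invariant fields give global bases.  The matrix [c] is a right inverse of
    the matrix of coefficients, so it certifies independence and computes the
    coordinates in the basis. *)
Lemma is_distribution_invariant (U : set C5) r (D : C5 -> set C5)
    (xi : 'I_r -> 'rV[C]_5) (c : 'M[C]_(5, r)) :
  open U -> (\matrix_k xi k) *m c = 1%:M ->
  (forall u X, D u X <-> coords X u = \sum_k (coords X u *m c) 0 k *: xi k) ->
  is_distribution U r D.
Proof.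
move=> oU xc DE u Uu; exists U, (fun k => invariant_field alpha (xi k)).
have mE v : \matrix_k invariant_field alpha (xi k) v = (\matrix_k xi k) *m (N v)^T.
  by apply/row_matrixP => k; rewrite rowK row_mul rowK.
split=> //; first by split.
  by move=> k v _; apply: elementary_row_differentiable; exact: elementary_invariant_field.
move=> v _; rewrite mE; split.
  apply/row_freeP; exists ((E v)^T *m c).
  by rewrite mulmxA -[X in X *m c]mulmxA -trmx_mul coframe_frame // trmx1 mulmx1.
rewrite -mE; apply/seteqP; split => X.
  move=> /DE XE; apply: (@combination_submx _ _ _ _ (fun k => (coords X v *m c) 0 k)).
  by rewrite -invariant_field_sum -XE field_coords.
rewrite /= mE => /submxP [d Xd]; apply/DE.
have Y : coords X v = d *m (\matrix_k xi k).
  by rewrite -[RHS](coords_field _ v) /invariant_field -mulmxA -Xd.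
by rewrite Y -mulmxA xc mulmx1 mulmx_sum_row; apply: eq_bigr => k _; rewrite rowK.
Qed.

Lemma open_domain : open [set u : C5 | yc u != alpha].
Proof.
rewrite (_ : [set u : C5 | _] = (fun u : C5 => u 0 1) @^-1` [set x | x != alpha]) //.
apply: open_comp; first by move=> u _; exact: coord_continuous.
exact: open_neqC.
Qed.

Lemma contact_is_distribution : is_distribution [set u : C5 | yc u != alpha] 2
  (contact_distribution (@contact_form C)).
Proof.
apply: (is_distribution_invariant open_domain (sections_selector C (leqnSn 2))) => u X.
exact: iff_trans (contact_rank2P u X) (rank2_spanP _).
Qed.

Lemma derived_is_distribution : is_distribution [set u : C5 | yc u != alpha] 3
  (contact_distribution (@derived_form C)).
Proof.
apply: (is_distribution_invariant open_domain (sections_selector C (leqnn 3))) => u X.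
exact: iff_trans (contact_rank3P u X) (rank3_spanP _).
Qed.

Lemma contact_section u (j : 'I_2) :
  local_section (contact_distribution (@contact_form C)) u (invariant_field alpha (sections C j)).
Proof.
apply: filterE => v; split.
  by apply: elementary_row_differentiable; exact: elementary_invariant_field.
by apply/contact_rank2P; rewrite coords_field; exact: sections_rank2.
Qed.

Lemma derived_section u (j : 'I_3) :
  local_section (contact_distribution (@derived_form C)) u (invariant_field alpha (sections C j)).
Proof.
apply: filterE => v; split.
  by apply: elementary_row_differentiable; exact: elementary_invariant_field.
by apply/contact_rank3P; rewrite coords_field; exact: sections_rank3.
Qed.

End GrowthVector.

Section Brackets235.
Variables (R : realType) (alpha : CC R).
Hypothesis alpha_neq0 : alpha != 0.
Hypothesis alpha2_neq : alpha ^+ 2 != -1.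
Local Notation C := (CC R).
Local Notation C5 := (C5 R).
Implicit Types (u v X Y : C5) (xi zeta : 'rV[C]_5).
Local Notation E := (coframe alpha).
Local Notation D0 := (contact_distribution alpha (@contact_form C)).
Local Notation D1 := (contact_distribution alpha (@derived_form C)).

Lemma extd_form_bracket kappa u X Y :
  (X *m extd (invariant_form alpha kappa) u *m Y^T) 0 0 =
  - pairing kappa (bracket alpha (coords alpha X u) (coords alpha Y u)).
Proof.
rewrite extd_invariant_form // pairingE.
have -> : X *m ((E u)^T *m (\sum_a kappa 0 a *: invariant_structure alpha a) *m E u) *m Y^T =
   \sum_a kappa 0 a *: (coords alpha X u *m invariant_structure alpha a *m (coords alpha Y u)^T).
  rewrite /coords trmx_mul trmxK mulmx_sumr mulmx_suml mulmx_sumr mulmx_suml.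
  by apply: eq_bigr => a _; rewrite -!(scalemxAr, scalemxAl) !mulmxA.
rewrite summxE [in RHS]mxE -sumrN; apply: eq_bigr => a _.
rewrite [LHS]mxE [X in _ = - (_ * X)]mxE [X in _ = - (_ * X)]mxE.
by rewrite mulrN opprK.
Qed.

(** A form of the annihilator pairs to zero with a section near the point, so
    the derivative terms of Cartan's formula vanish. *)
Lemma annihilated_derivative n (w : 'I_n -> 'rV[C]_5) k u (V : C5 -> C5) Z :
  local_section (contact_distribution alpha w) u V ->
  'D_Z (fun v => pairing (invariant_form alpha (w k) v) (V v)) u = 0.
Proof.
move=> sV.
have nV : \near u, pairing (invariant_form alpha (w k) u) (V u) = cst 0 u.
  by apply: filterS sV => v [_]; apply.
refine (etrans (near_eq_derive Z nV) _).
refine (etrans (has_diff_derive Z (has_diff_cst (0 : C) u)) _).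
by rewrite /pairing big1 // => j _; rewrite mxE mul0r.
Qed.

Lemma local_section_at n (w : 'I_n -> 'rV[C]_5) u V :
  local_section (contact_distribution alpha w) u V ->
  differentiable V u /\ contact_distribution alpha w u (V u).
Proof. by move=> sV; exact: nbhs_singleton sV. Qed.

Lemma pairing_sumr a n (c : 'I_n -> C) (B : 'I_n -> C5) :
  pairing a (\sum_k c k *: B k) = \sum_k c k * pairing a (B k).
Proof.
rewrite pairingE linear_sum mulmx_sumr summxE; apply: eq_bigr => k _.
by rewrite linearZ -scalemxAr mxE pairingE.
Qed.

Lemma contact_linear m (w : 'I_m -> 'rV[C]_5) u n (B : 'I_n -> C5) (c : 'I_n -> C) :
  (forall k, contact_distribution alpha w u (B k)) ->
  contact_distribution alpha w u (\sum_k c k *: B k).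
Proof.
move=> wB j; rewrite pairing_sumr big1 // => k _.
by rewrite (wB k j) mulr0.
Qed.

(** By Cartan's formula the pairing of theta_0 or theta_1 with the bracket
    depends only on the values of the two sections at u, so the computation in
    the Lie algebra covers sections that are not invariant. *)
Lemma contact_brackets_derived u V W :
  local_section D0 u V -> local_section D0 u W -> D1 u (lie_bracket V W u).
Proof.
move=> sV sW.
have [dV /contact_rank2P v] := local_section_at sV.
have [dW /contact_rank2P w] := local_section_at sW.
have/rank3_coordsP B := lie_bracket_rank3 (- 2 / alpha ^+ 2) v w.
move=> k.
have de := elementary_row_differentiable u (elementary_invariant_form alpha (derived_form C k)).
have H := etrans (extd_lie_bracket de dV dW)
  (congr1 (fun x => x - _) (congr2 (fun x y => x - y)
  (annihilated_derivative (widen_ord (leqnSn 2) k) (V u) sW)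
  (annihilated_derivative (widen_ord (leqnSn 2) k) (W u) sV))).
rewrite subrr add0r extd_form_bracket bracketE in H.
exact: etrans (esym (oppr_inj H)) (B k).
Qed.

(** One inclusion is the previous lemma, the other one uses the bracket of the
    two invariant generators. *)
Lemma dist_bracket_contact : dist_bracket D0 D0 = D1.
Proof.
apply: funext => u; apply/seteqP; split.
  apply: vspan_sub => [X [/contact_rank2P [H0 H1 _]|[V [W [sV sW ->]]]]|].
  - exact/contact_rank3P.
  - exact: contact_brackets_derived.
  - by move=> n B c; exact: contact_linear.
move=> X /contact_rank3P.
pose s : C := - 2 / alpha ^+ 2; have s2 : s - 2 != 0.
  have -> : s - 2 = - 2 * (alpha ^+ 2 + 1) / alpha ^+ 2 by rewrite /s; field.
  rewrite !mulf_neq0 ?oppr_eq0 ?pnatr_eq0 ?invr_neq0 ?expf_neq0 //.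
  by rewrite addr_eq0.
move=> /(rank3_bracket_span s2) [c XE].
pose f (k : 'I_3) : 'rV[C]_5 :=
  nth 0 [:: section1 C; section2 C; lie_bracket_row s (section1 C) (section2 C)] k.
apply: (@vspan_combination _ _ _ (fun k => invariant_field alpha (f k) u) _ c).
  have D0s (j : 'I_2) : D0 u (invariant_field alpha (sections C j) u).
    by have [] := local_section_at (contact_section alpha_neq0 u j).
  case=> [[|[|[|//]]]] i.
  - by left; exact: (D0s 0).
  - by left; exact: (D0s 1).
  right; exists (invariant_field alpha (section1 C)), (invariant_field alpha (section2 C)).
  split.
  - exact: (contact_section alpha_neq0 u 0).
  - exact: (contact_section alpha_neq0 u 1).
  - by rewrite lie_bracket_invariant // bracketE.
by rewrite -invariant_field_sum -XE field_coords.
Qed.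

Lemma dist_bracket_full u : dist_bracket D0 D1 u = setT.
Proof.
apply/seteqP; split=> // X _; pose s : C := - 2 / alpha ^+ 2.
have [c XE] := bracket_span s (coords alpha X u).
pose f (k : 'I_5) : 'rV[C]_5 := nth 0 [:: section1 C; section2 C; section3 C;
  lie_bracket_row s (section1 C) (section3 C); lie_bracket_row s (section2 C) (section3 C)] k.
apply: (@vspan_combination _ _ _ (fun k => invariant_field alpha (f k) u) _ c).
  have D1s (j : 'I_3) : D1 u (invariant_field alpha (sections C j) u).
    by have [] := local_section_at (derived_section alpha_neq0 u j).
  case=> [[|[|[|[|[|//]]]]]] i.
  - by left; exact: (D1s 0).
  - by left; exact: (D1s 1).
  - by left; exact: (D1s 2).
  - right; exists (invariant_field alpha (section1 C)), (invariant_field alpha (section3 C)).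
    split.
    + exact: (contact_section alpha_neq0 u 0).
    + exact: (derived_section alpha_neq0 u 2).
    + by rewrite lie_bracket_invariant // bracketE.
  - right; exists (invariant_field alpha (section2 C)), (invariant_field alpha (section3 C)).
    split.
    + exact: (contact_section alpha_neq0 u 1).
    + exact: (derived_section alpha_neq0 u 2).
    + by rewrite lie_bracket_invariant // bracketE.
by rewrite -invariant_field_sum -XE field_coords.
Qed.

Lemma contact_is_235 : is_235_distribution [set u : C5 | yc u != alpha] D0.
Proof.
split.
- exact: contact_is_distribution.
- by rewrite dist_bracket_contact; exact: derived_is_distribution.
- by move=> u _; rewrite dist_bracket_contact dist_bracket_full.
Qed.

End Brackets235.

(** * The span of omega and Nurowski's metric *)

Section HalfSums.
Variables (K : fieldType) (a i : K) (f g : 'rV[K]_5).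
Hypotheses (a0 : a != 0) (two0 : (2 : K) != 0) (i2 : i ^+ 2 = -1).

Let ia : - i * (i / a) = a^-1.
Proof. by rewrite mulrA mulNr -expr2 i2 opprK mul1r. Qed.

Lemma half_sum :
  (a / 2) *: (- i *: ((i / a) *: (f + g)) + a^-1 *: (f - g)) = f.
Proof. by rewrite scalerA ia; apply/rowP => k; rewrite !mxE; field; rewrite ?two0 ?a0. Qed.

Lemma half_diff :
  (a / 2) *: (- i *: ((i / a) *: (f + g)) - a^-1 *: (f - g)) = g.
Proof. by rewrite scalerA ia; apply/rowP => k; rewrite !mxE; field; rewrite ?two0 ?a0. Qed.

End HalfSums.

Section RollingForms.
Variables (R : realType) (alpha : CC R).
Hypothesis alpha_neq0 : alpha != 0.
Local Notation C := (CC R).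
Local Notation C5 := (C5 R).
Implicit Types (u X : C5) (kappa : 'rV[C]_5).
Local Notation inv_form := (invariant_form alpha).

Lemma pairingNl (a X : C5) : pairing (- a) X = - pairing a X.
Proof. by rewrite -scaleN1r pairingZl mulN1r. Qed.

Lemma omegaE u :
  [/\ omega1 alpha u =
         ('i / alpha) *: (inv_form (contact_form C 0) u + inv_form (contact_form C 1) u),
      omega2 u = alpha^-1 *: (inv_form (contact_form C 0) u - inv_form (contact_form C 1) u) &
      omega3 alpha u = 'i *: inv_form (contact_form C 2) u].
Proof.
have two0 : (2 : C) != 0 by rewrite pnatr_eq0.
exact: (rolling_rows (yc u) (pc u) (cexp (alpha * xc u)) 'i alpha_neq0 two0).
Qed.

Lemma contact_omegaE u :
  [/\ inv_form (contact_form C 0) u = (alpha / 2) *: ((- 'i) *: omega1 alpha u + omega2 u),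
      inv_form (contact_form C 1) u = (alpha / 2) *: ((- 'i) *: omega1 alpha u - omega2 u) &
      inv_form (contact_form C 2) u = (- 'i) *: omega3 alpha u].
Proof.
have two0 : (2 : C) != 0 by rewrite pnatr_eq0.
have [E1 E2 E3] := omegaE u; split.
- by rewrite E1 E2 (half_sum _ _ alpha_neq0 two0 (sqrCi _)).
- by rewrite E1 E2 (half_diff _ _ alpha_neq0 two0 (sqrCi _)).
- by rewrite E3 scalerA mulNr -expr2 sqrCi opprK scale1r.
Qed.

Lemma annihilator_omega u :
  annihilator (omega alpha) u = contact_distribution alpha (@contact_form C) u.
Proof.
have [E1 E2 E3] := omegaE u.
have [F1 F2 F3] := contact_omegaE u.
apply/seteqP; split => X H.
  have H0 : pairing (omega1 alpha u) X = 0 := H 0.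
  have H1 : pairing (omega2 u) X = 0 := H 1.
  have H2 : pairing (omega3 alpha u) X = 0 := H 2.
  case=> [[|[|[|//]]]] ik.
  - rewrite (_ : Ordinal ik = 0); last exact: val_inj.
    by rewrite F1 pairingZl pairingDl pairingZl H0 H1 mulr0 addr0 mulr0.
  - rewrite (_ : Ordinal ik = 1); last exact: val_inj.
    by rewrite F2 pairingZl pairingDl pairingNl pairingZl H0 H1 mulr0 subr0 mulr0.
  - rewrite (_ : Ordinal ik = 2); last exact: val_inj.
    by rewrite F3 pairingZl H2 mulr0.
have H0 := H 0; have H1 := H 1; have H2 := H 2.
have G1 : pairing (omega1 alpha u) X = 0.
  by rewrite E1 pairingZl pairingDl H0 H1 addr0 mulr0.
have G2 : pairing (omega2 u) X = 0.
  by rewrite E2 pairingZl pairingDl pairingNl H0 H1 subr0 mulr0.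
have G3 : pairing (omega3 alpha u) X = 0 by rewrite E3 pairingZl H2 mulr0.
by case=> [[|[|[|//]]]] ik.
Qed.

End RollingForms.

Section Additive.
Variables (V W : zmodType) (f : V -> W).
Hypothesis fD : forall x y, f (x + y) = f x + f y.

Lemma additive_sum3 x1 x2 x3 y1 y2 y3 : f x1 = y1 -> f x2 = y2 -> f x3 = y3 ->
  f (x1 + x2 + x3) = y1 + y2 + y3.
Proof. by move=> <- <- <-; rewrite !fD. Qed.

Lemma additive_sum4 x1 x2 x3 x4 y1 y2 y3 y4 : f x1 = y1 -> f x2 = y2 -> f x3 = y3 -> f x4 = y4 ->
  f (x1 + x2 + x3 + x4) = y1 + y2 + y3 + y4.
Proof. by move=> <- <- <- <-; rewrite !fD. Qed.

End Additive.

Section MaximalSymmetry.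
Variables (R : realType) (alpha : CC R).
Hypothesis alpha_neq0 : alpha != 0.
Hypothesis alpha2_neq : alpha ^+ 2 != -1.
Local Notation C := (CC R).
Local Notation C5 := (C5 R).
Local Notation inv_form := (invariant_form alpha).
Local Notation E := (coframe alpha).
Implicit Types (u : C5) (a b : 'rV[C]_5) (M : 'M[C]_5).

Definition conj_coframe u M : 'M[C]_5 := (E u)^T *m M *m E u.

Lemma conj_coframeD u M M' : conj_coframe u (M + M') = conj_coframe u M + conj_coframe u M'.
Proof. by rewrite /conj_coframe mulmxDr mulmxDl. Qed.

Lemma conj_coframeB u M M' : conj_coframe u (M - M') = conj_coframe u M - conj_coframe u M'.
Proof. by rewrite /conj_coframe mulmxBr mulmxBl. Qed.

Lemma conj_coframeZ u c M : conj_coframe u (c *: M) = c *: conj_coframe u M.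
Proof. by rewrite /conj_coframe -scalemxAr -scalemxAl. Qed.

Lemma tensor_invariant u a b : (inv_form a u)^T *m inv_form b u = conj_coframe u (a^T *m b).
Proof. by rewrite /conj_coframe /invariant_form trmx_mul !mulmxA. Qed.

Lemma wedge_invariant u a b :
  wedge (inv_form a u) (inv_form b u) = conj_coframe u (const_wedge a b).
Proof. by rewrite conj_coframeB -!tensor_invariant. Qed.

Lemma invariant_formD u a b : inv_form (a + b) u = inv_form a u + inv_form b u.
Proof. exact: mulmxDl. Qed.

Lemma invariant_formZ u c a : inv_form (c *: a) u = c *: inv_form a u.
Proof. by rewrite /invariant_form -scalemxAl. Qed.

Lemma conj_coframeN u M : conj_coframe u (- M) = - conj_coframe u M.
Proof. by rewrite /conj_coframe mulmxN mulNmx. Qed.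

Variables (G Gi P T O Ti : table) (w : seq table) (k m n d D : int) (s : seq int).
Hypothesis frame_data : frame_data_check G Gi P w k s.
Hypothesis cartan_data : cartan_check T O G Ti m n d D s.
Hypotheses (k0 : k != 0) (d0 : d != 0) (D0 : D != 0) (n0 : n != 0) (m0 : m != 0).
Hypothesis coefs : forall a : 'I_5,
  lie_coef (- 2 / alpha ^+ 2) a = (d%:~R)^-1 * (nth 0 s a)%:~R :> C.
Hypothesis contact_rows : forall j : 'I_3, exists2 c : C, c != 0 &
  table_row C T j = c *: contact_form C j.

Let th (j : 'I_5) := inv_form (table_row C T j).
Let Om (j : 'I_7) := inv_form ((D%:~R)^-1 *: table_row C O j).
Let c (a : 'I_5) : C := (d%:~R)^-1 * (nth 0 s a)%:~R.

Lemma invariant_structure_table : invariant_structure alpha = lie_structure c.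
Proof.
apply: funext => a; rewrite /invariant_structure /lie_structure.
by rewrite coefs.
Qed.

Lemma extd_table (j : 'I_5) u : extd (th j) u =
  conj_coframe u (\sum_a table_row C T j 0 a *: lie_structure c a).
Proof.
by rewrite -invariant_structure_table; exact: extd_invariant_form.
Qed.

Lemma table_coframe U : cartan_coframe U (contact_distribution alpha (@contact_form C)) th Om.
Proof.
split.
- by split=> j u _; apply: elementary_row_differentiable; exact: elementary_invariant_form.
- move=> u _.
  have -> : \matrix_j th j u = (\matrix_(j < 5) table_row C T j) *m E u.
    by apply/row_matrixP => j; rewrite row_mul !rowK.
  apply/row_freeP; exists (frame alpha u *m ((n%:~R)^-1 *: table_mx C Ti)).
  rewrite -mulmxA [E u *m _]mulmxA coframe_frame // mul1mx.
  exact: (table_cartan_free C cartan_data n0).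
- move=> u _; apply/seteqP; split=> X HX.
    have H (j : 'I_3) : pairing (inv_form (table_row C T j) u) X = 0.
      by have [c' _ ->] := contact_rows j; rewrite invariant_formZ pairingZl HX mulr0.
    case=> [[|[|[|//]]]] i.
    + exact: (H 0).
    + exact: (H 1).
    + exact: (H 2).
  move=> j; have [c' c'0 E'] := contact_rows j.
  have H : pairing (inv_form (table_row C T j) u) X = 0.
    by case: j {E'} => [[|[|[|//]]]] i; [exact: (HX 0)|exact: (HX 1)|exact: (HX 2)].
  apply: (mulfI c'0); rewrite mulr0 -pairingZl -invariant_formZ -E'.
  exact: H.
- move=> u _ t o.
  have [E0 E1 E2 E3 E4] := table_cartan C cartan_data d0 D0.
  pose r j := (D%:~R)^-1 *: table_row C O j.
  have o03 : inv_form (2 *: r 0%N + r 3%N) u = 2 *: o 0 + o 3.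
    exact (etrans (invariant_formD u (2 *: r 0%N) (r 3%N))
      (congr1 (fun x => x + o 3) (invariant_formZ u 2 (r 0%N)))).
  have o30 : inv_form (r 0%N + 2 *: r 3%N) u = o 0 + 2 *: o 3.
    exact (etrans (invariant_formD u (r 0%N) (2 *: r 3%N))
      (congr1 (fun x => o 0 + x) (invariant_formZ u 2 (r 3%N)))).
  have s03 : inv_form (r 0%N + r 3%N) u = o 0 + o 3.
    exact (invariant_formD u (r 0%N) (r 3%N)).
  have W a b x : inv_form b u = x -> conj_coframe u (const_wedge a b) = wedge (inv_form a u) x.
    by move=> <-; rewrite wedge_invariant.
  have X (j : 'I_5) M : \sum_a table_row C T j 0 a *: lie_structure c a = M ->
      extd (th j) u = conj_coframe u M by move=> <-; exact: extd_table.
  split.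
  + refine (etrans (X 0 _ E0) (additive_sum3 (@conj_coframeD u)
      (W _ _ _ o03) (W _ _ _ erefl) (W _ _ _ erefl))).
  + refine (etrans (X 1 _ E1) (additive_sum3 (@conj_coframeD u)
      (W _ _ _ erefl) (W _ _ _ o30) (W _ _ _ erefl))).
  + refine (etrans (X 2 _ E2) (additive_sum4 (@conj_coframeD u) (W _ _ _ erefl) (W _ _ _ erefl)
      (W _ _ _ s03) (W _ _ _ erefl))).
  + refine (etrans (X 3 _ E3) (additive_sum4 (@conj_coframeD u) (W _ _ _ erefl)
      (etrans (conj_coframeZ _ _ _) (congr1 _ (W _ _ _ erefl)))
      (W _ _ _ erefl) (W _ _ _ erefl))).
  + refine (etrans (X 4 _ E4) (additive_sum4 (@conj_coframeD u) (W _ _ _ erefl)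
      (etrans (conj_coframeN _ _) (congr1 _ (etrans (conj_coframeZ _ _ _)
         (congr1 _ (W _ _ _ erefl)))))
      (W _ _ _ erefl) (W _ _ _ erefl))).
Qed.

Lemma nurowski_metric_table :
  nurowski_metric th = frame_metric E ((m%:~R / 3) *: table_mx C G).
Proof.
apply: funext => u.
have H := congr1 (conj_coframe u) (table_cartan_metric C cartan_data).
refine (etrans _ H).
rewrite /nurowski_metric /th.
have t a b := tensor_invariant u a b.
refine (esym (etrans (conj_coframeD _ _ _) (congr2 +%R _ _))); last first.
  exact: etrans (conj_coframeZ _ _ _) (congr1 _ (esym (t _ _))).
refine (etrans (conj_coframeB _ _ _) (congr2 (fun x y => x - y) _ _)).
  exact: etrans (conj_coframeD _ _ _) (congr2 +%R (esym (t _ _)) (esym (t _ _))).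
exact: etrans (conj_coframeD _ _ _) (congr2 +%R (esym (t _ _)) (esym (t _ _))).
Qed.

(** The metric is [G] up to the factor m / 3.  Rescaling a metric by a constant
    changes neither its connection nor the tensor P. *)
Lemma table_weyl u i j p l : weyl (nurowski_metric th) u i j p l = 0.
Proof.
rewrite nurowski_metric_table; set z : C := m%:~R / 3.
have z0 : z != 0 by rewrite mulf_neq0 ?invr_eq0 ?intr_eq0 ?pnatr_eq0.
set g := table_mx C G.
pose wm (e : 'I_5) : 'M[C]_5 := (d%:~R)^-1 *: table_mx C (nth [::] w e).
apply: (@frame_weyl R E (frame alpha) (z *: g) (z^-1 *: ((k%:~R)^-1 *: table_mx C Gi))
  ((d%:~R ^+ 2)^-1 *: table_mx C P) wm (lie_structure c)).
- exact: elementary_coframe.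
- exact: elementary_frame.
- exact: frame_coframe.
- by move=> a v; rewrite -invariant_structure_table; exact: coframe_structure.
- rewrite -scalemxAl -scalemxAr scalerA mulVf // scale1r.
  exact: (table_metric_inv C frame_data k0).
- by rewrite linearZ /= (table_metric_sym C frame_data).
- by rewrite linearZ /= (table_schouten_sym C frame_data).
- move=> e.
  have zE x : (z *: g) *m x + x^T *m (z *: g) = z *: (g *m x + x^T *m g).
    by rewrite -scalemxAl -scalemxAr -scalerDr.
  by rewrite zE (table_connection_metric C d frame_data) scaler0.
- exact: (lie_structureE C d frame_data).
- move=> a b e f.
  have H := table_curvature C frame_data d0 a b e f.
  rewrite -scalemxAl [LHS]mxE; refine (etrans (congr1 _ H) _).
  rewrite /kulkarni_nomizu.
  have zE x y : (z *: g) x y = z * g x y by rewrite mxE.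
  by rewrite !zE -/g; move: (_ *: table_mx C P) => Q; ring.
Qed.

Lemma table_maximally_symmetric :
  maximally_symmetric [set u : C5 | yc u != alpha] (annihilator (omega alpha)).
Proof.
have -> : annihilator (omega alpha) = contact_distribution alpha (@contact_form C).
  by apply: funext => u; exact: annihilator_omega.
split; first exact: contact_is_235.
move=> u Uu; exists [set u : C5 | yc u != alpha], th, Om; split.
- by split=> //; exact: open_domain.
- exact: table_coframe.
- by move=> v _ i j p l; exact: table_weyl.
Qed.

End MaximalSymmetry.

Lemma contact_rows1 (K : numFieldType) (j : 'I_3) : exists2 c : K, c != 0 &
  table_row K coframe1 j = c *: contact_form K j.
Proof.
exists (nth 0 [:: 36; 36; 9] j); first by case: j => [[|[|[|//]]]] i /=; rewrite pnatr_eq0.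
by case: j => [[|[|[|//]]]] i; apply/rowP => -[[|[|[|[|[|//]]]]] ij];
  rewrite !mxE /entry /coframe1 /=; ring.
Qed.

Lemma contact_rows2 (K : numFieldType) (j : 'I_3) : exists2 c : K, c != 0 &
  table_row K coframe2 j = c *: contact_form K j.
Proof.
exists (nth 0 [:: -4; -4; -1] j).
  by case: j => [[|[|[|//]]]] i /=; rewrite oppr_eq0 ?pnatr_eq0 ?oner_eq0.
by case: j => [[|[|[|//]]]] i; apply/rowP => -[[|[|[|[|[|//]]]]] ij];
  rewrite !mxE /entry /coframe2 /=; ring.
Qed.

Lemma lie_coef1 (K : numFieldType) (a : 'I_5) : lie_coef (- 2 / - 9) a =
  (36%:~R)^-1 * (nth 0 [:: 36; -36; 8; -36; 36] a : int)%:~R :> K.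
Proof. by rewrite /lie_coef; case: a => [[|[|[|[|[|//]]]]]] i /=; field. Qed.

Lemma lie_coef2 (K : numFieldType) (a : 'I_5) : lie_coef (- 2 / - 9^-1) a =
  (12%:~R)^-1 * (nth 0 [:: 12; -12; 216; -12; 12] a : int)%:~R :> K.
Proof. by rewrite /lie_coef; case: a => [[|[|[|[|[|//]]]]]] i /=; field. Qed.

Lemma rolling_maximally_symmetric (R : realType) (alpha : CC R) :
  alpha != 0 -> alpha ^+ 2 != -1 ->
  alpha ^+ 2 = - 9^-1 \/ alpha ^+ 2 = - 9 ->
  maximally_symmetric [set u : 'rV[CC R]_5 | yc u != alpha] (annihilator (omega alpha)).
Proof.
move=> a0 a2 [aE|aE].
  apply: (table_maximally_symmetric a0 a2 check2 cartan_check2) => //.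
    by move=> a; rewrite aE; exact: lie_coef2.
  exact: contact_rows2.
apply: (table_maximally_symmetric a0 a2 check1 cartan_check1) => //.
  by move=> a; rewrite aE; exact: lie_coef1.
exact: contact_rows1.
Qed.

(** * The Monge normal form *)

Section MongeRows.
Variables (K : numFieldType) (al y p A Z : K).
Hypotheses (al0 : al != 0) (al2 : al ^+ 2 + 1 != 0) (ya : y - al != 0)
  (A0 : A != 0) (Z0 : Z != 0).

Local Notation dx := (delta_mx 0 0 : 'rV[K]_5).
Local Notation dy := (delta_mx 0 1 : 'rV[K]_5).
Local Notation dz := (delta_mx 0 2 : 'rV[K]_5).
Local Notation dp := (delta_mx 0 3 : 'rV[K]_5).
Local Notation dq := (delta_mx 0 4 : 'rV[K]_5).
Local Notation theta k := (contact_form K k *m coframe_mx al y p A).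

(* The barred coordinates and their differentials in terms of A = exp (alpha x)
   and Z = exp z. *)
Definition barx := 2 * (Z / A).
Definition barz := - ((al * y + 1) / al) * Z.
Definition barp := - Z^-1 * p.
Definition barq := - (4 * (Z ^+ 2 / A) * (y - al))^-1.

Definition d_barx := barx *: (dz - al *: dx).
Definition d_bary := (A^-1 + 2 * p * al / A) *: dx - (2 / A) *: dp + dq.
Definition d_barz := - Z *: dy + barz *: dz.
Definition d_barp := (p / Z) *: dz - Z^-1 *: dp.

Definition monge_slope := barq * barz ^+ 2
  - (al ^+ 2 + 1)^-1 * (barq * barz ^+ 2 - barz / barx + (4 * barq * barx ^+ 2)^-1).

Let c := Z * (1 + y ^+ 2) / (2 * (y - al)).

(** Eliminating d(bar x) leaves combinations of the contact forms; for the
    third form this is what determines the function in the Monge equation. *)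
Lemma monge_rows :
  [/\ d_bary - barp *: d_barx = - (2 / (al * A)) *: theta 1,
      d_barp - barq *: d_barx = (2 * Z * (y - al))^-1 *: (2 *: theta 1 + theta 2) &
      d_barz - monge_slope *: d_barx =
        - (Z / al) *: theta 0 + ((Z + 2 * al * c) / al) *: theta 1 + c *: theta 2].
Proof.
have two0 : (2 : K) != 0 by rewrite pnatr_eq0.
rewrite !contact_coframe //= /d_barx /d_bary /d_barz /d_barp.
rewrite /monge_slope /barx /barz /barp /barq /c.
split; apply/rowP => -[[|[|[|[|[|//]]]]] ij]; rewrite !mxE /=; field;
  rewrite ?al0 ?al2 ?ya ?A0 ?Z0 ?two0 //.
Qed.

(** Back substitution in the triangular system of [monge_rows]. *)
Lemma contact_rows_monge M1 M2 M3 : M1 = d_bary - barp *: d_barx ->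
  M2 = d_barp - barq *: d_barx -> M3 = d_barz - monge_slope *: d_barx ->
  [/\ theta 1 = - (al * A / 2) *: M1,
      theta 2 = (2 * Z * (y - al)) *: M2 + (al * A) *: M1 &
      theta 0 = - (al / Z) *: M3 - ((Z + 2 * al * c) / Z * (al * A / 2)) *: M1
                + (al / Z * c) *: ((2 * Z * (y - al)) *: M2 + (al * A) *: M1)].
Proof.
have two0 : (2 : K) != 0 by rewrite pnatr_eq0.
have [E1 E2 E3] := monge_rows; move=> -> -> ->.
rewrite E1 E2 E3; clear E1 E2 E3.
move: (theta 0) (theta 1) (theta 2) c => t0 t1 t2 c'.
split; apply/rowP => j; rewrite !mxE; field; rewrite ?al0 ?ya ?A0 ?Z0 ?two0 //.
Qed.

End MongeRows.

Lemma sum_two_coords (K : pzRingType) n (V : lmodType K) (f : 'I_n.+1 -> V) k (a b : K) :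
  \sum_j (a *: delta_mx 0 k - b *: delta_mx 0 0 : 'rV[K]_n.+1) 0 j *: f j
  = a *: f k - b *: f 0.
Proof.
rewrite -(sum_delta_scale f k) -(sum_delta_scale f 0) !scaler_sumr -sumrB.
apply: eq_bigr => j _.
by rewrite !scalerA -scalerBl !mxE.
Qed.

(* The left-hand sides are the differentials in the shape that the rules for
   sums, products and exponentials produce. *)
Section BarDifferentials.
Variables (K : numFieldType) (al x y zc p a z ai zi : K).
Hypotheses (al0 : al != 0) (aiE : ai = a^-1) (ziE : zi = z^-1).
Local Notation dx := (delta_mx 0 0 : 'rV[K]_5).
Local Notation dy := (delta_mx 0 1 : 'rV[K]_5).
Local Notation dz := (delta_mx 0 2 : 'rV[K]_5).
Local Notation dp := (delta_mx 0 3 : 'rV[K]_5).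
Local Notation dq := (delta_mx 0 4 : 'rV[K]_5).
Local Notation dax := (- al *: dx + x *: 0).

Lemma d_barxE : 2 *: (z *: (ai *: dax) + ai *: (z *: dz)) + (z * ai) *: 0 = d_barx al a z.
Proof.
rewrite aiE /d_barx /barx.
by apply/rowP => -[[|[|[|[|[|//]]]]] ij]; rewrite !mxE /=; ring.
Qed.

Lemma d_baryE : dq + (- al^-1 *: (ai *: dax) + ai *: 0)
  + ((- 2 * p) *: (ai *: dax) + ai *: (- 2 *: dp + p *: 0)) = d_bary al p a.
Proof.
rewrite aiE /d_bary.
apply/rowP => -[[|[|[|[|[|//]]]]] ij]; rewrite !mxE /=; try ring.
by move: (a^-1) => b; field.
Qed.

Lemma d_barzE : (- 1 * y + - al^-1) *: (z *: dz) + z *: (- 1 *: dy + y *: 0 + 0)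
  = d_barz al y z.
Proof.
rewrite /d_barz /barz.
by apply/rowP => -[[|[|[|[|[|//]]]]] ij]; rewrite !mxE /=; field.
Qed.

Lemma d_barpE : (- 1 * zi) *: dp + p *: (- 1 *: (zi *: (- 1 *: dz + zc *: 0)) + zi *: 0)
  = d_barp p z.
Proof.
rewrite ziE /d_barp.
by apply/rowP => -[[|[|[|[|[|//]]]]] ij]; rewrite !mxE /=; ring.
Qed.

End BarDifferentials.

Section MongeForms.
Variables (R : realType) (alpha : CC R).
Hypothesis alpha_neq0 : alpha != 0.
Local Notation C := (CC R).
Local Notation C5 := (C5 R).
Implicit Types (u v : C5).
Local Notation Phi := (bar_coordinates alpha).
Local Notation A u := (cexp (alpha * xc u)).
Local Notation Z u := (cexp (zc u)).

Lemma bar_coordinatesE v :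
  [/\ Phi v 0 0 = 2 * (cexp (zc v) * cexp (- alpha * xc v)),
      Phi v 0 1 = qc v + - alpha^-1 * cexp (- alpha * xc v)
                  + - 2 * pc v * cexp (- alpha * xc v),
      Phi v 0 2 = (- 1 * yc v + - alpha^-1) * cexp (zc v),
      Phi v 0 3 = - 1 * cexp (- 1 * zc v) * pc v &
      Phi v 0 4 = (- 4 * (cexp (zc v) * cexp (zc v) * cexp (- alpha * xc v))
                   * (yc v + - alpha))^-1].
Proof.
have E1 : - (alpha * xc v) = - alpha * xc v by rewrite mulNr.
split; rewrite [LHS]mxE /= ?cexpD ?E1.
- by [].
- by move: (cexp _) => e; ring.
- by move: (cexp _) => e; field.
- by rewrite !mulN1r.
- rewrite (_ : 2 * zc v = zc v + zc v); last by ring.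
  by rewrite cexpD -invrN; congr (_^-1); ring.
Qed.

Lemma Phi_barx v : Phi v 0 0 = barx (A v) (Z v).
Proof. by have [-> _ _ _ _] := bar_coordinatesE v; rewrite mulNr cexpN. Qed.

Lemma Phi_barz v : Phi v 0 2 = barz alpha (yc v) (Z v).
Proof. by have [_ _ -> _ _] := bar_coordinatesE v; rewrite /barz; field. Qed.

Lemma Phi_barp v : Phi v 0 3 = barp (pc v) (Z v).
Proof. by have [_ _ _ -> _] := bar_coordinatesE v; rewrite !mulN1r cexpN. Qed.

Lemma Phi_barq v : Phi v 0 4 = barq alpha (yc v) (A v) (Z v).
Proof.
have [_ _ _ _ ->] := bar_coordinatesE v.
have E : cexp (- alpha * xc v) = (A v)^-1 by rewrite mulNr cexpN.
rewrite E /barq -invrN; congr (_^-1); ring.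
Qed.

Lemma exp_alphaN u : cexp (- alpha * u 0 0) = (A u)^-1.
Proof. by rewrite mulNr cexpN. Qed.

Lemma has_diff_bar0 u : has_diff (fun v => Phi v 0 0) u (d_barx alpha (A u) (Z u)).
Proof.
rewrite (_ : (fun v => _) = fun v : C5 => 2 * (cexp (v 0 2) * cexp (- alpha * v 0 0))); last first.
  by apply: funext => v; have [] := bar_coordinatesE v.
eapply has_diff_eq; first has_diff_tac.
exact: d_barxE (exp_alphaN u).
Qed.

Lemma has_diff_bar1 u : has_diff (fun v => Phi v 0 1) u (d_bary alpha (pc u) (A u)).
Proof.
rewrite (_ : (fun v => _) = fun v : C5 => v 0 4 + - alpha^-1 * cexp (- alpha * v 0 0)
   + - 2 * v 0 3 * cexp (- alpha * v 0 0)); last first.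
  by apply: funext => v; have [] := bar_coordinatesE v.
eapply has_diff_eq; first has_diff_tac.
exact: d_baryE alpha_neq0 (exp_alphaN u).
Qed.

Lemma has_diff_bar2 u : has_diff (fun v => Phi v 0 2) u (d_barz alpha (yc u) (Z u)).
Proof.
rewrite (_ : (fun v => _) = fun v : C5 => (- 1 * v 0 1 + - alpha^-1) * cexp (v 0 2)); last first.
  by apply: funext => v; have [] := bar_coordinatesE v.
eapply has_diff_eq; first has_diff_tac.
exact: d_barzE alpha_neq0.
Qed.

Lemma has_diff_bar3 u : has_diff (fun v => Phi v 0 3) u (d_barp (pc u) (Z u)).
Proof.
rewrite (_ : (fun v => _) = fun v : C5 => - 1 * cexp (- 1 * v 0 2) * v 0 3); last first.
  by apply: funext => v; have [] := bar_coordinatesE v.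
eapply has_diff_eq; first has_diff_tac.
apply: d_barpE; by rewrite mulN1r cexpN.
Qed.

Lemma barq_denominator_neq0 u : yc u != alpha ->
  - 4 * (cexp (zc u) * cexp (zc u) * cexp (- alpha * xc u)) * (yc u + - alpha) != 0.
Proof.
move=> ya; rewrite !mulf_neq0 ?cexp_neq0 ?oppr_eq0 ?pnatr_eq0 //.
by rewrite subr_eq0.
Qed.

Lemma differentiable_bar4 u : yc u != alpha -> differentiable (fun v => Phi v 0 4) u.
Proof.
move=> ya.
rewrite (_ : (fun v => _) = fun v : C5 => (- 4 * (cexp (v 0 2) * cexp (v 0 2)
   * cexp (- alpha * v 0 0)) * (v 0 1 + - alpha))^-1); last first.
  by apply: funext => v; have [] := bar_coordinatesE v.
apply: differentiableV; last exact: barq_denominator_neq0.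
eapply has_diff_differentiable; has_diff_tac.
Qed.

Lemma holo_bar_coordinates : holo [set u : C5 | yc u != alpha] Phi.
Proof.
move=> u ya; apply: differentiable_row; apply: ord5P.
- exact: has_diff_differentiable (has_diff_bar0 u).
- exact: has_diff_differentiable (has_diff_bar1 u).
- exact: has_diff_differentiable (has_diff_bar2 u).
- exact: has_diff_differentiable (has_diff_bar3 u).
- exact: differentiable_bar4.
Qed.

Lemma pullback_dk (eta : C5 -> C5) u (k : 'I_5) (a b : C) : 
  eta (Phi u) = a *: ebasis R k - b *: ebasis R 0 ->
  pullback Phi eta u = a *: fdiff (fun v => Phi v 0 k) u - b *: fdiff (fun v => Phi v 0 0) u.
Proof.
move=> E; rewrite /pullback E.
exact: (sum_two_coords (fun k => fdiff (fun v => Phi v 0 k) u)).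
Qed.

Lemma pullback_monge u :
  [/\ pullback Phi (@monge1 R) u =
        d_bary alpha (pc u) (A u) - barp (pc u) (Z u) *: d_barx alpha (A u) (Z u),
      pullback Phi (@monge2 R) u =
        d_barp (pc u) (Z u) - barq alpha (yc u) (A u) (Z u) *: d_barx alpha (A u) (Z u) &
      pullback Phi (monge3 alpha) u =
        d_barz alpha (yc u) (Z u)
        - monge_slope alpha (yc u) (A u) (Z u) *: d_barx alpha (A u) (Z u)].
Proof.
have D0 := has_diff_fdiff (has_diff_bar0 u).
have D1 := has_diff_fdiff (has_diff_bar1 u).
have D2 := has_diff_fdiff (has_diff_bar2 u).
have D3 := has_diff_fdiff (has_diff_bar3 u).
have H (k : 'I_5) (b : C) eta dk : eta (Phi u) = ebasis R k - b *: ebasis R 0 ->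
    fdiff (fun v => Phi v 0 k) u = dk ->
    pullback Phi eta u = dk - b *: d_barx alpha (A u) (Z u).
  move=> E Ek; refine (etrans (@pullback_dk eta u k 1 b (etrans E _)) _).
    exact (congr1 (fun x : C5 => x - b *: ebasis R 0) (esym (scale1r (ebasis R k)))).
  exact (congr2 (fun x y : C5 => x - b *: y) (etrans (scale1r _) Ek) D0).
split.
- apply: H D1.
  exact (congr1 (fun b : C => ebasis R 1 - b *: ebasis R 0) (Phi_barp u)).
- apply: H D3.
  exact (congr1 (fun b : C => ebasis R 3 - b *: ebasis R 0) (Phi_barq u)).
- apply: H D2.
  rewrite /monge3 /monge_square /monge_slope.
  have -> : qc (Phi u) = barq alpha (yc u) (A u) (Z u) := Phi_barq u.
  have -> : zc (Phi u) = barz alpha (yc u) (Z u) := Phi_barz u.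
  have -> : xc (Phi u) = barx (A u) (Z u) := Phi_barx u.
  by [].
Qed.

End MongeForms.

Section FormSpans.
Variable R : realType.
Local Notation C := (CC R).
Local Notation C5 := (C5 R).

Lemma form_span_sub (U : set C5) n m (w : 'I_n -> C5 -> C5) (w' : 'I_m -> C5 -> C5) :
  (forall k, form_span U w' (w k)) -> form_span U w `<=` form_span U w'.
Proof.
move=> /choice [f fE] eta [g gE].
exists (fun j u => \sum_k g k u * f k j u) => u Uu.
rewrite gE //; under [RHS]eq_bigr => j _ do rewrite scaler_suml.
rewrite exchange_big; apply: eq_bigr => k _.
by rewrite fE // scaler_sumr; apply: eq_bigr => j _; rewrite scalerA.
Qed.

Lemma form_span3 (U : set C5) (w : 'I_3 -> C5 -> C5) eta (a b c : C5 -> C) :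
  (forall u, U u -> eta u = a u *: w 0 u + b u *: w 1 u + c u *: w 2 u) ->
  form_span U w eta.
Proof.
move=> E; exists (fun k u => nth 0 [:: a u; b u; c u] k) => u Uu.
exact: etrans (E u Uu) (esym (sum_I3 _)).
Qed.

End FormSpans.

Lemma ord3P (P : 'I_3 -> Prop) : P 0 -> P 1 -> P 2 -> forall i, P i.
Proof.
move=> P0 P1 P2 [[|[|[|//]]] i].
- by rewrite (_ : Ordinal i = 0) //; apply: val_inj.
- by rewrite (_ : Ordinal i = 1) //; apply: val_inj.
- by rewrite (_ : Ordinal i = 2) //; apply: val_inj.
Qed.

(* The combinations of one or two of the vectors x, y, z that occur below, with
   all three coefficients made explicit. *)
Section Combinations.
Variables (K : pzRingType) (V : lmodType K) (a b c : K) (x y z : V).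

Lemma combD : a *: (x + y) = a *: x + a *: y + 0 *: z.
Proof. by rewrite scale0r addr0 scalerDr. Qed.

Lemma combB : a *: (x - y) = a *: x + - a *: y + 0 *: z.
Proof. by rewrite scale0r addr0 scalerBr scaleNr. Qed.

Lemma comb3 : a *: z = 0 *: x + 0 *: y + a *: z.
Proof. by rewrite !scale0r !add0r. Qed.

Lemma comb2D : a *: (b *: x + y) = (a * b) *: x + a *: y + 0 *: z.
Proof. by rewrite scale0r addr0 scalerDr scalerA. Qed.

Lemma comb2B : a *: (b *: x - y) = (a * b) *: x + - a *: y + 0 *: z.
Proof. by rewrite scale0r addr0 scalerBr scalerA scaleNr. Qed.

Lemma comb_yz : a *: (b *: y + z) = 0 *: x + (a * b) *: y + a *: z.
Proof. by rewrite scale0r add0r scalerDr scalerA. Qed.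

Lemma comb1 : a *: x = a *: x + 0 *: y + 0 *: z.
Proof. by rewrite !scale0r !addr0. Qed.

Lemma comb2 : a *: y = 0 *: x + a *: y + 0 *: z.
Proof. by rewrite !scale0r addr0 add0r. Qed.

Lemma comb_swap : a *: y + b *: x = b *: x + a *: y + 0 *: z.
Proof. by rewrite scale0r addr0 addrC. Qed.

Lemma comb_triangular d e :
  c *: z - a *: x + b *: (d *: y + e *: x) = (b * e - a) *: x + (b * d) *: y + c *: z.
Proof.
rewrite scalerDr !scalerA scalerBl -addrA addrC; congr (_ + _).
by rewrite [_ *: y + _]addrC addrCA addrA.
Qed.

End Combinations.

Section MongeSpan.
Variables (R : realType) (alpha : CC R).
Hypothesis alpha_neq0 : alpha != 0.
Hypothesis alpha2_neq : alpha ^+ 2 != -1.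
Local Notation C := (CC R).
Local Notation C5 := (C5 R).
Local Notation Phi := (bar_coordinates alpha).
Local Notation U := [set u : C5 | yc u != alpha].
Local Notation theta := (fun k => invariant_form alpha (contact_form C k)).

Lemma span_omega : form_span U (omega alpha) = form_span U theta.
Proof.
apply/seteqP; split; apply: form_span_sub; apply: ord3P.
- apply: form_span3 => u _; have [E _ _] := omegaE alpha_neq0 u.
  exact: etrans E (combD _ _ _ _).
- apply: form_span3 => u _; have [_ E _] := omegaE alpha_neq0 u.
  exact: etrans E (combB _ _ _ _).
- apply: form_span3 => u _; have [_ _ E] := omegaE alpha_neq0 u.
  exact: etrans E (comb3 _ _ _ _).
- apply: form_span3 => u _; have [E _ _] := contact_omegaE alpha_neq0 u.
  exact: etrans E (comb2D _ _ _ _ _).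
- apply: form_span3 => u _; have [_ E _] := contact_omegaE alpha_neq0 u.
  exact: etrans E (comb2B _ _ _ _ _).
- apply: form_span3 => u _; have [_ _ E] := contact_omegaE alpha_neq0 u.
  exact: etrans E (comb3 _ _ _ _).
Qed.

Lemma span_monge : form_span U (fun k => pullback Phi (monge alpha k)) = form_span U theta.
Proof.
have al2 : alpha ^+ 2 + 1 != 0 by rewrite addr_eq0.
have rows u (Uu : U u) := monge_rows (pc u) alpha_neq0 al2
  (eq_ind_r (fun b => ~~ b) Uu (subr_eq0 _ _)) (cexp_neq0 (alpha * xc u)) (cexp_neq0 (zc u)).
have pb := pullback_monge alpha_neq0.
have rows' u (Uu : U u) := let: And3 F1 F2 F3 := pb u in
  contact_rows_monge alpha_neq0 al2
  (eq_ind_r (fun b => ~~ b) Uu (subr_eq0 _ _)) (cexp_neq0 (alpha * xc u)) (cexp_neq0 (zc u))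
  F1 F2 F3.
apply/seteqP; split; apply: form_span_sub; apply: ord3P.
- apply: form_span3 => u Uu; have [E _ _] := rows u Uu; have [F _ _] := pb u.
  exact: etrans F (etrans E (comb2 _ _ _ _)).
- apply: form_span3 => u Uu; have [_ E _] := rows u Uu; have [_ F _] := pb u.
  exact: etrans F (etrans E (comb_yz _ _ _ _ _)).
- apply: form_span3 => u Uu; have [_ _ E] := rows u Uu; have [_ _ F] := pb u.
  exact: etrans F E.
- apply: form_span3 => u Uu; have [_ _ E] := rows' u Uu.
  exact: etrans E (comb_triangular _ _ _ _ _ _ _ _).
- apply: form_span3 => u Uu; have [E _ _] := rows' u Uu.
  exact: etrans E (comb1 _ _ _ _).
- apply: form_span3 => u Uu; have [_ E _] := rows' u Uu.
  exact: etrans E (comb_swap _ _ _ _ _).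
Qed.

End MongeSpan.

(** * The inverse change of coordinates *)

Section InverseAlgebra.
Variables (K : numFieldType) (al : K).
Hypotheses (al0 : al != 0) (al2 : al ^+ 2 + 1 != 0).

(** From bar q and bar x one gets (y - alpha) Z = - 1 / (2 bar x bar q), and
    bar z is - (y + 1/alpha) Z; subtracting eliminates y and leaves the factor
    alpha + 1/alpha of Z. *)
Definition recover_Z (bx bz bq : K) := al / (al ^+ 2 + 1) * ((2 * bx * bq)^-1 - bz).
Definition recover_A (bx bz bq : K) := 2 * recover_Z bx bz bq / bx.
Definition recover_y (bx bz bq : K) := al - (2 * bx * bq * recover_Z bx bz bq)^-1.

Section Forth.
Variables (y A Z : K).
Hypotheses (ya : y - al != 0) (A0 : A != 0) (Z0 : Z != 0).

Let two0 : (2 : K) != 0. Proof. by rewrite pnatr_eq0. Qed.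

Lemma barx_neq0 : barx A Z != 0.
Proof. by rewrite /barx !mulf_neq0 ?invr_neq0. Qed.

Lemma barq_neq0 : barq al y A Z != 0.
Proof.
by rewrite /barq oppr_eq0 invr_eq0 !mulf_neq0 ?invr_neq0 ?expf_neq0 ?pnatr_eq0.
Qed.

Lemma barp_inverse p : - barp p Z * Z = p.
Proof. by rewrite /barp; field. Qed.

Lemma barp_recover p : barp (- p * Z) Z = p.
Proof. by rewrite /barp; field. Qed.

Lemma bary_inverse q p ai :
  q + - al^-1 * ai + - 2 * p * ai + al^-1 * ai + 2 * p * ai = q.
Proof. ring. Qed.

Lemma bary_recover q p ai :
  q + al^-1 * ai + 2 * p * ai + - al^-1 * ai + - 2 * p * ai = q.
Proof. ring. Qed.

Lemma recover_ZE : recover_Z (barx A Z) (barz al y Z) (barq al y A Z) = Z.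
Proof.
by rewrite /recover_Z /barx /barz /barq; field; rewrite ?al0 ?al2 ?ya ?A0 ?Z0 ?two0.
Qed.

Lemma recover_AE : recover_A (barx A Z) (barz al y Z) (barq al y A Z) = A.
Proof. by rewrite /recover_A recover_ZE /barx; field; rewrite ?A0 ?Z0 ?two0. Qed.

Lemma recover_yE : recover_y (barx A Z) (barz al y Z) (barq al y A Z) = y.
Proof.
by rewrite /recover_y recover_ZE /barx /barq; field; rewrite ?al0 ?al2 ?ya ?A0 ?Z0 ?two0.
Qed.

End Forth.

Variables (bx bz bq : K).
Hypotheses (bx0 : bx != 0) (bq0 : bq != 0).
Local Notation Z := (recover_Z bx bz bq).
Local Notation A := (recover_A bx bz bq).
Local Notation y := (recover_y bx bz bq).
Hypothesis Z0 : Z != 0.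

Lemma recover_y_neq : y - al != 0.
Proof.
rewrite /recover_y addrAC subrr sub0r oppr_eq0 invr_eq0; move: Z Z0 => z z0.
by rewrite !mulf_neq0 ?pnatr_eq0.
Qed.

Lemma barx_recover : barx A Z = bx.
Proof.
rewrite /barx /recover_A; move: Z Z0 => z z0; field.
by rewrite bx0 z0.
Qed.

Lemma barq_recover : barq al y A Z = bq.
Proof.
rewrite /barq /recover_y /recover_A; move: Z Z0 => z z0.
rewrite [_ - al](_ : _ = - (2 * bx * bq * z)^-1); last by rewrite addrAC subrr sub0r.
by field; rewrite bx0 bq0 z0 ?pnatr_eq0.
Qed.

Lemma barz_recover : barz al y Z = bz.
Proof.
have E : Z = al / (al ^+ 2 + 1) * ((2 * bx * bq)^-1 - bz) by [].
have -> : barz al y Z = - ((al ^+ 2 + 1) / al * Z) + (2 * bx * bq)^-1.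
  rewrite /barz /recover_y; move: Z Z0 => z z0; field.
  by rewrite al0 bx0 bq0 z0 ?pnatr_eq0.
by rewrite E; move: ((2 * bx * bq)^-1) => i; field; rewrite al0 al2.
Qed.

End InverseAlgebra.

Section LocalCoordinates.
Variables (R : realType) (alpha : CC R).
Hypothesis alpha_neq0 : alpha != 0.
Hypothesis alpha2_neq : alpha ^+ 2 != -1.
Local Notation C := (CC R).
Local Notation C5 := (C5 R).
Local Notation Phi := (bar_coordinates alpha).
Local Notation U := [set u : C5 | yc u != alpha].
Implicit Types (u v : C5).

Let al2 : alpha ^+ 2 + 1 != 0. Proof. by rewrite addr_eq0. Qed.

Definition rec_Z v : C := recover_Z alpha (v 0 0) (v 0 2) (v 0 4).
Definition rec_A v : C := recover_A alpha (v 0 0) (v 0 2) (v 0 4).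

Lemma rec_Phi u : U u ->
  [/\ rec_Z (Phi u) = cexp (zc u), rec_A (Phi u) = cexp (alpha * xc u) &
      recover_y alpha (Phi u 0 0) (Phi u 0 2) (Phi u 0 4) = yc u].
Proof.
move=> Uu; have ya : yc u - alpha != 0 by rewrite subr_eq0.
rewrite /rec_Z /rec_A Phi_barx // Phi_barz // Phi_barq //.
have A0 := cexp_neq0 (alpha * xc u); have Z0 := cexp_neq0 (zc u).
by split; [apply: recover_ZE|apply: recover_AE|apply: recover_yE].
Qed.

Variable u0 : C5.

(** The exponentials are divided by their values at the base point, so that
    the principal logarithm applies near it and the result is the branch that
    returns the coordinates of the base point. *)
Definition local_inverse v : C5 :=
  let p := - v 0 3 * rec_Z v in
  \row_k [tuple xc u0 + alpha^-1 * clog (rec_A v / cexp (alpha * xc u0));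
                recover_y alpha (v 0 0) (v 0 2) (v 0 4);
                zc u0 + clog (rec_Z v / cexp (zc u0));
                p;
                v 0 1 + alpha^-1 * (rec_A v)^-1 + 2 * p * (rec_A v)^-1]`_k.

(** The two strips are those on which the principal logarithm inverts the
    exponential, and [target] is the matching condition on the image. *)
Definition source : set C5 := [set v : C5 | [/\ yc v != alpha,
  - (pi / 2) < complex.Im (zc v - zc u0) < pi / 2 &
  - (pi / 2) < complex.Im (alpha * (xc v - xc u0)) < pi / 2]].

Definition target : set C5 := [set v : C5 | [/\ v 0 0 != 0, v 0 4 != 0,
  0 < complex.Re (rec_Z v / cexp (zc u0)) &
  0 < complex.Re (rec_A v / cexp (alpha * xc u0))]].

Lemma target_neq0 v : target v -> rec_Z v != 0 /\ rec_A v != 0.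
Proof.
move=> [_ _ Z0 A0]; split; apply/eqP => E.
  by move: Z0; rewrite E mul0r ltxx.
by move: A0; rewrite E mul0r ltxx.
Qed.

Lemma differentiable_rec_Z (v : C5) : v 0 0 != 0 -> v 0 4 != 0 -> differentiable rec_Z v.
Proof.
move=> v0 v4; apply: differentiable_mul; first exact: differentiable_const.
apply: differentiable_add; last exact/differentiable_opp/differentiable_coordinate.
apply: differentiableV; last by rewrite !mulf_neq0 ?pnatr_eq0.
apply: differentiable_mul; last exact: differentiable_coordinate.
by apply: differentiable_mul; [exact: differentiable_const|exact: differentiable_coordinate].
Qed.

Lemma differentiable_rec_A (v : C5) : v 0 0 != 0 -> v 0 4 != 0 -> differentiable rec_A v.
Proof.
move=> v0 v4; apply: differentiable_mul.
  apply: differentiable_mul; first exact: differentiable_const.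
  exact: differentiable_rec_Z.
by apply: differentiableV => //; exact: differentiable_coordinate.
Qed.

Lemma holo_local_inverse : holo target local_inverse.
Proof.
move=> v tv; have [v0 v4 Z0 A0] := tv; have [Zn An] := target_neq0 tv.
have dZ := differentiable_rec_Z v0 v4; have dA := differentiable_rec_A v0 v4.
have dp : differentiable (fun w : C5 => - w 0 3 * rec_Z w) v.
  by apply: differentiable_mul => //; exact/differentiable_opp/differentiable_coordinate.
have dAi : differentiable (fun w => (rec_A w)^-1) v by exact: differentiableV.
have E k : (fun w => local_inverse w 0 k) = fun w =>
   [tuple xc u0 + alpha^-1 * clog (rec_A w / cexp (alpha * xc u0));
          recover_y alpha (w 0 0) (w 0 2) (w 0 4);
          zc u0 + clog (rec_Z w / cexp (zc u0));
          - w 0 3 * rec_Z w;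
          w 0 1 + alpha^-1 * (rec_A w)^-1 + 2 * (- w 0 3 * rec_Z w) * (rec_A w)^-1]`_k.
  by apply: funext => w; exact: mxE.
have dc (c : C) : differentiable (fun _ : C5 => c) v := differentiable_const c v.
have dco k : differentiable (fun w : C5 => w 0 k : C) v := differentiable_coordinate k v.
have two0 : (2 : C) != 0 by rewrite pnatr_eq0.
apply: differentiable_row; apply: ord5P; rewrite E /=.
- have dq := differentiable_mul dA (dc (cexp (alpha * xc u0))^-1).
  exact: (differentiable_add (dc _) (differentiable_mul (dc _) (differentiable_log dq A0))).
- have dq := differentiable_mul (differentiable_mul (differentiable_mul (dc 2) (dco 0)) (dco 4)) dZ.
  have q0 := mulf_neq0 (mulf_neq0 (mulf_neq0 two0 v0) v4) Zn.
  exact: (differentiable_add (dc _) (differentiable_opp (differentiableV dq q0))).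
- have dq := differentiable_mul dZ (dc (cexp (zc u0))^-1).
  exact: (differentiable_add (dc _) (differentiable_log dq Z0)).
- exact: dp.
- exact: (differentiable_add (differentiable_add (dco 1) (differentiable_mul (dc _) dAi))
    (differentiable_mul (differentiable_mul (dc 2) dp) dAi)).
Qed.

Lemma open_source : open source.
Proof.
rewrite openE => v [ya hz hx].
have H1 := near_open (differentiable_coordinate 1 v) (@open_neqC R alpha) ya.
have dz : differentiable (fun w : C5 => w 0 2 + - zc u0) v.
  by apply: differentiable_add; [exact: differentiable_coordinate|exact: differentiable_const].
have H2 := near_open dz (@open_strip R) hz.
have dx : differentiable (fun w : C5 => alpha * (w 0 0 + - xc u0)) v.
  apply: differentiable_mul; first exact: differentiable_const.
  by apply: differentiable_add; [exact: differentiable_coordinate|exact: differentiable_const].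
have H3 := near_open dx (@open_strip R) hx.
by near=> w; split; near: w.
Unshelve. all: by end_near. Qed.

Lemma open_target : open target.
Proof.
rewrite openE => v [v0 v4 hZ hA].
have H1 := near_open (differentiable_coordinate 0 v) (@open_neqC R 0) v0.
have H2 := near_open (differentiable_coordinate 4 v) (@open_neqC R 0) v4.
have dZ : differentiable (fun w => rec_Z w / cexp (zc u0)) v.
  apply: differentiable_mul; last exact: differentiable_const.
  exact: differentiable_rec_Z.
have H3 := near_open dZ (@open_right_half_plane R) hZ.
have dA : differentiable (fun w => rec_A w / cexp (alpha * xc u0)) v.
  apply: differentiable_mul; last exact: differentiable_const.
  exact: differentiable_rec_A.
have H4 := near_open dA (@open_right_half_plane R) hA.
by near=> w; split; near: w.
Unshelve. all: by end_near. Qed.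

Lemma local_inverseE (v : C5) : let psi := local_inverse v in
  [/\ xc psi = xc u0 + alpha^-1 * clog (rec_A v / cexp (alpha * xc u0)),
      yc psi = recover_y alpha (v 0 0) (v 0 2) (v 0 4),
      zc psi = zc u0 + clog (rec_Z v / cexp (zc u0)),
      pc psi = - v 0 3 * rec_Z v &
      qc psi = v 0 1 + alpha^-1 * (rec_A v)^-1
               + 2 * (- v 0 3 * rec_Z v) * (rec_A v)^-1].
Proof. by split; exact: mxE. Qed.

Lemma local_inverse_Phi v : source v -> target (Phi v) /\ local_inverse (Phi v) = v.
Proof.
move=> [ya hz hx]; have [ZE AE yE] := rec_Phi ya.
have ya' : yc v - alpha != 0 by rewrite subr_eq0.
have A0 := cexp_neq0 (alpha * xc v); have Z0 := cexp_neq0 (zc v).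
have zE : rec_Z (Phi v) / cexp (zc u0) = cexp (zc v - zc u0).
  by rewrite ZE cexpD cexpN.
have xE : rec_A (Phi v) / cexp (alpha * xc u0) = cexp (alpha * (xc v - xc u0)).
  by rewrite AE mulrBr cexpD cexpN.
split.
  split.
  - by rewrite (Phi_barx alpha_neq0 v) (barx_neq0 A0 Z0).
  - by rewrite (Phi_barq alpha_neq0 v) (barq_neq0 ya' A0 Z0).
  - by rewrite zE (Re_cexp_gt0 hz).
  - by rewrite xE (Re_cexp_gt0 hx).
have [Ex Ey Ez Ep Eq] := local_inverseE (Phi v).
apply: rowP5.
- refine (etrans Ex _); rewrite xE cexpK // mulKf // addrC subrK //.
- exact: etrans Ey yE.
- refine (etrans Ez _); rewrite zE cexpK // addrC subrK //.
- refine (etrans Ep _); rewrite ZE Phi_barp //; exact: barp_inverse.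
- refine (etrans Eq _); rewrite AE ZE Phi_barp // barp_inverse //.
  have [_ -> _ _ _] := bar_coordinatesE alpha_neq0 v.
  have -> : cexp (- alpha * xc v) = (cexp (alpha * xc v))^-1 by rewrite mulNr cexpN.
  exact: bary_inverse.
Qed.

Lemma Phi_local_inverse (v : C5) :
  target v -> source (local_inverse v) /\ Phi (local_inverse v) = v.
Proof.
move=> tv; have [v0 v4 hZ hA] := tv; have [Z0 A0] := target_neq0 tv.
have [Ex Ey Ez Ep Eq] := local_inverseE v; set psi := local_inverse v in Ex Ey Ez Ep Eq *.
have zE : cexp (zc psi) = rec_Z v.
  by rewrite Ez cexpD clogK // mulrCA divff ?mulr1 // cexp_neq0.
have xE : cexp (alpha * xc psi) = rec_A v.
  rewrite Ex mulrDr [alpha * (_ * _)]mulrA divff // mul1r cexpD clogK //.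
  by rewrite mulrCA divff ?mulr1 // cexp_neq0.
split.
  split.
  - by rewrite Ey -subr_eq0; exact: recover_y_neq.
  - by rewrite Ez addrAC subrr add0r; exact: Im_clog_bound.
  - by rewrite Ex addrAC subrr add0r mulrA divff // mul1r; exact: Im_clog_bound.
apply: rowP5.
- refine (etrans (Phi_barx alpha_neq0 psi) _); rewrite xE zE; exact: barx_recover.
- have [_ E _ _ _] := bar_coordinatesE alpha_neq0 psi; refine (etrans E _).
  have -> : cexp (- alpha * xc psi) = (rec_A v)^-1 by rewrite -xE mulNr cexpN.
  rewrite Eq Ep; exact: bary_recover.
- refine (etrans (Phi_barz alpha_neq0 psi) _); rewrite zE Ey; exact: barz_recover.
- refine (etrans (Phi_barp alpha_neq0 psi) _); rewrite zE Ep; exact: barp_recover.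
- refine (etrans (Phi_barq alpha_neq0 psi) _); rewrite xE zE Ey; exact: barq_recover.
Qed.

End LocalCoordinates.

Lemma bar_local_coordinates (R : realType) (alpha : CC R) :
  alpha != 0 -> alpha ^+ 2 != -1 ->
  local_coordinates [set u : 'rV[CC R]_5 | yc u != alpha] (bar_coordinates alpha).
Proof.
move=> a0 a2; split; first exact: holo_bar_coordinates.
move=> u0 Uu; exists (source alpha u0), (target alpha u0), (local_inverse alpha u0); split.
- split; first exact: open_source.
    have h : - (pi / 2) < (0 : R) < pi / 2 by rewrite oppr_lt0 !divr_gt0 ?pi_gt0.
    by split; rewrite ?subrr ?mulr0.
  by move=> v [].
- split; first exact: open_target.
  exact: holo_local_inverse.
- by move=> v; exact: local_inverse_Phi.
- by move=> v; exact: Phi_local_inverse.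
Qed.

(** * Normal form, local coordinates and flat parameters *)

Theorem theorem3p1 (R : realType) (alpha : CC R)
    (alpha_neq0 : alpha != 0) (alpha2_neq : alpha ^+ 2 != -1) :
  let U := [set u : 'rV[CC R]_5 | yc u != alpha] in
  let Phi := bar_coordinates alpha in
  [/\ local_coordinates U Phi,
      form_span U (omega alpha)
        = form_span U (fun k => pullback Phi (monge alpha k)) &
      alpha ^+ 2 = - 9^-1 \/ alpha ^+ 2 = - 9 ->
        maximally_symmetric U (annihilator (omega alpha))].
Proof.
split; first exact: bar_local_coordinates.
- exact: etrans (span_omega alpha_neq0) (esym (span_monge alpha_neq0 alpha2_neq)).
- exact: rolling_maximally_symmetric.
Qed.
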